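(* There exist sequences $D_2,D_3,\dots$ and $L_2,L_3,\dots$ of positive absolute constants with \[ \lim_{n\to\infty}D_n=\lim_{p\to0}C_{\{1,2\}}(p)<1.2183,\qquad \lim_{n\to\infty}L_n=\lim_{p\to0}C_{J_{sym}}(p)<0.5893, \] such that the following holds. Let $n\geqslant 2$, let $X_1,\dots,X_n$ be independent real random variables with $\mathbb{E}X_j=0$, $\mathbb{E}X_j^2=1$, let $S_n=(X_1+\cdots+X_n)/\sqrt n$ and $\Delta=\frac1n\sum_{j=1}^n\chi^2(X_j,\mathcal N)$. Then \[ \chi^2(S_n,\mathcal N)\leqslant\frac{\Delta}{n-1}\left(1+\sum_{k=2}^n D_nD_{n-1}\cdots D_{n-k+2}\,\Delta^{k-1}\right). \] If in addition all $X_j$ are symmetric (i.e. $-X_j$ has the same distribution as $X_j$), then \[ \chi^2(S_n,\mathcal N)\leqslant\frac{\Delta}{n^2-1}\left(1+\sum_{k=2}^n L_nL_{n-1}\cdots L_{n-k+2}\,\Delta^{k-1}\right). \]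
   Context: $\varphi(x)=e^{-x^2/2}/\sqrt{2\pi}$. For a real random variable $Y$ with density $p$, $\chi^2(Y,\mathcal N)=\int_{-\infty}^{\infty}\left(\frac{p(x)}{\varphi(x)}-1\right)^2\varphi(x)\,dx$ (taken to be $+\infty$ if $Y$ has no density). $\mathbb{Z}^+$ is the set of positive integers. For $J\subset\mathbb{Z}^+$, $s\in\mathbb{Z}^+$, $0<p<1$: $h_J(s,p)=\frac{(1-p)^s}{p^2}\sum_{k\in\mathbb{Z}^+\setminus J}\frac{k^2}{(k+s)^2}\binom{k+s}{k}p^k$ and $C_J(p)=\max_{s\in\mathbb{Z}^+}h_J(s,p)$. $J_{sym}=\{2\}\cup\{2m+1:m\geqslant0\}$. *)

(* Defs.v *)
From HB Require Import structures.
From mathcomp Require Import all_boot all_order all_algebra.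
From mathcomp Require Import all_classical all_reals all_analysis.
Import Order.TTheory GRing.Theory Num.Theory.
Import numFieldNormedType.Exports.
Set Implicit Arguments. Unset Strict Implicit. Unset Printing Implicit Defensive.
Local Open Scope classical_set_scope.
Local Open Scope ring_scope.

Definition gauss {R : realType} (x : R) : R :=
  expR (- (x ^+ 2) / 2) / Num.sqrt (pi *+ 2).

Definition is_density_of {R : realType} {d} {T : measurableType d}
  (P : probability T R) (Y : T -> R) (p : R -> R) : Prop :=
  [/\ measurable_fun setT p, (forall x, 0 <= p x) &
      forall A : set R, measurable A ->
        P (Y @^-1` A) = (\int[lebesgue_measure]_(x in A) (p x)%:E)%E].

(* chi^2(Y, N) = int (p/phi - 1)^2 phi dx, and +oo if Y has no density.
   All densities of Y agree a.e., so the infimum is the common value;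
   the infimum of the empty set is +oo. *)
Definition chi2 {R : realType} {d} {T : measurableType d}
  (P : probability T R) (Y : T -> R) : \bar R :=
  ereal_inf [set (\int[lebesgue_measure]_x
                    (((p x / gauss x - 1) ^+ 2 * gauss x)%:E))%E
            | p in is_density_of P Y].

Definition hJ {R : realType} (J : pred nat) (s : nat) (p : R) : \bar R :=
  (((1 - p) ^+ s / p ^+ 2)%:E *
   \sum_(1 <= k <oo | ~~ J k)
      ((k%:R ^+ 2 / (k + s)%:R ^+ 2 * 'C(k + s, k)%:R * p ^+ k)%:E))%E.

(* C_J(p) = max_{s in Z^+} h_J(s,p)  (taken as the supremum) *)
Definition CJ {R : realType} (J : pred nat) (p : R) : \bar R :=
  ereal_sup (range (fun s : nat => hJ J s.+1 p)).

Definition J12 : pred nat := fun k => (k == 1)%N || (k == 2)%N.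
Definition Jsym : pred nat := fun k => (k == 2)%N || odd k.

Definition mutually_independent {R : realType} {d} {T : measurableType d}
  (P : probability T R) (n : nat) (X : 'I_n -> T -> R) : Prop :=
  forall A : 'I_n -> set R, (forall i, measurable (A i)) ->
    P (\bigcap_(i in [set: 'I_n]) (X i @^-1` A i)) =
    (\prod_(i < n) P (X i @^-1` A i))%E.

Definition symmetric_rv {R : realType} {d} {T : measurableType d}
  (P : probability T R) (Y : T -> R) : Prop :=
  forall A : set R, measurable A ->
    P (Y @^-1` A) = P ((fun w => - Y w) @^-1` A).

(* Main.v *)
Require Import Defs.
From HB Require Import structures.
From mathcomp Require Import all_boot all_order all_algebra.
From mathcomp Require Import all_classical all_reals all_analysis.
From mathcomp Require Import measurable_realfun.
From mathcomp Require Import ring lra zify.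
Import Order.TTheory GRing.Theory Num.Theory.
Import numFieldNormedType.Exports.
Local Open Scope classical_set_scope.
Local Open Scope ring_scope.

(* With Hermite polynomials [hermite v k] of variance [v], normalised so that
   [hermite (v + w) m] at [x + y] is the convolution of the two families, the
   moments [E (hermite k (X_1 + ... + X_k))_m] are the coefficients of the product
   of the polynomials [\sum_m E (hermite 1 m)(X_j) X^m], and [chi^2(S_n)] is the
   weighted square norm [\sum_m m!/n^m B_m^2] of the coefficients of that product.
   Writing [m B_m] as the coefficient of the derivative of the product and applying
   Cauchy-Schwarz with weights [h_J(s, 1/n)] bounds the norm of a product of [n]
   factors by norms of products of [n - 1] factors, which gives the recursion for
   [D_n]; the limit of [h_J(s, p)] along [s p -> x] is an explicit function of [x].

   Bessel's inequality gives one direction of the identity between [chi^2] and the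
   Hermite coefficients.  For the other one, finiteness of [E exp(c S_n^2)] makes
   polynomials dense in [L^2] of the sum of the law of [S_n] and of the Gaussian
   law, so that [2 E f(S_n) <= C + \int (2 f + f^2) dN] extends from polynomials to
   bounded measurable [f]; this forces absolute continuity, and truncations of
   [f = p/phi - 1] give [chi^2 <= C]. *)

(** * Energy of products of polynomials *)

(** [C_J] is a maximum over s >= 1 and so says nothing about s = 0, where the product of the other
    factors contributes only its constant coefficient 1. That row is the geometric sum of n^-k over
    k outside J, which produces the prefactors 1/(n - 1) and 1/(n^2 - 1). Removing X_j replaces
    Delta by the mean over the other n - 1 variables, which varies with j. Powers of these means are
    controlled by Delta only after averaging over j, for exponents at most n - 1. The series of h_J
    becomes explicitly summable once a factor 1 - 1/(k + s) is dropped from its terms. This bounds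
    h_J(s, p) by G + 3 p/(1 - p) for every s, with G the supremum of the limit profile; D_n and L_n
    are built from this bound rather than from C_J(1/n). The limits agree because the dropped factor
    tends to 1 along s ~ x/p. Density of polynomials is proved without Fourier analysis: the bounded
    functions that multiply polynomials into their L^2 closure form an algebra closed under bounded
    pointwise limits, and iterating one cubic polynomial yields sign functions in it. *)

Lemma cauchy_schwarz_sum (R : realFieldType) (I : Type) (r : seq I) (P : pred I)
    (w u v : I -> R) : (forall i, P i -> 0 < w i) ->
  (\sum_(i <- r | P i) u i * v i) ^+ 2 <=
  (\sum_(i <- r | P i) w i * u i ^+ 2) * (\sum_(i <- r | P i) v i ^+ 2 / w i).
Proof.
move=> w0.
set a := \sum_(i <- r | P i) w i * u i ^+ 2.
set b := \sum_(i <- r | P i) v i ^+ 2 / w i.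
set s := \sum_(i <- r | P i) u i * v i.
(* Lagrange's identity: the gap between the two sides is half of this double sum of weighted
   squares. *)
have : 0 <= \sum_(i <- r | P i) \sum_(j <- r | P j)
    w i * w j * (u i * (v j / w j) - u j * (v i / w i)) ^+ 2.
  apply: sumr_ge0 => i Pi; apply: sumr_ge0 => j Pj.
  by rewrite mulr_ge0 ?sqr_ge0// mulr_ge0// ltW// w0.
have -> : \sum_(i <- r | P i) \sum_(j <- r | P j)
    w i * w j * (u i * (v j / w j) - u j * (v i / w i)) ^+ 2 =
    2 * (a * b - s ^+ 2).
  transitivity (\sum_(i <- r | P i)
      (w i * u i ^+ 2 * b + v i ^+ 2 / w i * a - 2 * (u i * v i) * s)).
    apply: eq_bigr => i Pi; rewrite /a /b /s !mulr_sumr -big_split/= -sumrB.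
    have wi := w0 i Pi.
    by apply: eq_bigr => j /w0 wj; field; rewrite !gt_eqF.
  rewrite sumrB big_split/= -!mulr_suml -mulr_sumr -/a -/b -/s; ring.
by rewrite pmulr_rge0// subr_ge0.
Qed.

Lemma deriv_prod_set (R : comNzRingType) (T : finType) (P : T -> {poly R})
    (I : {set T}) :
  (\prod_(i in I) P i)^`() = \sum_(j in I) (P j)^`() * \prod_(i in I :\ j) P i.
Proof.
have [n] := ubnP #|I|; elim: n I => // n IH I In.
have [->|[k kI]] := set_0Vmem I; first by rewrite !big_set0 derivC.
rewrite (big_setD1 k)//= derivM IH; last by move: In; rewrite (cardsD1 k I) kI.
rewrite [in RHS](big_setD1 k)//=; congr (_ + _).
rewrite mulr_sumr; apply: eq_bigr => j; rewrite !inE => /andP[jk jI].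
rewrite [in RHS](big_setD1 k) /=; last by rewrite !inE eq_sym jk.
have -> : I :\ j :\ k = I :\ k :\ j by apply/setP => i; rewrite !inE andbCA.
by rewrite mulrCA.
Qed.

Lemma coef_prod_set (R : comNzRingType) (T : finType) (P : T -> {poly R})
    (I : {set T}) (m : nat) :
  (\prod_(i in I) P i)`_m *+ m = \sum_(j in I)
    \sum_(0 <= k < m.+1) ((P j)`_k *+ k) * (\prod_(i in I :\ j) P i)`_(m - k).
Proof.
case: m => [|m].
  by rewrite mulr0n big1// => j _; rewrite big_nat1 mulr0n mul0r.
rewrite -coef_deriv deriv_prod_set coef_sum; apply: eq_bigr => j _.
rewrite coefM big_nat_recl// mulr0n mul0r add0r big_mkord.
by apply: eq_bigr => k _; rewrite coef_deriv subSS.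
Qed.

(** The change of index s = m - k maps the triangle k <= m < N into the square k, s < N; this
    decouples the degree taken from one factor from the degree of the others. *)
Lemma le_sum_triangle (R : numDomainType) (N : nat) (F : nat -> nat -> R) :
  (forall k s, 0 <= F k s) ->
  \sum_(0 <= m < N) \sum_(0 <= k < m.+1) F k (m - k)%N <=
  \sum_(0 <= s < N) \sum_(0 <= k < N) F k s.
Proof.
move=> F0.
have -> : \sum_(0 <= m < N) \sum_(0 <= k < m.+1) F k (m - k)%N =
    \sum_(0 <= m < N) \sum_(0 <= k < N | (k < m.+1)%N) F k (m - k)%N.
  rewrite !big_nat; apply: eq_bigr => m /= mN.
  by rewrite (big_nat_widen _ _ N).
rewrite (exchange_big_dep_nat xpredT)//= [leRHS]exchange_big_nat/=.
apply: ler_sum => k _.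
have -> : \sum_(0 <= m < N | (k < m.+1)%N) F k (m - k)%N =
    \sum_(k <= m < N) F k (m - k)%N by rewrite (big_nat_widenl k 0).
rewrite -{1}[k](add0n k) big_addn.
under eq_bigr do rewrite addnK.
rewrite [leRHS](big_cat_nat (leq0n (N - k)) (leq_subr k N))/=.
by rewrite lerDl sumr_ge0.
Qed.

(** With [v] the number of factors, this is the part of degrees 1 to [M] of the series for
    chi^2(S_n). Degree 0 is the constant subtracted in p/phi - 1. The truncation keeps all sums
    finite; every bound is uniform in [M]. *)
Definition hermite_energy (R : fieldType) (M : nat) (v : R) (B : {poly R}) : R :=
  \sum_(1 <= m < M.+1) m`!%:R / v ^+ m * B`_m ^+ 2.

Lemma hermite_energy_ge0 (R : realFieldType) (M : nat) (v : R) (B : {poly R}) :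
  0 < v -> 0 <= hermite_energy R M v B.
Proof.
move=> v0; apply: sumr_ge0 => m _.
by rewrite mulr_ge0 ?sqr_ge0// divr_ge0// exprn_ge0// ltW.
Qed.

(** The origin of h_J: as n^-(l+s) = n^-l (1 - 1/n)^s (n - 1)^-s and (l + s)! = C(l+s, l) l! s!, the
    weight of degree l + s splits into the term k = l of h_J(s, 1/n), up to its factor p^-2, and the
    weight of degree s at variance n - 1. *)
Lemma hermite_weight_split (R : numFieldType) (n l s : nat) (b : R) :
  (1 < n)%N -> (0 < l)%N ->
  (l + s)`!%:R / n%:R ^+ (l + s) / (l + s)%:R ^+ 2 * ((l%:R * b) ^+ 2 / l`!%:R) =
  l%:R ^+ 2 / (l + s)%:R ^+ 2 * 'C(l + s, l)%:R * n%:R^-1 ^+ l * (1 - n%:R^-1) ^+ s *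
    (s`!%:R / (n%:R - 1) ^+ s * b ^+ 2).
Proof.
move=> n1 l0; rewrite -(bin_fact (leq_addr s l)) addKn !natrM.
have ls0 : (l + s)%:R != 0 :> R by rewrite pnatr_eq0 addn_eq0 negb_and -lt0n l0.
have lf0 : l`!%:R != 0 :> R by rewrite pnatr_eq0 -lt0n fact_gt0.
have n0 : n%:R != 0 :> R by rewrite pnatr_eq0 -lt0n ltnW.
have n10 : n%:R - 1 != 0 :> R by rewrite subr_eq0 (eqr_nat R n 1) gtn_eqF.
have -> : 1 - n%:R^-1 = (n%:R - 1) / n%:R :> R by rewrite mulrBl divff// mul1r.
move: (l`!%:R) (s`!%:R) lf0 => lf sf lf0; rewrite exprVn expr_div_n exprD.
by field; rewrite -natrD ls0 lf0 !expf_neq0.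
Qed.

(** Each factor [P j] is removed in turn. The row s = 0 is paid by [kappa], since the other factors
    have constant coefficient 1 there; the rows s >= 1 are paid by [C] times the energy of the other
    factors. *)
Lemma hermite_energy_step (R : realFieldType) (T : finType) (P : T -> {poly R})
    (J : pred nat) (M : nat) (I : {set T}) (kappa C : R) :
  (forall j, (P j)`_0 = 1) -> (forall j k, J k -> (P j)`_k = 0) ->
  (2 <= #|I|)%N -> 0 <= kappa -> 0 <= C ->
  \sum_(1 <= k < M.+1 | ~~ J k) (#|I|%:R^-1) ^+ k <= kappa / #|I|%:R ^+ 2 ->
  (forall s, (1 <= s)%N -> \sum_(1 <= k < M.+1 | ~~ J k)
      k%:R ^+ 2 / (k + s)%:R ^+ 2 * 'C(k + s, k)%:R * (#|I|%:R^-1) ^+ k *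
        (1 - #|I|%:R^-1) ^+ s <= C / #|I|%:R ^+ 2) ->
  hermite_energy R M #|I|%:R (\prod_(i in I) P i) <=
  #|I|%:R^-1 * \sum_(j in I) hermite_energy R M 1 (P j) *
    (kappa + C * hermite_energy R M #|I|.-1%:R (\prod_(i in I :\ j) P i)).
Proof.
move=> P0 PJ I2 k0 C0 H0 Hs.
set n := #|I|; set p := n%:R^-1 : R.
have n0 : (0 : R) < n%:R by rewrite ltr0n ltnW.
have n10 : (0 : R) < n.-1%:R by rewrite ltr0n -subn1 subn_gt0.
have nE : n.-1%:R = n%:R - 1 :> R by rewrite -subn1 natrB// ltnW.
pose Q j := \prod_(i in I :\ j) P i.
pose h k s : R := k%:R ^+ 2 / (k + s)%:R ^+ 2 * 'C(k + s, k)%:R * p ^+ k * (1 - p) ^+ s.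
pose W j s : R := s`!%:R / n.-1%:R ^+ s * (Q j)`_s ^+ 2.
have q0 : 0 < 1 - p by rewrite subr_gt0 /p invf_lt1// ltr1n.
have p0 : 0 < p by rewrite invr_gt0.
have h0 k s : 0 <= h k s.
  by rewrite /h !mulr_ge0 ?invr_ge0 ?exprn_ge0 ?ler0n// ltW.
have W0 j s : 0 <= W j s.
  by rewrite /W mulr_ge0 ?sqr_ge0// divr_ge0// exprn_ge0// ltW.
(* The share of degree k taken from [P j] and degree s from the other factors; it is 0 when k = 0 or
   k lies in [J]. *)
pose F j k s : R := if (1 <= k)%N && ~~ J k then h k s * W j s else 0.
have F0 j k s : 0 <= F j k s by rewrite /F; case: ifP => // _; rewrite mulr_ge0.
(* Cauchy-Schwarz is used twice: over the removed factor j, at the cost of n, and over its degree k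
   with weights k!, which splits off the energy of [P j]. *)
have key m : (1 <= m < M.+1)%N ->
    m`!%:R / n%:R ^+ m * (\prod_(i in I) P i)`_m ^+ 2 <=
    n%:R * \sum_(j in I) hermite_energy R M 1 (P j) * \sum_(0 <= k < m.+1) F j k (m - k)%N.
  move=> /andP[m1 mM].
  have m0 : (0 : R) < m%:R by rewrite ltr0n.
  pose y j := \sum_(0 <= k < m.+1) ((P j)`_k *+ k) * (Q j)`_(m - k).
  have -> : (\prod_(i in I) P i)`_m = (\sum_(j in I) y j) / m%:R.
    apply: (canRL (mulfK _)); first by rewrite gt_eqF.
    by rewrite mulr_natr coef_prod_set.
  have Hy : (\sum_(j in I) y j) ^+ 2 <= n%:R * \sum_(j in I) y j ^+ 2.
    have := @cauchy_schwarz_sum R T (index_enum T) (mem I) (fun=> 1) (fun=> 1) y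
      (fun _ _ => ltr01).
    under eq_bigr do rewrite mul1r.
    under [X in _ <= X * _]eq_bigr do rewrite mul1r expr1n.
    under [X in _ <= _ * X]eq_bigr do rewrite divr1.
    by rewrite sumr_const.
  have c0 : 0 <= m`!%:R / n%:R ^+ m / m%:R ^+ 2 :> R.
    by rewrite !divr_ge0// exprn_ge0// ltW.
  rewrite expr_div_n [leLHS]mulrCA [leLHS]mulrC.
  apply: (le_trans (ler_wpM2l c0 Hy)).
  rewrite mulrCA ler_pM2l// mulr_sumr; apply: ler_sum => j jI.
  have Hyj : y j ^+ 2 <= hermite_energy R M 1 (P j) *
      \sum_(1 <= k < m.+1 | ~~ J k) (k%:R * (Q j)`_(m - k)) ^+ 2 / k`!%:R.
    have -> : y j = \sum_(1 <= k < m.+1 | ~~ J k) (P j)`_k * (k%:R * (Q j)`_(m - k)).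
      rewrite /y big_nat_recl// mulr0n mul0r add0r big_add1/= [RHS]big_mkcond/=.
      apply: eq_bigr => k _; case: ifPn => [_|/negPn Jk].
        by rewrite mulrA mulr_natr.
      by rewrite PJ// mul0rn mul0r.
    apply: (le_trans (@cauchy_schwarz_sum _ _ _ _ (fun k => k`!%:R) _ _ _)).
      by move=> k _; rewrite ltr0n fact_gt0.
    apply: ler_wpM2r.
      by apply: sumr_ge0 => k _; rewrite divr_ge0// sqr_ge0.
    rewrite /hermite_energy [leRHS](@big_cat_nat _ _ _ m.+1 1)//= big_mkcond/=.
    rewrite -[leLHS]addr0 lerD//.
      apply: ler_sum => k _; rewrite expr1n divr1.
      by case: ifP => // _; rewrite mulr_ge0 ?sqr_ge0.
    by apply: sumr_ge0 => k _; rewrite expr1n divr1 mulr_ge0 ?sqr_ge0.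
  apply: (le_trans (ler_wpM2l c0 Hyj)); rewrite mulrCA ler_wpM2l//.
    exact: hermite_energy_ge0.
  rewrite big_nat_recl// {1}/F ltnn/= add0r mulr_sumr big_add1 -[m.+1.-1]/m [leLHS]big_mkcond.
  apply: ler_sum_nat => k /andP[_ km]; rewrite /F ltn0Sn andTb.
  case: ifP => // _; rewrite /h /W; set l := k.+1.
  have -> : m = (l + (m - l))%N by rewrite subnKC.
  by rewrite addKn -[n.-1%:R]/(#|I|.-1%:R) nE hermite_weight_split.
have W00 j : W j 0%N = 1.
  by rewrite /W expr0 divr1 mul1r coef0_prod big1 ?expr1n.
have HF j : \sum_(0 <= s < M.+1) \sum_(0 <= k < M.+1) F j k s <=
    (kappa + C * hermite_energy R M n.-1%:R (Q j)) / n%:R ^+ 2.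
  have FE s : \sum_(0 <= k < M.+1) F j k s = (\sum_(1 <= k < M.+1 | ~~ J k) h k s) * W j s.
    rewrite big_nat_recl// {1}/F ltnn/= add0r big_add1 [in RHS]big_mkcond mulr_suml.
    by apply: eq_bigr => k _; rewrite /F /=; case: ifP; rewrite ?mul0r.
  rewrite big_nat_recl// mulrDl lerD//.
    rewrite FE W00 mulr1; apply: le_trans H0; rewrite le_eqVlt; apply/orP; left; apply/eqP.
    rewrite big_nat_cond [RHS]big_nat_cond; apply: eq_bigr => k /andP[/andP[k1 _] _].
    rewrite /h addn0 binn expr0 mulr1 mulr1 divff ?mul1r//.
    by rewrite expf_neq0// pnatr_eq0 -lt0n.
  rewrite mulrAC /hermite_energy mulr_sumr big_add1/=.
  by apply: ler_sum => s _; rewrite FE ler_wpM2r//; exact: Hs.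
rewrite {1}/hermite_energy.
apply: (le_trans (ler_sum_nat key)).
rewrite -mulr_sumr exchange_big/= !mulr_sumr; apply: ler_sum => j _.
rewrite -mulr_sumr mulrA [n%:R * _]mulrC -mulrA [leRHS]mulrCA ler_wpM2l//.
  exact: hermite_energy_ge0.
have -> : n%:R^-1 * (kappa + C * hermite_energy R M n.-1%:R (\prod_(i in I :\ j) P i)) =
    n%:R * ((kappa + C * hermite_energy R M n.-1%:R (Q j)) / n%:R ^+ 2).
  by field; rewrite gt_eqF.
rewrite ler_pM2l//; apply: le_trans (HF j).
apply: le_trans (le_sum_triangle _ _ _ (F0 j)).
rewrite [leRHS]big_ltn//= lerDr.
by apply: sumr_ge0 => k _.
Qed.

(** The right side is the tangent at w = 0 of the left side seen as a function of w. Passing from r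
    to r + 1 loses (N - r) w^2 >= 0, up to the factor a^r. *)
Lemma tangent_bound (R : realFieldType) (N r : nat) (a w : R) :
  (r <= N)%N -> 0 <= a -> 0 <= a - w ->
  (a + N%:R * w) * (a - w) ^+ r <= a ^+ r * (a + N%:R * w - r%:R * w).
Proof.
move=> + a0 y0; elim: r => [|r IH] rN; first by rewrite !expr0 mulr1 mul1r mul0r subr0.
rewrite exprSr mulrA.
apply: (le_trans (ler_wpM2r y0 (IH (ltnW rN)))).
rewrite exprSr -!mulrA ler_wpM2l// ?exprn_ge0//.
have -> : N%:R = (N - r.+1)%N%:R + r.+1%:R :> R by rewrite -natrD subnK.
rewrite -(natr1 r).
have : 0 <= (N - r.+1)%N%:R * w ^+ 2 by rewrite mulr_ge0 ?sqr_ge0.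
move: (_%:R) (r%:R) => b c; nra.
Qed.

(** For a the mean and x_j = a + (n - 1) w_j, the mean of the others is a - w_j. The tangent bound
    is linear in w_j, and the w_j sum to 0. *)
Lemma sum_power_others (R : realFieldType) (T : finType) (I : {set T}) (x : T -> R)
    (r : nat) :
  (2 <= #|I|)%N -> (r <= #|I|.-1)%N -> (forall j, 0 <= x j) ->
  \sum_(j in I) x j * (#|I|.-1%:R^-1 * \sum_(i in I :\ j) x i) ^+ r <=
  #|I|%:R * (#|I|%:R^-1 * \sum_(i in I) x i) ^+ r.+1.
Proof.
move=> I2 rI x0; set n := #|I|; set a := n%:R^-1 * \sum_(i in I) x i.
have n0 : (0 : R) < n%:R by rewrite ltr0n ltnW.
have n10 : (0 : R) < n.-1%:R by rewrite ltr0n -subn1 subn_gt0.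
have nE : n.-1%:R = n%:R - 1 :> R by rewrite -subn1 natrB// ltnW.
have nn1 : n.-1%:R != 0 :> R by rewrite gt_eqF.
have sumE : \sum_(i in I) x i = n%:R * a by rewrite mulrA divff ?mul1r ?gt_eqF.
have a0 : 0 <= a by rewrite mulr_ge0 ?invr_ge0 ?sumr_ge0// ltW.
pose w j := (x j - a) / n.-1%:R.
have xE j : x j = a + n.-1%:R * w j by rewrite mulrC divfK// addrC subrK.
have yE j : j \in I -> n.-1%:R^-1 * \sum_(i in I :\ j) x i = a - w j.
  move=> jI; have -> : \sum_(i in I :\ j) x i = n%:R * a - x j.
    by rewrite -sumE (big_setD1 j jI)/= addrAC subrr add0r.
  apply: (mulfI nn1); rewrite mulrA divff// mul1r mulrBr -mulrC.
  by rewrite mulrC [_ * w j]mulrC divfK// nE; ring.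
apply: (@le_trans _ _ (\sum_(j in I) a ^+ r * (x j - r%:R * w j))).
  apply: ler_sum => j jI; rewrite yE// {1}xE [x j in leRHS]xE.
  apply: tangent_bound => //; rewrite -yE// mulr_ge0 ?invr_ge0 ?sumr_ge0// ltW//.
have sw : \sum_(j in I) w j = 0.
  by rewrite -mulr_suml sumrB sumE sumr_const -[a *+ _]mulr_natl subrr mul0r.
by rewrite -mulr_sumr sumrB -mulr_sumr sw sumE mulr0 subr0 exprSr mulrCA.
Qed.

Section energy_induction.
Context (R : realFieldType).
Variables (kappa C D : nat -> R).
Hypotheses (kappa0 : forall n, 0 <= kappa n) (C0 : forall n, 0 <= C n).
Hypotheses (kappa1 : kappa 1 = 1) (D0 : forall n, (2 <= n)%N -> 0 <= D n).
Hypothesis CD : forall n, (2 <= n)%N -> C n * kappa n.-1 = D n * kappa n.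

(** The bracket of the theorem: the coefficient of x^r is D_n ... D_(n-r+1). The relation [CD]
    normalises [D] so that the prefactor [kappa] of n - 1 factors is exchanged for that of n
    factors. *)
Definition nested_sum (n : nat) (x : R) : R :=
  \sum_(0 <= r < n) (\prod_((n.+1 - r)%N <= i < n.+1) D i) * x ^+ r.

Lemma nested_sumS (n : nat) (x : R) : (2 <= n)%N ->
  nested_sum n x = 1 + D n * x * nested_sum n.-1 x.
Proof.
case: n => // n _; rewrite /nested_sum/= big_nat_recl// subn0 big_geq// expr0 mulr1.
congr (_ + _); rewrite mulr_sumr; apply: eq_big_nat => r /andP[_ rn].
rewrite subSS big_nat_recr/=; last by rewrite leq_subr.
by rewrite exprS; ring.
Qed.

(** Induction on the number of factors. The induction hypothesis is evaluated at [b j], the mean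
    without j, so [nested_sum] is expanded and each power of [b j] is averaged over j separately. *)
Lemma hermite_energy_bound (T : finType) (P : T -> {poly R}) (J : pred nat) (M : nat)
    (x : T -> R) (I : {set T}) :
  (forall j, (P j)`_0 = 1) -> (forall j k, J k -> (P j)`_k = 0) ->
  (forall j, hermite_energy R M 1 (P j) <= x j) ->
  (forall n, (2 <= n)%N ->
     \sum_(1 <= k < M.+1 | ~~ J k) (n%:R^-1) ^+ k <= kappa n / n%:R ^+ 2) ->
  (forall n s, (2 <= n)%N -> (1 <= s)%N -> \sum_(1 <= k < M.+1 | ~~ J k)
      k%:R ^+ 2 / (k + s)%:R ^+ 2 * 'C(k + s, k)%:R * (n%:R^-1) ^+ k *
        (1 - n%:R^-1) ^+ s <= C n / n%:R ^+ 2) ->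
  (0 < #|I|)%N ->
  hermite_energy R M #|I|%:R (\prod_(i in I) P i) <=
  kappa #|I| * (#|I|%:R^-1 * \sum_(i in I) x i) *
    nested_sum #|I| (#|I|%:R^-1 * \sum_(i in I) x i).
Proof.
move=> P0 PJ Px H0 Hs I0.
have x0 j : 0 <= x j by apply: le_trans (Px j); exact: hermite_energy_ge0.
have [n] := ubnP #|I|; elim: n I I0 => // n IH I I0 In.
have [I1|I1] := leqP #|I| 1.
  have /cards1P[j ->] : #|I| == 1%N by rewrite eqn_leq I1.
  rewrite cards1 !big_set1 kappa1 /nested_sum big_nat1 subn0 big_geq//.
  by rewrite expr0 invr1 !mul1r !mulr1.
have n0 : (0 : R) < #|I|%:R by rewrite ltr0n.
apply: (le_trans (hermite_energy_step _ _ _ _ _ _ (kappa #|I|) (C #|I|) P0 PJ I1 _ _ _ _)) => //.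
- exact: H0.
- by move=> s; exact: Hs.
set a := #|I|%:R^-1 * \sum_(i in I) x i.
pose b j := #|I|.-1%:R^-1 * \sum_(i in I :\ j) x i.
have b0 j : 0 <= b j by rewrite /b mulr_ge0 ?sumr_ge0// invr_ge0.
apply: (@le_trans _ _ (#|I|%:R^-1 * \sum_(j in I) x j *
    (kappa #|I| + C #|I| * (kappa #|I|.-1 * b j * nested_sum #|I|.-1 (b j))))).
  rewrite ler_wpM2l ?invr_ge0 ?ler0n//; apply: ler_sum => j jI.
  have Ij : #|I :\ j| = #|I|.-1 by rewrite (cardsD1 j I) jI.
  have {}IH : hermite_energy R M #|I|.-1%:R (\prod_(i in I :\ j) P i) <=
      kappa #|I|.-1 * b j * nested_sum #|I|.-1 (b j).
    have := IH (I :\ j); rewrite Ij; apply; first by rewrite -subn1 subn_gt0.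
    by rewrite -ltnS prednK.
  apply: ler_pM => //; first exact: hermite_energy_ge0.
    rewrite addr_ge0// mulr_ge0// hermite_energy_ge0// ltr0n -subn1 subn_gt0//.
  by rewrite lerD2l ler_wpM2l.
have DI : 0 <= D #|I| by exact: D0.
pose c r := \prod_((#|I|.-1.+1 - r)%N <= i < #|I|.-1.+1) D i.
have c0 r : (r < #|I|.-1)%N -> 0 <= c r.
  move=> rI; rewrite /c big_nat_cond prodr_ge0// => i /andP[/andP[ri _] _].
  by apply: D0; apply: leq_trans ri; rewrite ltn_subRL addn1.
have -> : #|I|%:R^-1 * (\sum_(j in I) x j *
    (kappa #|I| + C #|I| * (kappa #|I|.-1 * b j * nested_sum #|I|.-1 (b j)))) =
   kappa #|I| * (a + D #|I| * \sum_(0 <= r < #|I|.-1)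
     c r * (#|I|%:R^-1 * \sum_(j in I) x j * b j ^+ r.+1)).
  transitivity (#|I|%:R^-1 * \sum_(j in I) (x j * kappa #|I| + kappa #|I| * D #|I| *
      \sum_(0 <= r < #|I|.-1) c r * (x j * b j ^+ r.+1))).
    congr (_ * _); apply: eq_bigr => j _; rewrite [kappa #|I| * D _]mulrC -CD//.
    rewrite mulrDr; congr (_ + _); rewrite /nested_sum !mulr_sumr.
    by apply: eq_bigr => r _; rewrite -/(c r) exprS; ring.
  rewrite big_split/= -mulr_suml -mulr_sumr exchange_big/=.
  under [X in _ * (_ + _ * X) = _]eq_bigr do rewrite -mulr_sumr.
  under [X in _ = _ * (_ + _ * X)]eq_bigr do rewrite mulrCA.
  by rewrite -[in RHS]mulr_sumr /a; ring.
rewrite -mulrA ler_wpM2l// nested_sumS// mulrDr mulr1 lerD2l mulrCA -mulrA ler_wpM2l//.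
rewrite /nested_sum !mulr_sumr; apply: ler_sum_nat => r /andP[_ rI].
have -> : a * (a * (\prod_((#|I|.-1.+1 - r)%N <= i < #|I|.-1.+1) D i * a ^+ r)) =
    c r * a ^+ r.+2 by rewrite -/(c r) !exprS; ring.
rewrite ler_wpM2l ?c0//.
(* The exponent r + 1 is at most n - 1, because [nested_sum] for n - 1 factors has degree n - 2 in
   x. *)
have := sum_power_others _ _ I x r.+1 I1 rI x0; rewrite -/a.
by rewrite -ler_pdivrMl.
Qed.
End energy_induction.

(** * Limits of C_J *)

(** The cubic divided by e^u has derivative -(u^3/6) e^(-u), hence its maximum, 1, at u = 0.
    Negative u are covered, which the expansions around 3.2, 4.3 and 2 rely on. *)
Lemma expR_ge_taylor3 (R : realType) (u : R) :
  1 + u + u ^+ 2 / 2 + u ^+ 3 / 6 <= expR u.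
Proof.
pose f x : R := (1 + x + x ^+ 2 / 2 + x ^+ 3 / 6) * expR (- x).
have df x : is_derive x (1 : R) f (- (x ^+ 3 / 6) * expR (- x)).
  rewrite /f; apply: is_derive_eq.
  by rewrite /GRing.scale/=; field.
suff : f u <= f 0.
  by rewrite /f !expr0n/= !mul0r !addr0 oppr0 expR0 mulr1 expRN ler_pdivrMr ?expR_gt0// mul1r.
have cf : continuous f.
  by move=> x; apply/differentiable_continuous/derivable1_diffP; have [] := df x.
have [u0|u0|->//] := ltgtP u 0.
- have [c cu E] := MVT u0 (fun x _ => df x) (continuous_subspaceT cf).
  rewrite -subr_ge0 E; move: cu; rewrite in_itv/= => /andP[_ c0].
  rewrite mulr_ge0 ?subr_ge0 ?(ltW u0)// mulr_ge0 ?expR_ge0// oppr_ge0.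
  by rewrite pmulr_lle0// exprn_odd_le0// ltW.
- have [c cu E] := MVT u0 (fun x _ => df x) (continuous_subspaceT cf).
  rewrite -subr_ge0 -opprB E; move: cu; rewrite in_itv/= => /andP[c0 _].
  rewrite -mulNr mulr_ge0 ?subr_ge0 ?(ltW u0)// -mulNr mulr_ge0 ?expR_ge0// opprK.
  by rewrite divr_ge0// exprn_ge0// ltW.
Qed.

(** One rung of a squaring ladder: a rational lower bound on e^(-x) is squared and rounded down to
    one on e^(-2x). *)
Lemma expRN_sqr_ge (R : realType) (x a b : R) : 0 <= a ->
  a <= expR (- x) -> b <= a ^+ 2 -> b <= expR (- (x * 2)).
Proof.
move=> a0 ax ba; apply: (le_trans ba).
by rewrite -mulNr -[2]/(2%:R) expRM_natr ler_pXn2r// nnegrE expR_ge0.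
Qed.

(** 3.2 is close to the maximiser of [limit_profile12]. The ladder starts at 3.2/2^6 = 0.05, where
    the cubic is accurate. *)
Lemma expR_32_ge (R : realType) : 4075%:R / 100000%:R <= expR (- (32%:R / 10%:R)) :> R.
Proof.
have -> : 32%:R / 10%:R = 5%:R / 100%:R * 2 * 2 * 2 * 2 * 2 * 2 :> R by field.
have H : 951229%:R / 1000000%:R <= expR (- (5%:R / 100%:R)) :> R.
  by apply: le_trans (expR_ge_taylor3 _ _); lra.
apply: (@expRN_sqr_ge _ _ (20188%:R / 100000%:R)); [lra| |lra].
apply: (@expRN_sqr_ge _ _ (44932%:R / 100000%:R)); [lra| |lra].
apply: (@expRN_sqr_ge _ _ (670315%:R / 1000000%:R)); [lra| |lra].
apply: (@expRN_sqr_ge _ _ (818728%:R / 1000000%:R)); [lra| |lra].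
apply: (@expRN_sqr_ge _ _ (904836%:R / 1000000%:R)); [lra| |lra].
apply: (@expRN_sqr_ge _ _ (951229%:R / 1000000%:R)); [lra| |lra].
exact: H.
Qed.

(** 4.3 is close to the maximiser of [limit_profile_sym]; the ladder starts at 4.3/2^6. *)
Lemma expR_43_ge (R : realType) : 1356%:R / 100000%:R <= expR (- (43%:R / 10%:R)) :> R.
Proof.
have -> : 43%:R / 10%:R = 671875%:R / 10000000%:R * 2 * 2 * 2 * 2 * 2 * 2 :> R by field.
have H : 935019%:R / 1000000%:R <= expR (- (671875%:R / 10000000%:R)) :> R.
  by apply: le_trans (expR_ge_taylor3 _ _); lra.
apply: (@expRN_sqr_ge _ _ (116471%:R / 1000000%:R)); [lra| |lra].
apply: (@expRN_sqr_ge _ _ (341279%:R / 1000000%:R)); [lra| |lra].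
apply: (@expRN_sqr_ge _ _ (584192%:R / 1000000%:R)); [lra| |lra].
apply: (@expRN_sqr_ge _ _ (764325%:R / 1000000%:R)); [lra| |lra].
apply: (@expRN_sqr_ge _ _ (87426%:R / 100000%:R)); [lra| |lra].
apply: (@expRN_sqr_ge _ _ (935019%:R / 1000000%:R)); [lra| |lra].
exact: H.
Qed.

Lemma expR1_ge (R : realType) : 27167%:R / 10000%:R <= expR 1 :> R.
Proof.
have E (x : R) : expR (x + x) = expR x ^+ 2 by rewrite expRD expr2.
have H : 128385%:R / 100000%:R <= expR (1 / 4%:R) :> R.
  by apply: le_trans (expR_ge_taylor3 _ _); lra.
have {}H : 164826%:R / 100000%:R <= expR (1 / 2%:R) :> R.
  have -> : 1 / 2 = 1 / 4%:R + 1 / 4%:R :> R by field.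
  rewrite E expr2; apply: le_trans (ler_pM _ _ H H); [lra|lra|lra].
have -> : expR 1 = expR (1 / 2%:R + 1 / 2%:R) :> R by congr expR; field.
rewrite E expr2; apply: le_trans (ler_pM _ _ H H); [lra|lra|lra].
Qed.

(** Upper bounds on e^(-n) are inverses of lower bounds on e^n, here with 2.7167 <= e. *)
Lemma expRN_nat_le (R : realType) (n : nat) (c : R) :
  1 <= c * (27167%:R / 10000%:R) ^+ n -> expR (- n%:R) <= c.
Proof.
move=> cn; have e1 := expR1_ge R.
have c0 : 0 <= c.
  rewrite leNgt; apply/negP => c0; move: cn; apply/negP; rewrite -ltNge.
  by apply: (@le_lt_trans _ _ 0) => //; rewrite nmulr_rle0// exprn_ge0//; lra.
rewrite expRN -div1r ler_pdivrMr ?expR_gt0//; apply: (le_trans cn); rewrite ler_wpM2l//.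
rewrite -[n%:R]mulr1 expRM_natl; apply: lerXn2r e1; rewrite nnegrE ?expR_ge0//.
Qed.

(** [lra] concludes from Bernstein products of x and 1.2 - x, which are nonnegative on the interval.
    The constant 0.21829 is 1.21829 - 1, for the bound 1.21829 on the profile. *)
Lemma poly12_small (R : realFieldType) (x : R) : 0 <= x -> x <= 12%:R / 10%:R ->
  1 - 21829%:R / 100000%:R * x <= (1 + 2 * x) * (1 - x + x ^+ 2 / 2 - x ^+ 3 / 6).
Proof.
move=> x0 x1; set t := 12%:R / 10%:R - x.
have t0 : 0 <= t by rewrite subr_ge0.
have xt : x = 12%:R / 10%:R - t by rewrite /t; ring.
clearbody t.
have h0 : 0 <= t ^+ 3 * x by rewrite mulr_ge0// exprn_ge0.
have h1 : 0 <= t ^+ 2 * x ^+ 2 by rewrite mulr_ge0// exprn_ge0.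
have h2 : 0 <= t * x ^+ 3 by rewrite mulr_ge0// exprn_ge0.
have h3 : 0 <= x ^+ 4 by rewrite exprn_ge0.
have t_ : t = 12%:R / 10%:R - x by rewrite xt; ring.
clear xt; subst t. lra.
Qed.

(** Here u = 3.2 - x with x between 1.2 and 4.6, and 0.04075 is a lower bound on e^(-3.2). The
    square [h2] is centred near the point where the inequality is almost an equality. *)
Lemma poly12_large (R : realFieldType) (u : R) :
  - (14%:R / 10%:R) <= u -> u <= 2 ->
  1 - 21829%:R / 100000%:R * (32%:R / 10%:R - u) <= (1 + 2 * (32%:R / 10%:R - u)) *
    (4075%:R / 100000%:R * (1 + u + u ^+ 2 / 2 + u ^+ 3 / 6)).
Proof.
move=> u1 u2.
have h1 : 0 <= u ^+ 2 * ((u + 14%:R / 10%:R) * (2 - u)).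
  by rewrite mulr_ge0 ?sqr_ge0// mulr_ge0; lra.
have h2 : 0 <= (u + 3%:R / 100%:R) ^+ 2 by exact: sqr_ge0.
have h3 : 0 <= u ^+ 2 * (u + 14%:R / 10%:R) by rewrite mulr_ge0 ?sqr_ge0//; lra.
have h4 : 0 <= u ^+ 2 * (2 - u) by rewrite mulr_ge0 ?sqr_ge0//; lra.
have h5 : 0 <= u ^+ 2 by exact: sqr_ge0.
lra.
Qed.

(** The constant 0.17858 is 2 * 0.58929 - 1, for the bound 0.58929 on the profile. *)
Lemma poly_sym_small (R : realFieldType) (x : R) : 0 <= x -> x <= 1 ->
  1 - 17858%:R / 100000%:R * x <=
  4%:R * x * (1 - x + x ^+ 2 / 2 - x ^+ 3 / 6) + (1 - x) * (1 - x) ^+ 2.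
Proof.
move=> x0 x1.
have t0 : 0 <= 1 - x by rewrite subr_ge0.
have h0 : 0 <= (1 - x) ^+ 3 * x by rewrite mulr_ge0// exprn_ge0.
have h1 : 0 <= (1 - x) ^+ 2 * x ^+ 2 by rewrite mulr_ge0// exprn_ge0.
have h2 : 0 <= (1 - x) * x ^+ 3 by rewrite mulr_ge0// exprn_ge0.
have h3 : 0 <= x ^+ 4 by rewrite exprn_ge0.
lra.
Qed.

(** Here u = 4.3 - x with x between 4 and 5.6; 0.01356 bounds e^(-4.3) from below and 0.0184 bounds
    e^(-x) from above. The square [h2] sits near the maximiser. The next two lemmas treat x in
    [3, 4] and [1, 3] in the same way, with upper bounds 0.05 and 0.37. *)
Lemma poly_sym_4_56 (R : realFieldType) (u : R) :
  - (13%:R / 10%:R) <= u -> u <= 3%:R / 10%:R ->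
  1 - 17858%:R / 100000%:R * (43%:R / 10%:R - u) <=
  (1356%:R / 100000%:R * (1 + u + u ^+ 2 / 2 + u ^+ 3 / 6)) *
  (4%:R * (43%:R / 10%:R - u) - (43%:R / 10%:R - u - 1) * (184%:R / 10000%:R)).
Proof.
move=> u1 u2.
have h1 : 0 <= u ^+ 2 * ((u + 13%:R / 10%:R) * (3%:R / 10%:R - u)).
  by rewrite mulr_ge0 ?sqr_ge0// mulr_ge0; lra.
have h2 : 0 <= (u - 3%:R / 1000%:R) ^+ 2 by exact: sqr_ge0.
have h3 : 0 <= u ^+ 2 * (u + 13%:R / 10%:R) by rewrite mulr_ge0 ?sqr_ge0//; lra.
have h4 : 0 <= u ^+ 2 * (3%:R / 10%:R - u) by rewrite mulr_ge0 ?sqr_ge0//; lra.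
have h5 : 0 <= u ^+ 2 by exact: sqr_ge0.
lra.
Qed.

Lemma poly_sym_3_4 (R : realFieldType) (u : R) :
  3%:R / 10%:R <= u -> u <= 13%:R / 10%:R ->
  1 - 17858%:R / 100000%:R * (43%:R / 10%:R - u) <=
  (1356%:R / 100000%:R * (1 + u + u ^+ 2 / 2 + u ^+ 3 / 6)) *
  (4%:R * (43%:R / 10%:R - u) - (43%:R / 10%:R - u - 1) * (5%:R / 100%:R)).
Proof.
move=> u1 u2; set a := u - 3%:R / 10%:R; set b := 13%:R / 10%:R - u.
have a0 : 0 <= a by rewrite subr_ge0.
have b0 : 0 <= b by rewrite subr_ge0.
have h0 : 0 <= a ^+ 4 by rewrite exprn_ge0.
have h1 : 0 <= a ^+ 3 * b by rewrite mulr_ge0// exprn_ge0.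
have h2 : 0 <= a ^+ 2 * b ^+ 2 by rewrite mulr_ge0// exprn_ge0.
have h3 : 0 <= a * b ^+ 3 by rewrite mulr_ge0// exprn_ge0.
have h4 : 0 <= b ^+ 4 by rewrite exprn_ge0.
rewrite /a /b in h0 h1 h2 h3 h4; clear a b a0 b0; lra.
Qed.

Lemma poly_sym_1_3 (R : realFieldType) (u : R) :
  - 1 <= u -> u <= 1 ->
  1 - 17858%:R / 100000%:R * (2 - u) <=
  (135%:R / 1000%:R * (1 + u + u ^+ 2 / 2 + u ^+ 3 / 6)) *
  (4%:R * (2 - u) - (2 - u - 1) * (37%:R / 100%:R)).
Proof.
move=> u1 u2; set a := u + 1; set b := 1 - u.
have a0 : 0 <= a by rewrite /a; lra.
have b0 : 0 <= b by rewrite subr_ge0.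
have h0 : 0 <= a ^+ 4 by rewrite exprn_ge0.
have h1 : 0 <= a ^+ 3 * b by rewrite mulr_ge0// exprn_ge0.
have h2 : 0 <= a ^+ 2 * b ^+ 2 by rewrite mulr_ge0// exprn_ge0.
have h3 : 0 <= a * b ^+ 3 by rewrite mulr_ge0// exprn_ge0.
have h4 : 0 <= b ^+ 4 by rewrite exprn_ge0.
rewrite /a /b in h0 h1 h2 h3 h4; clear a b a0 b0; lra.
Qed.

Lemma taylor3N (R : numFieldType) (x : R) :
  1 + - x + (- x) ^+ 2 / 2 + (- x) ^+ 3 / 6 = 1 - x + x ^+ 2 / 2 - x ^+ 3 / 6.
Proof. by field. Qed.

Lemma expRN2_ge (R : realType) : 135%:R / 1000%:R <= expR (- 2) :> R.
Proof.
have -> : 2 = 25%:R / 100%:R * 2 * 2 * 2 :> R by field.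
have H : 7786%:R / 10000%:R <= expR (- (25%:R / 100%:R)) :> R.
  by apply: le_trans (expR_ge_taylor3 _ _); lra.
apply: (@expRN_sqr_ge _ _ (36748%:R / 100000%:R)); [lra| |lra].
apply: (@expRN_sqr_ge _ _ (60621%:R / 100000%:R)); [lra| |lra].
apply: (@expRN_sqr_ge _ _ (7786%:R / 10000%:R)); [lra| |lra].
exact: H.
Qed.

(** The limit of h_J(s, p) for J = {1, 2} as p -> 0 and s p -> x, with e^(-x) the limit of (1 -
    p)^s. *)
Definition limit_profile12 (R : realType) (x : R) : R :=
  1 + (1 - expR (- x)) / x - 2 * expR (- x).

(** The same limit for [Jsym]; the squared exponential is the limit of ((1 - p)/(1 + p))^s. *)
Definition limit_profile_sym (R : realType) (x : R) : R :=
  (1 + expR (- x) ^+ 2) / 2 + (1 - expR (- x) ^+ 2) / (2 * x) - 2 * expR (- x).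

Lemma expRN_ge_taylor3_center (R : realType) (x c K : R) : 0 <= K -> K <= expR (- c) ->
  K * (1 + (c - x) + (c - x) ^+ 2 / 2 + (c - x) ^+ 3 / 6) <= expR (- x).
Proof.
move=> K0 Kc; have -> : expR (- x) = expR (- c + (c - x)) by congr expR; ring.
rewrite expRD; apply: (@le_trans _ _ (K * expR (c - x))).
  by rewrite ler_wpM2l ?expR_ge_taylor3.
by rewrite ler_wpM2r ?expR_ge0.
Qed.

(** Multiplied by x, the bound becomes linear in y = e^(-x), with positive coefficient 1 + 2 x; a
    lower bound on e^(-x) is then enough. *)
Lemma profile12_le_linear (R : realFieldType) (x y c : R) : 0 < x ->
  1 - (c - 1) * x <= (1 + 2 * x) * y -> 1 + (1 - y) / x - 2 * y <= c.
Proof.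
move=> x0 H; rewrite -subr_ge0.
have -> : c - (1 + (1 - y) / x - 2 * y) = ((1 + 2 * x) * y - (1 - (c - 1) * x)) / x.
  by field; rewrite gt_eqF.
by rewrite divr_ge0 ?subr_ge0// ltW.
Qed.

(** Clearing denominators leaves a quadratic in y whose leading coefficient 1 - x changes sign at 1;
    hence the case split at x = 1 below. *)
Lemma profile_sym_le_linear (R : realFieldType) (x y c : R) : 0 < x ->
  1 - (2 * c - 1) * x <= 4%:R * x * y + (1 - x) * y ^+ 2 ->
  (1 + y ^+ 2) / 2 + (1 - y ^+ 2) / (2 * x) - 2 * y <= c.
Proof.
move=> x0 H; rewrite -subr_ge0.
have -> : c - ((1 + y ^+ 2) / 2 + (1 - y ^+ 2) / (2 * x) - 2 * y) =
    (4%:R * x * y + (1 - x) * y ^+ 2 - (1 - (2 * c - 1) * x)) / (2 * x).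
  by field; rewrite gt_eqF.
by rewrite divr_ge0 ?subr_ge0// mulr_ge0// ltW.
Qed.

Lemma limit_profile12_le (R : realType) (x : R) : 0 < x ->
  limit_profile12 R x <= 121829%:R / 100000%:R.
Proof.
move=> x0; apply: profile12_le_linear => //.
have -> : 121829%:R / 100000%:R - 1 = 21829%:R / 100000%:R :> R by lra.
have x20 : 0 <= 1 + 2 * x by rewrite addr_ge0// mulr_ge0// ltW.
have [x1|x1] := leP x (12%:R / 10%:R).
  apply: (le_trans (poly12_small _ _ (ltW x0) x1)); rewrite ler_wpM2l//.
  by rewrite -taylor3N expR_ge_taylor3.
(* Beyond 4.6 the left side 1 - 0.21829 x is negative. *)
have [x2|x2] := leP x (46%:R / 10%:R); last first.
  by apply: (@le_trans _ _ 0); [lra | rewrite mulr_ge0// expR_ge0].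
have xE : 32%:R / 10%:R - (32%:R / 10%:R - x) = x by ring.
have := @poly12_large R (32%:R / 10%:R - x); rewrite xE => /(_ _ _)/le_trans; apply.
- by lra.
- by lra.
- apply: ler_wpM2l x20 _ _ _.
  by apply: expRN_ge_taylor3_center; [lra|exact: expR_32_ge].
Qed.

Lemma limit_profile_sym_le (R : realType) (x : R) : 0 < x ->
  limit_profile_sym R x <= 58929%:R / 100000%:R.
Proof.
move=> x0; apply: profile_sym_le_linear => //; set y := expR (- x).
have -> : 2 * (58929%:R / 100000%:R) - 1 = 17858%:R / 100000%:R :> R by lra.
have y0 : 0 <= y := expR_ge0 _.
have [x1|x1] := leP x 1.
  apply: (le_trans (poly_sym_small _ _ (ltW x0) x1)); apply: lerD; last first.
    rewrite ler_wpM2l ?subr_ge0// lerXn2r ?nnegrE ?subr_ge0// /y.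
    exact: expR_ge1Dx.
  rewrite ler_wpM2l//; first by rewrite mulr_ge0// ltW.
  by rewrite -taylor3N expR_ge_taylor3.
have exp_le (n : nat) (c : R) : n%:R <= x -> 1 <= c * (27167%:R / 10000%:R) ^+ n -> y <= c.
  move=> nx /expRN_nat_le; apply: le_trans; by rewrite ler_expR lerN2.
(* For x > 1 the right side is y (4 x - (x - 1) y): the outer y needs a lower bound [l], the inner
   one an upper bound [c]. *)
have factor (c l : R) : y <= c -> l <= y -> 0 <= 4%:R * x - (x - 1) * c ->
    l * (4%:R * x - (x - 1) * c) <= 4%:R * x * y + (1 - x) * y ^+ 2.
  move=> yc ly c0; have -> : 4%:R * x * y + (1 - x) * y ^+ 2 =
    y * (4%:R * x - (x - 1) * y) by ring.
  apply: (le_trans (ler_wpM2r c0 ly)); rewrite ler_wpM2l// lerB// ler_wpM2l//.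
  by rewrite subr_ge0 ltW.
(* Beyond 5.6 the left side 1 - 0.17858 x is negative. *)
have [x56|x56] := leP (56%:R / 10%:R) x.
  have y1 : y <= 1 by rewrite -expR0 ler_expR oppr_le0 ltW.
  apply: (@le_trans _ _ 0); first by lra.
  by apply: le_trans (factor 1 0 y1 y0 _); rewrite ?mul0r//; lra.
have H43 : 43%:R / 10%:R - (43%:R / 10%:R - x) = x by ring.
have [x4|x4] := leP 4%:R x.
  have := @poly_sym_4_56 R (43%:R / 10%:R - x); rewrite H43 => /(_ _ _)/le_trans.
  apply; [lra|lra|apply: factor; last lra].
    by apply: (exp_le 4%N) => //; lra.
  by apply: expRN_ge_taylor3_center; [lra|exact: expR_43_ge].
have [x3|x3] := leP 3%:R x.
  have := @poly_sym_3_4 R (43%:R / 10%:R - x); rewrite H43 => /(_ _ _)/le_trans.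
  apply; [lra|lra|apply: factor; last lra].
    by apply: (exp_le 3%N) => //; lra.
  by apply: expRN_ge_taylor3_center; [lra|exact: expR_43_ge].
have H2 : 2 - (2 - x) = x by ring.
have := @poly_sym_1_3 R (2 - x); rewrite H2 => /(_ _ _)/le_trans.
apply; [lra|lra|apply: factor; last lra].
  by apply: (exp_le 1%N) => //; [exact: ltW|lra].
by apply: expRN_ge_taylor3_center; [lra|exact: expRN2_ge].
Qed.

(** * Negative binomial series and closed upper bounds for h_J *)

Definition nbinom (R : realType) (s : nat) (x : R) (i : nat) : R :=
  'C(i + s, i)%:R * x ^+ i.

(** Pascal's rule in summed form: multiplication by 1 - x lowers the order by one, up to a boundary
    term. *)
Lemma nbinom_telescope (R : realType) (s : nat) (x : R) (n : nat) :
  (1 - x) * series (nbinom R s.+1 x) n.+1 =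
  series (nbinom R s x) n.+1 - x * nbinom R s.+1 x n.
Proof.
elim: n => [|n IH]; first by rewrite /series/= !big_nat1 /nbinom !bin0 expr0; ring.
rewrite [in RHS]/series/= [in LHS]/series/= big_nat_recr//= mulrDr.
rewrite -[X in X + _ = _]/((1 - x) * series (nbinom R s.+1 x) n.+1) IH.
rewrite [in RHS]big_nat_recr//= -/(series (nbinom R s x) n.+1).
suff -> : nbinom R s.+1 x n.+1 = nbinom R s x n.+1 + x * nbinom R s.+1 x n.
rewrite -[\sum_(0 <= i < n.+1) _]/(series (nbinom R s x) n.+1); ring.
by rewrite /nbinom [in LHS]addSn binS natrD addSnnS exprS; ring.
Qed.

(** Induction on the order. Convergence at |x|, from monotone bounded partial sums, makes the terms
    tend to 0, so the boundary term of the telescoping identity disappears. *)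
Lemma cvg_nbinom_series (R : realType) (s : nat) (x : R) : `|x| < 1 ->
  series (nbinom R s x) @ \oo --> (1 - x)^-1 ^+ s.+1.
Proof.
elim: s x => [|s IH] x x1.
  rewrite expr1; have -> : nbinom R 0 x = geometric 1 x.
    by apply/funext => i; rewrite /nbinom addn0 binn.
  by rewrite -[(1 - x)^-1]mul1r; exact: cvg_geometric_series.
have x1' : 1 - x != 0.
  by rewrite subr_eq0 eq_sym lt_eqF// (le_lt_trans (ler_norm x)).
have nx1 : `| `|x| | < 1 by rewrite normr_id.
have nx0 : 0 < 1 - `|x| by rewrite subr_gt0.
have cvgN : cvgn (series (nbinom R s.+1 `|x|)).
  apply: nondecreasing_is_cvgn.
    by apply: nondecreasing_series => i _ _; rewrite mulr_ge0// exprn_ge0.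
  exists ((1 - `|x|)^-1 * (1 - `|x|)^-1 ^+ s.+1) => _ [n _ <-].
  have nd : nondecreasing_seq (series (nbinom R s.+1 `|x|)).
    by apply: nondecreasing_series => i _ _; rewrite mulr_ge0// exprn_ge0.
  apply: (le_trans (nd _ _ (leqnSn n))).
  rewrite -(ler_pM2l nx0) nbinom_telescope mulVKf ?gt_eqF//.
  rewrite lerBlDr ler_wpDr ?mulr_ge0 ?exprn_ge0//.
  have cs := IH _ nx1; rewrite -(cvg_lim _ cs)//; apply: nondecreasing_cvgn_le.
    by apply: nondecreasing_series => i _ _; rewrite mulr_ge0// exprn_ge0.
  by apply/cvg_ex; eexists; exact: cs.
have t0 : nbinom R s.+1 x @ \oo --> 0.
  apply/norm_cvg0P; rewrite (_ : (fun i => _) = nbinom R s.+1 `|x|).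
    exact: cvg_series_cvg_0.
  by apply/funext => i; rewrite /nbinom normrM normrX ger0_norm.
rewrite -(cvg_shiftS (series _)).
have -> : (fun n => series (nbinom R s.+1 x) n.+1) =
    (fun n => (1 - x)^-1 * (series (nbinom R s x) n.+1 - x * nbinom R s.+1 x n)).
  by apply/funext => n; rewrite -nbinom_telescope mulKf.
have -> : (1 - x)^-1 ^+ s.+2 = (1 - x)^-1 * ((1 - x)^-1 ^+ s.+1 - x * 0).
  by rewrite mulr0 subr0 -exprS.
apply: cvgMr; apply: cvgB; last exact: cvgMr.
by rewrite (cvg_shiftS (series _)); exact: IH.
Qed.

Definition hterm (R : fieldType) (s : nat) (p : R) (k : nat) : R :=
  k%:R ^+ 2 / (k + s)%:R ^+ 2 * 'C(k + s, k)%:R * p ^+ k.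

Definition hmajorant (R : realType) (t : nat) (p : R) (i : nat) : R :=
  nbinom R t.+1 p i + nbinom R t p i.+1 / (t.+1%:R * p).

(** Here k = i + 2 and s = t + 1, so the last factor is 1 - 1/(k + s), which lies between 1 - 1/s
    and 1. Without it, two negative binomial series with closed sums remain. *)
Lemma htermE (R : realType) (t : nat) (p : R) (i : nat) : 0 < p ->
  hterm R t.+1 p i.+2 = p ^+ 2 * hmajorant R t p i * (1 - (i + t.+3)%:R^-1).
Proof.
move=> p0; rewrite /hterm /hmajorant /nbinom.
have i1 : i.+1%:R != 0 :> R by rewrite pnatr_eq0.
have i2 : i.+2%:R != 0 :> R by rewrite pnatr_eq0.
have t1 : t.+1%:R != 0 :> R by rewrite pnatr_eq0.
have it2 : (i + t.+2)%:R != 0 :> R by rewrite addnS pnatr_eq0.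
have it3 : (i + t.+3)%:R != 0 :> R by rewrite addnS pnatr_eq0.
have pn0 : p != 0 by rewrite gt_eqF.
have E1 : 'C(i + t.+2, i.+1)%:R = (i + t.+2)%:R * 'C(i + t.+1, i)%:R / i.+1%:R :> R.
  apply: (canRL (mulfK i1)); rewrite -!natrM mulnC; congr _%:R.
  by rewrite -mul_bin_diag addnS.
have E2 : 'C(i.+2 + t.+1, i.+2)%:R = (i + t.+3)%:R * 'C(i + t.+2, i.+1)%:R / i.+2%:R :> R.
  apply: (canRL (mulfK i2)); rewrite -!natrM mulnC; congr _%:R.
  by rewrite -mul_bin_diag !addSn !addnS.
have E3 : 'C(i.+1 + t, i.+1)%:R = t.+1%:R * 'C(i + t.+1, i)%:R / i.+1%:R :> R.
  apply: (canRL (mulfK i1)); rewrite -!natrM mulnC; congr _%:R.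
  by rewrite mul_bin_left addSnnS addKn.
rewrite E2 E1 E3 (_ : (i.+2 + t.+1)%:R = (i + t.+3)%:R); last by rewrite !addSn !addnS.
rewrite !exprS; move: (p ^+ i) ('C(i + t.+1, i)%:R) => P c.
have i2E : i.+2%:R = i.+1%:R + 1 :> R by rewrite natr1.
have it3E : (i + t.+3)%:R = i.+1%:R + t.+1%:R + 1 :> R.
  by rewrite -natrD natr1 !addSn !addnS.
have it2E : (i + t.+2)%:R = i.+1%:R + t.+1%:R :> R.
  by rewrite -natrD !addSn !addnS.
rewrite it3E it2E i2E in i2 it2 it3 *.
move: (i.+1%:R) (t.+1%:R) i1 i2 t1 it2 it3 => a b i1 i2 t1 it2 it3.
by field; rewrite ?i1 ?i2 ?t1 ?it2 ?it3 ?pn0.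
Qed.

Lemma hmajorant_ge0 (R : realType) (t : nat) (p : R) (i : nat) : 0 < p ->
  0 <= hmajorant R t p i.
Proof.
move=> p0; have pge := ltW p0.
by rewrite addr_ge0 ?divr_ge0// mulr_ge0// exprn_ge0.
Qed.

(** (1 - p)^s times the sum of [hmajorant] over k >= 3. The last term removes k = 2, where the
    majorant equals 2. *)
Definition hbound12 (R : realType) (s : nat) (p : R) : R :=
  (1 - p)^-1 + (1 - (1 - p) ^+ s) / (s%:R * p) - 2 * (1 - p) ^+ s.

(** The analogue for even k >= 4; [rho] comes from evaluating the series at -p. *)
Definition hbound_sym (R : realType) (s : nat) (p : R) : R :=
  let rho := ((1 - p) / (1 + p)) ^+ s in
  ((1 - p)^-1 + rho / (1 + p)) / 2 + (1 - rho) / (2 * (s%:R * p)) - 2 * (1 - p) ^+ s.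

Lemma series0E (R : realType) (u : nat -> R) (n : nat) :
  series (fun i => (i == 0)%:R * u i) n.+1 = u 0%N.
Proof.
rewrite /series/= big_nat_recl// mul1r big1 ?addr0// => i _.
by rewrite mul0r.
Qed.

Lemma cvg_series_drop0 (R : realType) (u : nat -> R) (l : R) :
  series u @ \oo --> l ->
  series (fun i => (0 < i)%:R * u i) @ \oo --> l - u 0%N.
Proof.
move=> ul; rewrite -(cvg_shiftS (series _)).
have -> : (fun n => series (fun i => (0 < i)%:R * u i) n.+1) =
    (fun n => series u n.+1 - u 0%N).
  apply/funext => n; rewrite -[in RHS](series0E R u n) /series/= -sumrB.
  by apply: eq_bigr => -[|i] _ /=; rewrite ?mul1r ?mul0r ?subrr ?subr0.
by apply: cvgB; [rewrite (cvg_shiftS (series _))|exact: cvg_cst].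
Qed.

Lemma cvg_nbinom_pair (R : realType) (t : nat) (x c : R) : `|x| < 1 ->
  series (fun i => nbinom R t.+1 x i + c * nbinom R t x i.+1) @ \oo -->
  (1 - x)^-1 ^+ t.+2 + c * ((1 - x)^-1 ^+ t.+1 - 1).
Proof.
move=> x1.
have E n : series (fun i => nbinom R t.+1 x i + c * nbinom R t x i.+1) n =
    series (nbinom R t.+1 x) n + c * (series (nbinom R t x) n.+1 - 1).
  rewrite /series/= big_split/= [in RHS]big_nat_recl//=.
  have -> : nbinom R t x 0 = 1 by rewrite /nbinom expr0 bin0 mulr1.
  by congr (_ + _); rewrite addrAC subrr add0r mulr_sumr.
rewrite (funext E); apply: cvgD; first exact: cvg_nbinom_series.
apply: cvgMr; apply: cvgB; last exact: cvg_cst.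
by rewrite (cvg_shiftS (series _)); exact: cvg_nbinom_series.
Qed.

Lemma nbinomN (R : realType) (s : nat) (x : R) (i : nat) :
  nbinom R s (- x) i = (-1) ^+ i * nbinom R s x i.
Proof. by rewrite /nbinom [in LHS]exprNn mulrCA. Qed.

Lemma hmajorant_eq (R : realType) (t : nat) (p : R) (i : nat) :
  hmajorant R t p i = nbinom R t.+1 p i + (t.+1%:R * p)^-1 * nbinom R t p i.+1.
Proof. by rewrite /hmajorant [_ / _]mulrC. Qed.

Lemma nbinom0 (R : realType) (s : nat) (x : R) : nbinom R s x 0 = 1.
Proof. by rewrite /nbinom expr0 bin0 mulr1. Qed.

Lemma nbinom1 (R : realType) (s : nat) (x : R) : nbinom R s x 1 = s.+1%:R * x.
Proof. by rewrite /nbinom expr1 add1n bin1. Qed.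

Lemma cvg_hmajorant12 (R : realType) (t : nat) (p : R) : 0 < p < 1 ->
  series (fun i => (0 < i)%:R * hmajorant R t p i) @ \oo -->
  hbound12 R t.+1 p / (1 - p) ^+ t.+1.
Proof.
move=> /andP[p0 p1].
have q0 : 1 - p != 0 by rewrite subr_eq0 gt_eqF.
have pn : `|p| < 1 by rewrite gtr0_norm.
have pn0 : p != 0 by rewrite gt_eqF.
have t0 : t.+1%:R != 0 :> R by rewrite pnatr_eq0.
have c := cvg_series_drop0 R _ _ (cvg_nbinom_pair R t p (t.+1%:R * p)^-1 pn).
rewrite nbinom0 nbinom1 in c.
rewrite (_ : (fun i => _) = fun i => (0 < i)%:R *
    (nbinom R t.+1 p i + (t.+1%:R * p)^-1 * nbinom R t p i.+1)); last first.
  by apply/funext => i; rewrite hmajorant_eq.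
rewrite (_ : hbound12 R t.+1 p / _ = (1 - p)^-1 ^+ t.+2 +
    (t.+1%:R * p)^-1 * ((1 - p)^-1 ^+ t.+1 - 1) -
    (1 + (t.+1%:R * p)^-1 * (t.+1%:R * p))) //.
rewrite /hbound12 !exprVn !exprS.
by field; rewrite nat1r pn0 t0 q0 expf_neq0.
Qed.

(** Even indices are selected by averaging the series at p and at -p. The opposite sign of the
    second coefficient compensates the shifted index [i.+1]. *)
Lemma cvg_hmajorant_sym (R : realType) (t : nat) (p : R) : 0 < p < 1 ->
  series (fun i => ((0 < i)%N && ~~ odd i)%:R * hmajorant R t p i) @ \oo -->
  hbound_sym R t.+1 p / (1 - p) ^+ t.+1.
Proof.
move=> /andP[p0 p1].
have q0 : 1 - p != 0 by rewrite subr_eq0 gt_eqF.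
have p10 : 1 + p != 0 by rewrite gt_eqF// addr_gt0.
have pn : `|p| < 1 by rewrite gtr0_norm.
have pn' : `|- p| < 1 by rewrite normrN gtr0_norm.
have pn0 : p != 0 by rewrite gt_eqF.
have t0 : t.+1%:R != 0 :> R by rewrite pnatr_eq0.
have c1 := cvg_series_drop0 R _ _ (cvg_nbinom_pair R t p (t.+1%:R * p)^-1 pn).
have c2 := cvg_series_drop0 R _ _ (cvg_nbinom_pair R t (- p) (- (t.+1%:R * p)^-1) pn').
rewrite !nbinom0 !nbinom1 in c1 c2.
rewrite (_ : series _ = (fun n => 2^-1 * (series (fun i => (0 < i)%:R *
      (nbinom R t.+1 p i + (t.+1%:R * p)^-1 * nbinom R t p i.+1)) n +
      series (fun i => (0 < i)%:R *
      (nbinom R t.+1 (- p) i + - (t.+1%:R * p)^-1 * nbinom R t (- p) i.+1)) n))); last first.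
  apply/funext => n; rewrite /series/= -big_split/= mulr_sumr; apply: eq_bigr => i _.
  rewrite -mulrDr !nbinomN hmajorant_eq exprS -signr_odd.
  case: i => [|i] /=; first by rewrite !mul0r mulr0.
  by case: (odd i); rewrite /= ?expr0 ?expr1; field; rewrite ?nat1r ?pn0 ?t0.
rewrite (_ : hbound_sym R t.+1 p / _ = 2^-1 *
  ((1 - p)^-1 ^+ t.+2 + (t.+1%:R * p)^-1 * ((1 - p)^-1 ^+ t.+1 - 1) -
    (1 + (t.+1%:R * p)^-1 * (t.+1%:R * p)) +
  ((1 - (- p))^-1 ^+ t.+2 + - (t.+1%:R * p)^-1 * ((1 - (- p))^-1 ^+ t.+1 - 1) -
    (1 + - (t.+1%:R * p)^-1 * (t.+1%:R * (- p)))))).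
  by apply: cvgMr; exact: cvgD c1 c2.
rewrite /hbound_sym/= opprK expr_div_n !exprVn !exprS.
by field; rewrite nat1r pn0 t0 q0 p10 !expf_neq0.
Qed.

(** Both sides are 1 + y <= e^y raised to the power s, at y = -p and at y = p/(1 - p), where 1 + y =
    1/(1 - p). *)
Lemma expr_onem_bounds (R : realType) (s : nat) (p : R) : 0 < p < 1 ->
  expR (- (s%:R * p / (1 - p))) <= (1 - p) ^+ s <= expR (- (s%:R * p)).
Proof.
move=> /andP[p0 p1]; have q0 : 0 < 1 - p by rewrite subr_gt0.
rewrite -mulrA -[- (_ * (p / _))]mulrN -[- (_ * p)]mulrN !expRM_natl.
apply/andP; split; last first.
  by apply: lerXn2r; rewrite ?nnegrE ?expR_ge0 ?(ltW q0)//; exact: expR_ge1Dx.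
apply: lerXn2r; rewrite ?nnegrE ?expR_ge0 ?(ltW q0)//.
rewrite expRN -[leRHS]invrK lef_pV2 ?posrE ?expR_gt0 ?invr_gt0//.
have E : (1 - p)^-1 = 1 + p / (1 - p) by field; rewrite gt_eqF.
by rewrite [leLHS]E; exact: expR_ge1Dx.
Qed.

Lemma onem_expRN_div (R : realType) (x : R) : 0 < x -> 0 <= (1 - expR (- x)) / x <= 1.
Proof.
move=> x0; rewrite divr_ge0 ?(ltW x0) ?subr_ge0 ?expR_le1 ?oppr_le0 ?(ltW x0)//=.
by rewrite ler_pdivrMr// mul1r lerBlDr addrC -lerBlDr; exact: expR_ge1Dx.
Qed.

Lemma mul_expRN_le1 (R : realType) (x : R) : x * expR (- x) <= 1.
Proof.
rewrite expRN ler_pdivrMr ?expR_gt0// mul1r; apply: le_trans (expR_ge1Dx x).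
by rewrite lerDr.
Qed.

(** Passes from mu = s p to x = mu/(1 - p), the point where e^(-x) is a lower bound. As (1 - e)/x <=
    1, the change of denominator costs at most p/(1 - p). *)
Lemma onem_div_le (R : realType) (mu p a e : R) : 0 < p < 1 -> 0 < mu -> e <= a ->
  (1 - e) / (mu / (1 - p)) <= 1 ->
  (1 - a) / mu <= (1 - e) / (mu / (1 - p)) + p / (1 - p).
Proof.
move=> /andP[p0 p1] mu0 ea e1; have q0 : 0 < 1 - p by rewrite subr_gt0.
apply: (@le_trans _ _ ((1 - e) / mu)).
  by rewrite ler_pM2r ?invr_gt0// lerD2l lerN2.
have -> : (1 - e) / mu = (1 - e) / (mu / (1 - p)) * (1 + p / (1 - p)).
  by field; rewrite !gt_eqF.
rewrite mulrDr mulr1 lerD2l -[leRHS]mul1r ler_wpM2r// divr_ge0 ?(ltW p0)//.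
exact: ltW.
Qed.

(** At x = s p/(1 - p), rather than s p, one has e^(-x) <= (1 - p)^s, the direction that the
    negative terms require. The error is uniform in s, and 3 is a common rounding for both
    families. *)
Lemma hbound12_le (R : realType) (t : nat) (p : R) : 0 < p < 1 ->
  hbound12 R t.+1 p <=
  limit_profile12 R (t.+1%:R * p / (1 - p)) + 3%:R * (p / (1 - p)).
Proof.
move=> p01; have /andP[p0 p1] := p01; have q0 : 0 < 1 - p by rewrite subr_gt0.
have mu0 : 0 < t.+1%:R * p by rewrite mulr_gt0.
have /andP[eA _] := expr_onem_bounds _ t.+1 _ p01.
have /andP[_ d1] := onem_expRN_div _ _ (divr_gt0 mu0 q0).
rewrite /hbound12 /limit_profile12.
have := onem_div_le _ _ _ _ _ p01 mu0 eA d1.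
have : (1 - p)^-1 = 1 + p / (1 - p) by field; rewrite gt_eqF.
have : 0 <= p / (1 - p) by rewrite divr_ge0// ltW.
move: eA; set x := t.+1%:R * p / (1 - p).
move: (expR (- x)) ((1 - p) ^+ t.+1) => a e.
move: (p / (1 - p)) ((1 - p)^-1) => b c; move: ((1 - a) / x) ((1 - e) / _) => f g.
lra.
Qed.

Lemma ratio_expr_bounds (R : realType) (s : nat) (p : R) : 0 < p < 1 ->
  expR (- (s%:R * p / (1 - p))) ^+ 2 <= ((1 - p) / (1 + p)) ^+ s <=
  expR (- (2 * (s%:R * p) / (1 + p))).
Proof.
move=> p01; have /andP[p0 p1] := p01; have q0 : 0 < 1 - p by rewrite subr_gt0.
have r0 : 0 < 1 + p by rewrite addr_gt0.
have /andP[eA Ae] := expr_onem_bounds _ s _ p01.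
rewrite expr2 exprMn; apply/andP; split.
  apply: ler_pM; rewrite ?expR_ge0//.
  rewrite -mulrA -mulrN expRM_natl; apply: lerXn2r.
  - by rewrite nnegrE expR_ge0.
  - by rewrite nnegrE invr_ge0 ltW.
  rewrite expRN lef_pV2 ?posrE ?expR_gt0//; apply: le_trans (expR_ge1Dx _).
  by rewrite lerD2l ler_pdivlMr// -[leRHS]mulr1 ler_pM2l// lerBlDr lerDl ltW.
set mu := s%:R * p in Ae *.
have mu0 : 0 <= mu by rewrite mulr_ge0// ltW.
have -> : - (2 * mu / (1 + p)) = - (mu / (1 + p)) + - (mu / (1 + p)) by field; rewrite gt_eqF.
rewrite expRD; apply: ler_pM.
- by rewrite exprn_ge0// ltW.
- by rewrite exprn_ge0// invr_ge0 ltW.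
- apply: (le_trans Ae); rewrite ler_expR lerN2 ler_pdivrMr// mulrDr mulr1.
  by rewrite lerDl mulr_ge0// ltW.
rewrite /mu -mulrA -mulrN expRM_natl; apply: lerXn2r.
- by rewrite nnegrE invr_ge0 ltW.
- by rewrite nnegrE expR_ge0.
have E : (1 + p)^-1 = 1 + - (p / (1 + p)) by field; rewrite gt_eqF.
by rewrite [leLHS]E; exact: expR_ge1Dx.
Qed.

Lemma hbound_sym_le (R : realType) (t : nat) (p : R) : 0 < p < 1 ->
  hbound_sym R t.+1 p <=
  limit_profile_sym R (t.+1%:R * p / (1 - p)) + 3%:R * (p / (1 - p)).
Proof.
move=> p01; have /andP[p0 p1] := p01; have q0 : 0 < 1 - p by rewrite subr_gt0.
have r0 : 0 < 1 + p by rewrite addr_gt0.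
have /andP[rhoge rhole] := ratio_expr_bounds _ t.+1 _ p01.
have /andP[eA Ae] := expr_onem_bounds _ t.+1 _ p01.
set mu := t.+1%:R * p in rhoge rhole eA Ae *; have mu0 : 0 < mu by rewrite mulr_gt0.
set x := mu / (1 - p) in rhoge eA *; have x0 : 0 < x by rewrite divr_gt0.
set rho := ((1 - p) / (1 + p)) ^+ t.+1 in rhoge rhole *.
have rho0 : 0 <= rho by rewrite exprn_ge0// divr_ge0// ltW.
(* 2 x = a + d, where d may be large. The loss is at most e^(-a) d, and a e^(-a) <= 1 bounds it by 2
   p/(1 - p) for every s. *)
have gap : rho <= expR (- x) ^+ 2 + 2 * (p / (1 - p)).
  apply: (le_trans rhole).
  set a := 2 * mu / (1 + p); set d := a * (2 * (p / (1 - p))).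
  have -> : expR (- x) ^+ 2 = expR (- a) * expR (- d).
    rewrite expr2 -!expRD; congr expR; rewrite /d /a /x.
    by field; rewrite !gt_eqF.
  have a0 : 0 <= a by rewrite divr_ge0// ?mulr_ge0// ltW.
  have : expR (- a) * (1 - d) <= expR (- a) * expR (- d).
    by rewrite ler_wpM2l ?expR_ge0//; exact: expR_ge1Dx.
  have : a * expR (- a) * (2 * (p / (1 - p))) <= 1 * (2 * (p / (1 - p))).
    by rewrite ler_wpM2r ?mul_expRN_le1// mulr_ge0// divr_ge0// ltW.
  rewrite {}/d; move: (p / (1 - p)) (expR (- a)) (expR (- _)) => u v w; nra.
have d1 : (1 - expR (- x) ^+ 2) / (2 * mu / (1 - p)) <= 1.
  have /andP[_] := onem_expRN_div _ _ (mulr_gt0 (ltr0Sn R 1) x0).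
  have -> : - (2 * x) = - x + - x by ring.
  by rewrite expRD -expr2 /x mulrA.
have mu20 : 0 < 2 * mu by rewrite mulr_gt0.
have M := onem_div_le _ _ _ _ _ p01 mu20 rhoge d1.
have x2 : 2 * mu / (1 - p) = 2 * x by rewrite /x mulrA.
rewrite x2 in M.
have rr : rho / (1 + p) <= rho.
  by rewrite ler_pdivrMr// mulrDr mulr1 lerDl mulr_ge0// ltW.
rewrite /hbound_sym/= /limit_profile_sym -/rho -/mu.
have qE : (1 - p)^-1 = 1 + p / (1 - p) by field; rewrite gt_eqF.
have p0' : 0 <= p / (1 - p) by rewrite divr_ge0// ltW.
move: M eA gap rr qE p0'; clearbody x mu rho.
move: ((1 - rho) / (2 * mu)) (rho / (1 + p)) (p / (1 - p)) ((1 - p)^-1) => a f b c.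
move: ((1 - expR (- x) ^+ 2) / (2 * x)) (expR (- x)) => g h.
move: ((1 - p) ^+ _) => d; lra.
Qed.

(** * The limit of C_J as p tends to 0, for an abstract limit profile *)

Section CJ_limit.
Context (R : realType) (J e : pred nat) (g : R -> R) (H : nat -> R -> R) (c : R).
Hypotheses (J1 : J 1%N) (JE : forall i, ~~ J i.+2 = e i).
Hypothesis H_series : forall t p, 0 < p < 1 ->
  series (fun i => (e i)%:R * hmajorant R t p i) @ \oo --> H t.+1 p / (1 - p) ^+ t.+1.
Hypothesis H_le : forall t p, 0 < p < 1 ->
  H t.+1 p <= g (t.+1%:R * p / (1 - p)) + 3%:R * (p / (1 - p)).
Hypothesis g_le : forall x, 0 < x -> g x <= c.
Hypothesis H_cvg : forall x, 0 < x ->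
  H (Num.truncn (x / p)).+1 p @[p --> 0^'+] --> g x.

Let G := sup [set g x | x in [set x : R | 0 < x]].

Let has_sup_g : has_sup [set g x | x in [set x : R | 0 < x]].
Proof.
split; first by exists (g 1), 1 => //=; exact: ltr01.
by exists c => _ [x x0 <-]; exact: g_le.
Qed.

Lemma profile_sup_le : G <= c.
Proof. by apply: ge_sup => [|_ [x x0 <-]]; [case: has_sup_g|exact: g_le]. Qed.

Lemma profile_le_sup x : 0 < x -> g x <= G.
Proof. by move=> x0; apply: ub_le_sup; [case: has_sup_g|exists x]. Qed.

Let H_le_sup t p : 0 < p < 1 -> H t.+1 p <= G + 3%:R * (p / (1 - p)).
Proof.
move=> p01; apply: (le_trans (H_le t p p01)); rewrite lerD2r profile_le_sup//.
by case/andP: p01 => p0 p1; rewrite divr_gt0 ?subr_gt0// mulr_gt0.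
Qed.

Lemma sum_hterm_shift s p M : \sum_(1 <= k < M.+2 | ~~ J k) hterm R s p k =
  \sum_(0 <= i < M) (e i)%:R * hterm R s p i.+2.
Proof.
rewrite big_ltn_cond// J1/= big_add1 big_add1/= big_mkcond/=.
by apply: eq_bigr => i _; rewrite JE; case: (e i); rewrite ?mul1r ?mul0r.
Qed.

Lemma hterm_ge0 s (p : R) k : 0 <= p -> 0 <= hterm R s p k.
Proof.
by move=> p0; rewrite mulr_ge0 ?exprn_ge0// mulr_ge0// divr_ge0 ?exprn_ge0.
Qed.

Lemma sum_hterm_le t p M : 0 < p < 1 ->
  \sum_(1 <= k < M.+1 | ~~ J k) hterm R t.+1 p k <=
  p ^+ 2 * (H t.+1 p / (1 - p) ^+ t.+1).
Proof.
move=> p01; have /andP[p0 p1] := p01.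
apply: (@le_trans _ _ (\sum_(1 <= k < M.+2 | ~~ J k) hterm R t.+1 p k)).
  rewrite big_mkcond [leRHS]big_mkcond/= [leRHS]big_nat_recr//= lerDl.
  by case: ifP => // _; rewrite hterm_ge0// ltW.
rewrite sum_hterm_shift.
apply: (@le_trans _ _ (p ^+ 2 * series (fun i => (e i)%:R * hmajorant R t p i) M)).
  rewrite /series/= mulr_sumr; apply: ler_sum => i _.
  rewrite [leRHS]mulrCA ler_wpM2l// htermE// -[leRHS]mulr1 ler_wpM2l//.
    by rewrite mulr_ge0 ?exprn_ge0 ?hmajorant_ge0// ltW.
rewrite ler_wpM2l ?exprn_ge0 ?(ltW p0)//.
have cs := H_series t p p01; rewrite -(cvg_lim _ cs)//; apply: nondecreasing_cvgn_le.
  by apply: nondecreasing_series => i _ _; rewrite mulr_ge0// hmajorant_ge0.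
by apply/cvg_ex; eexists; exact: cs.
Qed.

(** A bound valid at each p and s, not only in the limit: at p = 1/n it is the hypothesis of the
    energy recursion. *)
Lemma sum_hterm_bound s p M : (1 <= s)%N -> 0 < p < 1 ->
  \sum_(1 <= k < M.+1 | ~~ J k) hterm R s p k * (1 - p) ^+ s <=
  (G + 3%:R * (p / (1 - p))) * p ^+ 2.
Proof.
case: s => // t _ p01; have /andP[p0 p1] := p01.
have q0 : 0 < (1 - p) ^+ t.+1 by rewrite exprn_gt0// subr_gt0.
rewrite -mulr_suml -ler_pdivlMr//; apply: (le_trans (sum_hterm_le t p M p01)).
rewrite [leRHS]mulrAC [leRHS]mulrC ler_wpM2l ?exprn_ge0 ?(ltW p0)//.
by rewrite ler_pM2r ?invr_gt0// H_le_sup.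
Qed.

Lemma hJ_le t p : 0 < p < 1 -> (hJ J t.+1 p <= (H t.+1 p)%:E)%E.
Proof.
move=> p01; have /andP[p0 p1] := p01.
have q0 : 0 < (1 - p) ^+ t.+1 by rewrite exprn_gt0// subr_gt0.
have -> : H t.+1 p = (1 - p) ^+ t.+1 / p ^+ 2 * (p ^+ 2 * (H t.+1 p / (1 - p) ^+ t.+1)).
  by rewrite mulrA divfK ?expf_neq0 ?gt_eqF// mulrCA divff ?mulr1// gt_eqF.
rewrite /hJ [X in (_ <= X)%E]EFinM lee_pmul2l ?lte_fin ?(divr_gt0 q0 (exprn_gt0 2 p0))//.
apply: lime_le.
  by apply: is_cvg_nneseries_cond => k _ _; rewrite lee_fin (hterm_ge0 t.+1 p k (ltW p0)).
near=> M; rewrite sumEFin lee_fin.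
have M0 : (0 < M)%N by near: M; exact: nbhs_infty_gt.
by rewrite -(prednK M0); exact: sum_hterm_le.
Unshelve. all: by end_near. Qed.

Lemma hJ_ge t p : 0 < p < 1 ->
  (((1 - t.+1%:R^-1) * H t.+1 p)%:E <= hJ J t.+1 p)%E.
Proof.
move=> p01; have /andP[p0 p1] := p01.
have q0 : 0 < (1 - p) ^+ t.+1 by rewrite exprn_gt0// subr_gt0.
have c1 : (fun M => (1 - p) ^+ t.+1 * (1 - t.+1%:R^-1) *
     series (fun i => (e i)%:R * hmajorant R t p i) M) @ \oo -->
   (1 - t.+1%:R^-1) * H t.+1 p.
  rewrite (_ : (1 - _) * _ = (1 - p) ^+ t.+1 * (1 - t.+1%:R^-1) *
      (H t.+1 p / (1 - p) ^+ t.+1)); first by apply: cvgMr; exact: H_series.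
  rewrite -mulrA mulrCA; congr (_ * _).
  by rewrite mulrCA divff ?mulr1// gt_eqF.
have le1 M : (((1 - p) ^+ t.+1 * (1 - t.+1%:R^-1) *
     series (fun i => (e i)%:R * hmajorant R t p i) M)%:E <= hJ J t.+1 p)%E.
  apply: (@le_trans _ _ (((1 - p) ^+ t.+1 / p ^+ 2)%:E *
     (\sum_(1 <= k < M.+2 | ~~ J k) hterm R t.+1 p k)%:E)%E); last first.
    rewrite /hJ lee_pmul2l ?lte_fin ?(divr_gt0 q0 (exprn_gt0 2 p0))// -sumEFin.
    apply: nneseries_lim_ge => k _.
    by rewrite lee_fin (hterm_ge0 t.+1 p k (ltW p0)).
  rewrite -EFinM lee_fin sum_hterm_shift /series/= -mulrA -mulrA ler_wpM2l ?(ltW q0)//.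
  rewrite !mulr_sumr; apply: ler_sum => i _.
  rewrite [leLHS]mulrCA [leRHS]mulrCA ler_wpM2l// htermE// -[p ^+ 2 * _ * _]mulrA.
  rewrite mulKf ?expf_neq0 ?gt_eqF//.
  rewrite [leRHS]mulrC ler_wpM2r ?hmajorant_ge0// lerD2l lerN2 lef_pV2 ?posrE//.
  by rewrite ler_nat -[t.+3]addn2 addnA addnAC leq_addl.
(* The value +oo satisfies the claim trivially, and -oo contradicts the bound by partial sums. *)
move: le1; case: (hJ J t.+1 p) => [r| |] le1; [|by rewrite leey|by have := le1 0%N].
rewrite lee_fin -(cvg_lim _ c1)//; apply: limr_le; first by apply/cvg_ex; eexists; exact: c1.
by near=> M; have := le1 M; rewrite lee_fin.
Unshelve. all: by end_near. Qed.

Lemma CJ_le (p : R) : 0 < p < 1 -> (CJ J p <= (G + 3%:R * (p / (1 - p)))%:E)%E.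
Proof.
move=> p01; apply: ge_ereal_sup => _ [t _ <-].
by apply: (le_trans (hJ_le t p p01)); rewrite lee_fin H_le_sup.
Qed.

Lemma hJ_le_CJ t (p : R) : (hJ J t.+1 p <= CJ J p)%E.
Proof. by apply: ereal_sup_ubound; exists t. Qed.

Lemma profile_bound_ge0 t p : 0 < p < 1 -> 0 <= H t.+1 p.
Proof.
move=> p01; have /andP[p0 p1] := p01.
have q0 : 0 < (1 - p) ^+ t.+1 by rewrite exprn_gt0// subr_gt0.
suff : 0 <= H t.+1 p / (1 - p) ^+ t.+1 by rewrite pmulr_lge0// invr_gt0.
have cs := H_series t p p01; rewrite -(cvg_lim _ cs)//; apply: limr_ge.
  by apply/cvg_ex; eexists; exact: cs.
near=> n; rewrite /series/=; apply: sumr_ge0 => i _.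
by rewrite mulr_ge0// hmajorant_ge0.
Unshelve. all: by end_near. Qed.

(** A squeeze: from above by the bound uniform in s, from below by the single index s = floor(x/p) +
    1, for which s p -> x. *)
Lemma cvg_CJ : (CJ J p : \bar R) @[p --> (0 : R)^'+] --> G%:E.
Proof.
have near01 : \forall p \near (0 : R)^'+, 0 < p < 1.
  near=> p; apply/andP; split; first by near: p; exact: nbhs_right_gt.
  by near: p; apply: nbhs_right_lt.
have fin : \forall p \near (0 : R)^'+, (CJ J p : \bar R) \is a fin_num.
  near=> p; have p01 : 0 < p < 1 by near: p.
  rewrite fin_numE -ltNye -ltey; apply/andP; split.
    by apply: lt_le_trans (hJ_le_CJ 0 p); apply: lt_le_trans (hJ_ge 0 p p01); rewrite ltNye.
  by apply: le_lt_trans (CJ_le p p01) _; rewrite ltey.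
apply/fine_cvgP; split => //.
have cub : (fun p : R => G + 3%:R * (p / (1 - p))) @ (0 : R)^'+ --> G.
  have GE : G = G + 3%:R * (0 / (1 - 0)) by rewrite mul0r mulr0 addr0.
  apply: cvg_at_right_filter; rewrite [X in _ --> X]GE.
  apply: cvgD; first exact: cvg_cst.
  apply: cvgMr; apply: cvgM; first exact: cvg_id.
  apply: cvgV; first by rewrite subr0 oner_neq0.
  by apply: cvgB; [exact: cvg_cst|exact: cvg_id].
apply/cvgrPdist_le => /= eps eps0.
(* A point x at which the profile is within eps/2 of its supremum. *)
have [_ [x x0 <-] gx] := sup_adherent (divr_gt0 eps0 (ltr0Sn R 1)) has_sup_g.
have low : (fun p : R => (1 - p / x) * H (Num.truncn (x / p)).+1 p) @ (0 : R)^'+ --> g x.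
  rewrite -[g x]mul1r; apply: cvgM; last exact: H_cvg.
  have E1 : 1 = 1 - 0 / x by rewrite mul0r subr0.
  apply: cvg_at_right_filter; rewrite [X in _ --> X]E1.
  by apply: cvgB; [exact: cvg_cst|apply: cvgMl; exact: cvg_id].
have e20 : 0 < eps / 2 by rewrite divr_gt0.
near=> p.
have p01 : 0 < p < 1 by near: p.
have /andP[p0 p1] := p01.
have Cfin : CJ J p \is a fin_num by near: p.
rewrite ler_distlC; apply/andP; split.
  rewrite -lee_fin fineK//; set t := Num.truncn (x / p).
  apply: le_trans (hJ_le_CJ t p); apply: le_trans (hJ_ge t p p01).
  rewrite lee_fin; apply: (@le_trans _ _ ((1 - p / x) * H t.+1 p)); last first.
    (* Since s > x/p, the lost factor 1 - 1/s is at least 1 - p/x. *)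
    rewrite ler_wpM2r ?profile_bound_ge0// lerD2l lerN2 -[leRHS]invf_div.
    by rewrite lef_pV2 ?posrE ?divr_gt0// ltW// truncnS_gt.
  have : g x - eps / 2 <= (1 - p / x) * H t.+1 p.
    rewrite lerBlDr addrC -lerBlDr; apply: le_trans (ler_norm _) _.
    by rewrite /t; near: p; move/cvgrPdist_le : low; exact.
  by move: gx; rewrite -/G; lra.
rewrite -lee_fin fineK//; apply: (le_trans (CJ_le p p01)); rewrite lee_fin.
rewrite -lerBlDl; apply: le_trans (ler_norm _) _; rewrite distrC.
by near: p; move/cvgrPdist_le : cub; exact.
Unshelve. all: by end_near. Qed.
End CJ_limit.

(** * Limits of the closed bounds along s = floor(x/p) + 1 *)

Section profile_limits.
Context (R : realType) (x : R).
Hypothesis x0 : 0 < x.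
Let s (p : R) := (Num.truncn (x / p)).+1.

Let near01 : \forall p \near (0 : R)^'+, 0 < p < 1.
Proof.
near=> p; apply/andP; split; first by near: p; exact: nbhs_right_gt.
by near: p; exact: nbhs_right_lt.
Unshelve. all: by end_near. Qed.

Let cvgp : (p : R) @[p --> (0 : R)^'+] --> (0 : R).
Proof. by apply: cvg_at_right_filter; exact: cvg_id. Qed.

Let cvg_onem : (1 - p : R) @[p --> (0 : R)^'+] --> (1 : R).
Proof. by rewrite -[X in _ --> X]subr0; apply: cvgB => //; exact: cvg_cst. Qed.

Let cvg_onep : (1 + p : R) @[p --> (0 : R)^'+] --> (1 : R).
Proof. by rewrite -[X in _ --> X]addr0; apply: cvgD => //; exact: cvg_cst. Qed.

Let cvg_inv (f : R -> R) : f @ (0 : R)^'+ --> (1 : R) ->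
  (f p)^-1 @[p --> (0 : R)^'+] --> (1 : R).
Proof. by move=> f1; rewrite -[X in _ --> X]invr1; apply: cvgV => //; exact: oner_neq0. Qed.

Let cvg_mu : ((s p)%:R * p : R) @[p --> (0 : R)^'+] --> x.
Proof.
apply: (@squeeze_cvgr _ _ _ _ (cst x) (fun p => x + p)).
- near=> p; have /andP[p0 p1] : 0 < p < 1 by near: p.
  rewrite /cst /s -ler_pdivrMr// ltW ?truncnS_gt//=.
  rewrite -natr1 mulrDl mul1r lerD2r -ler_pdivlMr//.
  by rewrite truncn_le// divr_ge0// ltW.
- exact: cvg_cst.
- by rewrite -[X in _ --> X]addr0; apply: cvgD => //; exact: cvg_cst.
Unshelve. all: by end_near. Qed.

Let cvg_expN (f : R -> R) (l : R) : f @ (0 : R)^'+ --> l ->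
  expR (- f p) @[p --> (0 : R)^'+] --> expR (- l).
Proof.
by move=> fl; apply: (cvg_comp _ _ (cvgN fl)); exact: continuous_expR.
Qed.

Let cvg_pow : (1 - p) ^+ s p @[p --> (0 : R)^'+] --> expR (- x).
Proof.
apply: (@squeeze_cvgr _ _ _ _ (fun p => expR (- ((s p)%:R * p / (1 - p))))
  (fun p => expR (- ((s p)%:R * p)))).
- by near=> p; apply: expr_onem_bounds; near: p.
- by apply: cvg_expN; rewrite -[x]mulr1; apply: cvgM => //; exact: cvg_inv.
- exact: cvg_expN.
Unshelve. all: by end_near. Qed.

Let cvg_ratio : ((1 - p) / (1 + p)) ^+ s p @[p --> (0 : R)^'+] --> expR (- x) ^+ 2.
Proof.
apply: (@squeeze_cvgr _ _ _ _ (fun p => expR (- ((s p)%:R * p / (1 - p))) ^+ 2)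
  (fun p => expR (- (2 * ((s p)%:R * p) / (1 + p))))).
- by near=> p; apply: ratio_expr_bounds; near: p.
- have H : expR (- ((s p)%:R * p / (1 - p))) @[p --> (0 : R)^'+] --> expR (- x).
    by apply: cvg_expN; rewrite -[x]mulr1; apply: cvgM => //; exact: cvg_inv.
  by rewrite expr2; under eq_fun do rewrite expr2; exact: cvgM.
- rewrite expr2 -expRD (_ : - x + - x = - (2 * x / 1)); last by rewrite divr1; ring.
  by apply: cvg_expN; apply: cvgM; [apply: cvgMr|rewrite invr1; exact: cvg_inv].
Unshelve. all: by end_near. Qed.

Lemma cvg_hbound12 :
  hbound12 R (Num.truncn (x / p)).+1 p @[p --> (0 : R)^'+] --> limit_profile12 R x.
Proof.
rewrite /hbound12 /limit_profile12; apply: cvgB; last exact: cvgMr.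
apply: cvgD; first exact: cvg_inv.
apply: cvgM; first by apply: cvgB; [exact: cvg_cst|exact: cvg_pow].
by apply: cvgV; [rewrite gt_eqF|exact: cvg_mu].
Qed.

Lemma cvg_hbound_sym :
  hbound_sym R (Num.truncn (x / p)).+1 p @[p --> (0 : R)^'+] --> limit_profile_sym R x.
Proof.
rewrite /hbound_sym /limit_profile_sym; apply: cvgB; last exact: cvgMr.
apply: cvgD.
  apply: cvgMl; apply: cvgD; first exact: cvg_inv.
  rewrite -[expR (- x) ^+ 2]mulr1; apply: cvgM; first exact: cvg_ratio.
  exact: cvg_inv.
apply: cvgM; first by apply: cvgB; [exact: cvg_cst|exact: cvg_ratio].
by apply: cvgV; [rewrite gt_eqF// mulr_gt0|apply: cvgMr; exact: cvg_mu].
Qed.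

End profile_limits.

(** * Hermite polynomials and Gaussian moments *)

Section hermite.
Context (R : numFieldType).
Implicit Types (v w x y c : R) (k l m : nat) (q : {poly R}).

(** Generating function exp(t x - v t^2/2): the classical polynomials divided by k!. At v = 1 the
    Gaussian square norm of degree k is therefore 1/k!, whence the weights k! in the energy. *)
Fixpoint hermite v k : {poly R} :=
  match k with
  | 0 => 1
  | l.+1 => l.+1%:R^-1 *:
      ('X * hermite v l - v *: (if l is m.+1 then hermite v m else 0))
  end.

Arguments hermite : simpl never.

(** Degree k - 1 with the convention 0 at k = 0, so that the recurrence and the derivative have a
    single form. *)
Definition hermite_pred v k : {poly R} := if k is l.+1 then hermite v l else 0.

Lemma hermiteS v k :
  k.+1%:R *: hermite v k.+1 = 'X * hermite v k - v *: hermite_pred v k.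
Proof. by rewrite [hermite v k.+1]/hermite -/hermite scalerA divff ?scale1r// pnatr_eq0. Qed.

Lemma horner_hermiteS v k x : k.+1%:R * (hermite v k.+1).[x] =
  x * (hermite v k).[x] - v * (hermite_pred v k).[x].
Proof. by rewrite -hornerZ hermiteS !hornerE. Qed.

Lemma hermite1 v : hermite v 1 = 'X.
Proof. by rewrite /hermite invr1 scale1r mulr1 scaler0 subr0. Qed.

Lemma horner_hermite0 v x : (hermite v 0).[x] = 1.
Proof. by rewrite /hermite hornerE. Qed.

Lemma horner_hermite2 v x : (hermite v 2).[x] = (x ^+ 2 - v) / 2.
Proof.
have := horner_hermiteS v 1 x; rewrite hermite1 hornerX horner_hermite0 => E.
apply: (canRL (mulfK _)); first by rewrite pnatr_eq0.
by rewrite mulrC E expr2 mulr1.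
Qed.

(** With c = n^(-1/2) it relates variance n, suited to the sum, to variance 1, suited to S_n; this
    produces the n^m in the energy. *)
Lemma hermite_scale v w c x k : c ^+ 2 * v = w ->
  (hermite w k).[c * x] = c ^+ k * (hermite v k).[x].
Proof.
move=> <-; have [n] := ubnP k; elim: n k => // n IH [_|k kn].
  by rewrite !horner_hermite0 expr0 mulr1.
have k0 : k.+1%:R != 0 :> R by rewrite pnatr_eq0.
apply: (mulfI k0); rewrite horner_hermiteS mulrCA horner_hermiteS IH//.
rewrite exprS; case: k kn {k0} => [|k] kn /=; first by rewrite !horner0; ring.
by rewrite (IH k) ?exprS; [ring|exact: ltnW].
Qed.

Lemma hermite_opp v x k : (hermite v k).[- x] = (-1) ^+ k * (hermite v k).[x].
Proof.
by have := @hermite_scale v v (-1) x k; rewrite mulN1r sqrrN expr1n mul1r => ->.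
Qed.

(** Generating functions multiply. On coefficients, m + 1 = i + (m + 1 - i) splits the convolution
    into two halves, and the recurrence is applied to a different family in each. *)
Lemma hermite_add v w x y m :
  (hermite (v + w) m).[x + y] =
  \sum_(0 <= i < m.+1) (hermite v i).[x] * (hermite w (m - i)).[y].
Proof.
have [n] := ubnP m; elim: n m => // n IH [_|m mn].
  by rewrite big_nat1 subnn !horner_hermite0 mulr1.
have m0 : m.+1%:R != 0 :> R by rewrite pnatr_eq0.
apply: (mulfI m0); rewrite horner_hermiteS IH//.
have predE : (hermite_pred (v + w) m).[x + y] =
    \sum_(0 <= i < m.+1) (hermite_pred v i).[x] * (hermite w (m - i)).[y].
  case: m mn {m0} => [|m] mn; first by rewrite big_nat1 /= !horner0 mul0r.
  rewrite big_nat_recl//= horner0 mul0r add0r IH; last exact: ltnW.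
  by apply: eq_bigr => i _; rewrite subSS.
have predE' : (hermite_pred (v + w) m).[x + y] =
    \sum_(0 <= i < m.+1) (hermite v i).[x] * (hermite_pred w (m - i)).[y].
  case: m mn {m0 predE} => [|m] mn; first by rewrite big_nat1 /= !horner0 mulr0.
  rewrite big_nat_recr//= subnn horner0 mulr0 addr0 IH; last exact: ltnW.
  by apply: eq_big_nat => i /andP[_ im]; rewrite subSn.
transitivity (\sum_(0 <= i < m.+1)
      i.+1%:R * (hermite v i.+1).[x] * (hermite w (m - i)).[y] +
    \sum_(0 <= i < m.+1)
      (hermite v i).[x] * ((m - i).+1%:R * (hermite w (m - i).+1).[y])).
  rewrite mulrDl mulrDl opprD addrACA {1}predE predE'; congr (_ + _).
    rewrite !mulr_sumr -sumrB; apply: eq_bigr => i _.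
    by rewrite horner_hermiteS; ring.
  rewrite !mulr_sumr -sumrB; apply: eq_bigr => i _.
  by rewrite horner_hermiteS; ring.
have -> : m.+1%:R * \sum_(0 <= i < m.+2) (hermite v i).[x] * (hermite w (m.+1 - i)).[y] =
   \sum_(0 <= i < m.+2) i%:R * (hermite v i).[x] * (hermite w (m.+1 - i)).[y] +
   \sum_(0 <= i < m.+2) (hermite v i).[x] * ((m.+1 - i)%:R * (hermite w (m.+1 - i)).[y]).
  rewrite mulr_sumr -big_split/=; apply: eq_big_nat => i /andP[_ im].
  have -> : m.+1%:R = i%:R + (m.+1 - i)%:R :> R by rewrite -natrD subnKC.
  ring.
congr (_ + _).
  by rewrite [RHS]big_nat_recl// !mul0r add0r.
rewrite [RHS]big_nat_recr//= subnn mul0r mulr0 addr0.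
by apply: eq_big_nat => i /andP[_ im]; rewrite subSn.
Qed.

Lemma deriv_hermite v k : (hermite v k)^`() = hermite_pred v k.
Proof.
have [n] := ubnP k; elim: n k => // n IH [_|k kn]; first by rewrite derivC.
have k0 : k.+1%:R != 0 :> R by rewrite pnatr_eq0.
apply: (scalerI k0); rewrite -derivZ hermiteS derivB derivM derivX mul1r derivZ IH//.
case: k kn k0 => [|k] kn k0 /=; first by rewrite derivC scaler0 mulr0 subr0 addr0 scale1r.
have -> : k.+2%:R *: hermite v k.+1 = hermite v k.+1 + k.+1%:R *: hermite v k.+1.
  by rewrite -(natr1 k.+1) scalerDl scale1r addrC.
rewrite hermiteS (IH k); last by rewrite -ltnS ltnW.
by rewrite -addrA.
Qed.

End hermite.

Section hermite_functional.
Context (R : numFieldType) (L : {poly R} -> R).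
Hypothesis L_lin : forall a p q, L (a *: p + q) = a * L p + L q.
Hypothesis L1 : L 1 = 1.
Hypothesis LX : forall q, L ('X * q) = L q^`().

Let L0 : L 0 = 0.
Proof. by have := L_lin (-1) 0 0; rewrite scaler0 addr0 mulN1r addNr. Qed.

Let LZ a p : L (a *: p) = a * L p.
Proof. by have := L_lin a p 0; rewrite addr0 L0 addr0. Qed.

Let LD p q : L (p + q) = L p + L q.
Proof. by have := L_lin 1 p q; rewrite scale1r mul1r. Qed.

Let LhermiteS k q : k.+1%:R * L (hermite R 1 k.+1 * q) = L (hermite R 1 k * q^`()).
Proof.
rewrite -LZ scalerAl hermiteS scale1r mulrBl -mulrA LD LX derivM deriv_hermite LD.
by rewrite -[- (_ * q)]scaleN1r LZ; ring.
Qed.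

(** Linearity and the integration by parts [LX] give (k + 1) L(H_(k+1) q) = L(H_k q'), so the degree
    of H_k is traded for derivatives of the other factor. *)
Lemma L_hermite_orth k l :
  L (hermite R 1 k * hermite R 1 l) = (k == l)%:R / k`!%:R.
Proof.
elim: k l => [|k IH] [|l].
- by rewrite mul1r L1 divr1.
- have l0 : l.+1%:R != 0 :> R by rewrite pnatr_eq0.
  by rewrite mulrC mul0r; apply: (mulfI l0); rewrite LhermiteS derivC mulr0 L0 mulr0.
- have k0 : k.+1%:R != 0 :> R by rewrite pnatr_eq0.
  by rewrite mul0r; apply: (mulfI k0); rewrite LhermiteS derivC mulr0 L0 mulr0.
have k0 : k.+1%:R != 0 :> R by rewrite pnatr_eq0.
apply: (mulfI k0); rewrite LhermiteS deriv_hermite /= IH eqSS factS natrM.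
by rewrite invfM mulrCA mulVKf.
Qed.

End hermite_functional.

Lemma size_hermite (R : numFieldType) (v : R) k : size (hermite R v k) = k.+1.
Proof.
have [n] := ubnP k; elim: n k => // n IH [_|k kn]; first by rewrite size_poly1.
have k0 : k.+1%:R != 0 :> R by rewrite pnatr_eq0.
have sX : size ('X * hermite R v k) = k.+2.
  by rewrite mulrC size_mulX ?IH// -size_poly_gt0 IH.
rewrite -(size_scale _ k0) hermiteS size_polyDl sX// size_polyN.
rewrite (leq_ltn_trans (size_scale_leq _ _))//.
case: k kn {k0 sX} => [|k] kn; first by rewrite size_poly0.
by rewrite [hermite_pred R v k.+1]/(hermite R v k) IH// -ltnS ltnW.
Qed.

Lemma hermite_expansion (R : numFieldType) (v : R) (q : {poly R}) :
  exists c : nat -> R, q = \sum_(0 <= k < size q) c k *: hermite R v k.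
Proof.
suff H n (p : {poly R}) : (size p <= n)%N ->
    exists c : nat -> R, p = \sum_(0 <= k < n) c k *: hermite R v k by exact: H.
elim: n p => [|n IH] p pn.
  by exists (fun=> 0); rewrite big_geq//; apply/eqP; rewrite -size_poly_leq0.
have h0 : lead_coef (hermite R v n) != 0.
  by rewrite lead_coef_eq0 -size_poly_gt0 size_hermite.
pose a := p`_n / lead_coef (hermite R v n).
have [|c cE] := IH (p - a *: hermite R v n).
  apply/leq_sizeP => j; rewrite leq_eqVlt => /predU1P[<-|nj].
    have -> : (p - a *: hermite R v n)`_n = p`_n - a * lead_coef (hermite R v n).
      by rewrite coefB coefZ lead_coefE size_hermite.
    by rewrite divfK// subrr.
  rewrite coefB coefZ !nth_default ?mulr0 ?subrr// ?size_hermite//.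
  exact: leq_trans pn nj.
exists (fun k => if (k < n)%N then c k else a).
rewrite big_nat_recr//= ltnn -[LHS](subrK (a *: hermite R v n)) {1}cE; congr (_ + _).
by apply: eq_big_nat => k /andP[_ ->].
Qed.

Section gaussian.
Context (R : realType).
Local Notation mu := (@lebesgue_measure R).
Implicit Types (q : {poly R}) (x : R).

Lemma gaussE : @gauss R = normal_pdf 0 1.
Proof.
apply/funext => x; rewrite /gauss normal_pdfE ?oner_neq0// /normal_peak /normal_fun.
by rewrite expr1n mul1r subr0 mulrC mulNr.
Qed.

Lemma gauss_gt0 x : 0 < gauss x.
Proof.
by rewrite /gauss divr_gt0 ?expR_gt0// sqrtr_gt0 mulrn_wgt0// pi_gt0.
Qed.

Lemma gauss_ge0 x : 0 <= gauss x.
Proof. exact: ltW (gauss_gt0 x). Qed.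

Lemma continuous_gauss : continuous (@gauss R).
Proof. by rewrite gaussE; apply: continuous_normal_pdf; exact: oner_neq0. Qed.

Lemma measurable_gauss : measurable_fun [set: R] (@gauss R).
Proof. by rewrite gaussE; exact: measurable_normal_pdf. Qed.

Lemma integral_gauss : (\int[mu]_x (gauss x)%:E = 1)%E.
Proof. by rewrite gaussE integral_normal_pdf. Qed.

(** Induction on [q] with c halved: one half of the exponent absorbs [q], the other the new factor
    x. *)
Lemma horner_le_expR q (c : R) : 0 < c ->
  exists2 C, 0 <= C & forall x, `|q.[x]| <= C * expR (c * x ^+ 2).
Proof.
elim/poly_ind: q c => [|q a IH] c c0; first by exists 0 => // x; rewrite horner0 normr0 mul0r.
have c20 : 0 < c / 2 by rewrite divr_gt0.
have [C C0 qC] := IH (c / 2) c20.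
exists (C * (1 + 2 / c) + `|a|).
  by rewrite addr_ge0// mulr_ge0// addr_ge0// divr_ge0// ltW.
move=> x; rewrite hornerMXaddC.
have e1 (b : R) : 0 <= b -> 1 <= expR (b * x ^+ 2).
  by move=> b0; rewrite -expR0 ler_expR mulr_ge0// sqr_ge0.
have xle : `|x| <= (1 + 2 / c) * expR (c / 2 * x ^+ 2).
  have : c / 2 * x ^+ 2 <= expR (c / 2 * x ^+ 2).
    by apply: le_trans (expR_ge1Dx _); rewrite lerDr.
  rewrite -ler_pdivlMl// invf_div => x2.
  rewrite mulrDl mul1r; apply: le_trans (lerD (e1 _ (ltW c20)) x2).
  rewrite -[x ^+ 2]real_normK ?num_real//.
  have := sqr_ge0 `|x|; have := sqr_ge0 (`|x| - 1).
  by rewrite sqrrB1; move: (`|x|) => t; lra.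
apply: (le_trans (ler_normD _ _)); rewrite mulrDl; apply: lerD; last first.
  exact: (ler_peMr (normr_ge0 a) (e1 c (ltW c0))).
rewrite normrM; have -> : c * x ^+ 2 = c / 2 * x ^+ 2 + c / 2 * x ^+ 2 by field.
rewrite expRD mulrACA.
exact: (ler_pM (normr_ge0 _) (normr_ge0 _) (qC x) xle).
Qed.

Lemma integrable_expR_gauss :
  mu.-integrable [set: R] (fun x => (expR (x ^+ 2 / 4%:R) * gauss x)%:E).
Proof.
have s0 : Num.sqrt 2 != 0 :> R by rewrite gt_eqF// sqrtr_gt0.
(* e^(x^2/4) phi(x) is C times the normal density of variance 2. *)
pose C : R := (normal_peak (Num.sqrt 2))^-1 / Num.sqrt (pi *+ 2).
have := integrableZl measurableT C (integrable_normal_pdf (0 : R) (Num.sqrt 2)).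
apply: eq_integrable => // x _; rewrite -EFinM; congr EFin.
rewrite normal_pdfE// /C mulrACA mulVf ?mul1r; last by rewrite gt_eqF// normal_peak_gt0.
rewrite /gauss mulrA -expRD mulrC; congr (expR _ / _).
by rewrite sqr_sqrtr// subr0; field.
Qed.

Lemma measurable_horner_gauss q :
  measurable_fun [set: R] (fun x => q.[x] * gauss x).
Proof.
apply: measurable_funM; first exact: measurable_poly.
exact: measurable_gauss.
Qed.

Lemma integrable_horner_gauss q : mu.-integrable [set: R] (fun x => (q.[x] * gauss x)%:E).
Proof.
have [C C0 qC] := horner_le_expR q _ (divr_gt0 ltr01 (ltr0Sn R 3)).
apply: (le_integrable measurableT _ _ (integrableZl measurableT C integrable_expR_gauss)).
  by apply/measurable_EFinP; exact: measurable_horner_gauss.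
move=> x _; rewrite -EFinM !abse_EFin lee_fin [C * _]mulrA (normrM q.[x]) (normrM (C * _)) (normrM C).
rewrite (ger0_norm (gauss_ge0 x)) ler_wpM2r ?gauss_ge0//.
rewrite (ger0_norm C0) (ger0_norm (expR_ge0 _)).
by have := qC x; rewrite mul1r [_^-1 * _]mulrC.
Qed.

Definition gauss_mean q : R := (\int[mu]_x (q.[x] * gauss x))%R.

Lemma gauss_mean_lin a p q : gauss_mean (a *: p + q) = a * gauss_mean p + gauss_mean q.
Proof.
have ia := integrableZl measurableT a (integrable_horner_gauss p).
have iq := integrable_horner_gauss q.
rewrite /gauss_mean -RintegralZl//; last exact: integrable_horner_gauss.
rewrite -RintegralD//; apply: eq_Rintegral => x _.
by rewrite hornerD hornerZ; ring.
Qed.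

Lemma gauss_mean1 : gauss_mean 1 = 1.
Proof.
rewrite /gauss_mean /Rintegral; under eq_integral do rewrite -polyC1 hornerC mul1r.
by rewrite integral_gauss.
Qed.

Lemma is_derive_gauss x : is_derive x (1 : R) (@gauss R) (- x * gauss x).
Proof.
rewrite /gauss; apply: is_derive_eq.
by rewrite /GRing.scale/= !mulr1 !mulr0 ?addr0 ?add0r; field; rewrite gt_eqF// sqrtr_gt0 mulrn_wgt0// pi_gt0.
Qed.

Lemma is_derive_horner q x : is_derive x (1 : R) (horner q) q^`().[x].
Proof.
by rewrite -[q^`().[x]]/(horner q^`() x) derivE derive1E; apply: derivableP;
  exact: derivable_horner.
Qed.

Lemma is_derive_horner_gauss q x :
  is_derive x (1 : R) (fun y => q.[y] * gauss y) ((q^`() - 'X * q).[x] * gauss x).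
Proof.
have dq := is_derive_horner q x; have dg := is_derive_gauss x.
have := is_deriveM dq dg; rewrite /GRing.scale/= => H.
by apply: (is_derive_eq H); rewrite hornerD hornerN hornerM hornerX; ring.
Qed.

Lemma continuous_horner_gauss q : continuous (fun x => q.[x] * gauss x).
Proof. by move=> x; apply: cvgM; [exact: continuous_horner|exact: continuous_gauss]. Qed.

Lemma cvg_horner_gauss q (e : R) : e ^+ 2 = 1 ->
  q.[e * n%:R] * gauss (e * n%:R) @[n --> \oo] --> (0 : R).
Proof.
move=> e2; have [C C0 qC] := horner_le_expR q _ (divr_gt0 ltr01 (ltr0Sn R 3)).
apply/norm_cvg0P.
apply: (@squeeze_cvgr _ _ _ _ (cst 0)
  (fun n => C / Num.sqrt (pi *+ 2) * expR (- n%:R))).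
- near=> n; rewrite normr_ge0/= normrM (ger0_norm (gauss_ge0 _)).
  apply: (le_trans (ler_wpM2r (gauss_ge0 _) (qC _))).
  have yE : (e * n%:R) ^+ 2 = n%:R ^+ 2 by rewrite exprMn e2 mul1r.
  rewrite /gauss yE; set y := n%:R ^+ 2; set K := Num.sqrt _.
  have -> : C * expR (1 / 4%:R * y) * (expR (- y / 2) / K) =
      C / K * (expR (1 / 4%:R * y) * expR (- y / 2)) by ring.
  rewrite -expRD ler_wpM2l ?divr_ge0 ?sqrtr_ge0// ler_expR.
  have n4 : 4%:R <= n%:R :> R by rewrite ler_nat; near: n; exact: nbhs_infty_ge.
  have : 4%:R * n%:R <= y by rewrite /y expr2 ler_wpM2r.
  by rewrite -[n%:R]/(n%:R : R); move: (n%:R : R) y => a b; lra.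
- exact: cvg_cst.
- by rewrite -[X in _ --> X](mulr0 (C / Num.sqrt (pi *+ 2))); apply: cvgMr; exact: cvgn_expR.
Unshelve. all: by end_near. Qed.

(** Stein's identity: (q phi)' = (q' - X q) phi is integrated over growing symmetric intervals,
    where the boundary terms vanish in the limit. *)
Lemma gauss_meanX q : gauss_mean ('X * q) = gauss_mean q^`().
Proof.
apply/esym/eqP; rewrite -subr_eq0.
pose r := q^`() - 'X * q.
have -> : gauss_mean q^`() - gauss_mean ('X * q) = gauss_mean r.
  have := gauss_mean_lin (-1) ('X * q) q^`().
  by rewrite scaleN1r [- _ + _]addrC -/r mulN1r addrC.
pose F x := q.[x] * gauss x.
pose I n := `[(- n.+1%:R)%R, n.+1%:R : R]%classic.
have FTC n : (\int[mu]_(x in I n) (r.[x] * gauss x)%:E =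
    (F n.+1%:R - F (- n.+1%:R))%:E)%E.
  have cF : continuous F := continuous_horner_gauss q.
  rewrite EFinB; apply: continuous_FTC2.
  - by rewrite (@lt_trans _ _ 0)// oppr_lt0.
  - by apply: continuous_subspaceT; exact: continuous_horner_gauss.
  - split.
    + by move=> x _; have [] := is_derive_horner_gauss q x.
    + by apply: cvg_at_right_filter; exact: cF.
    + by apply: cvg_at_left_filter; exact: cF.
  - by move=> x _; rewrite derive1E; have := is_derive_horner_gauss q x; case.
have ir := integrable_horner_gauss r.
have mI n : measurable (I n) by exact: measurable_itv.
have [||||_ _ c1] := @dominated_convergence _ _ _ mu setT measurableT
  (fun n => (fun x => (r.[x] * gauss x)%:E) \_ (I n))
  (fun x => (r.[x] * gauss x)%:E) (fun x => `|(r.[x] * gauss x)%:E|%E) _ (measurable_int _ ir).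
- by move=> n; apply/(measurable_restrictT _ (mI n)); apply: measurable_funTS; exact: measurable_int ir.
- apply: aeW => x _; apply: cvg_near_cst; near=> n; rewrite patchE mem_set//.
  rewrite /I /= in_itv/= -ler_norml; apply: (@le_trans _ _ n%:R); last by rewrite ler_nat.
  by near: n; exact: nbhs_infty_ger.
- exact: integrable_abse.
- apply: aeW => x n _; rewrite patchE; case: ifP => // _; rewrite abse0; exact: abse_ge0.
have c2 : (F n.+1%:R - F (- n.+1%:R))%:E @[n --> \oo] --> (\int[mu]_x (r.[x] * gauss x)%:E)%E.
  apply: cvg_trans c1; apply: near_eq_cvg; near=> n.
  by rewrite -FTC [RHS]integral_mkcond.
have c3 : F n.+1%:R - F (- n.+1%:R) @[n --> \oo] --> (0 : R).
  rewrite -[X in _ --> X](subr0 0); apply: cvgB.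
    rewrite (cvg_shiftS (fun n => F n%:R)); under eq_fun do rewrite -[_%:R]mul1r.
    by apply: cvg_horner_gauss; rewrite expr1n.
  rewrite (cvg_shiftS (fun n => F (- n%:R))); under eq_fun do rewrite -[- _%:R]mulN1r.
  by apply: cvg_horner_gauss; rewrite sqrrN expr1n.
have c4 : (F n.+1%:R - F (- n.+1%:R))%:E @[n --> \oo] --> (0 : R)%:E by apply/cvg_EFin; [exact: nearW|exact: c3].
by rewrite /gauss_mean /Rintegral (cvg_unique _ c2 c4).
Unshelve. all: by end_near. Qed.
End gaussian.

(** * Densities and the Bessel inequality *)

Section law.
Context (R : realType) (d : measure_display) (T : measurableType d) (P : probability T R).

Lemma measurable_fun_typeR (Y : {mfun T >-> R}) :
  @measurable_fun _ _ T (measurableTypeR R) setT Y.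
Proof. exact: (measurable_funPT Y). Qed.

(* The library's Lebesgue measure lives on [measurableTypeR R], which is not
   unified with the measurable structure of [R] itself; hence this copy of the
   distribution of [Y]. *)
Definition law (Y : {mfun T >-> R}) : probability (measurableTypeR R) R :=
  distribution P (@mfun_Sub _ _ T (measurableTypeR R) Y
    (mem_set (measurable_fun_typeR Y))).

Lemma lawE (Y : {mfun T >-> R}) (A : set R) : law Y A = P (Y @^-1` A).
Proof. by []. Qed.

Lemma ge0_integral_law (Y : {mfun T >-> R}) (f : R -> \bar R) :
  measurable_fun [set: R] f -> (forall x, 0 <= f x)%E ->
  (\int[law Y]_x f x = \int[P]_w f (Y w))%E.
Proof. by move=> mf f0; rewrite ge0_integral_distribution. Qed.

End law.

Section density.
Context (R : realType) (d : measure_display) (T : measurableType d) (P : probability T R).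
Local Notation mu := (@lebesgue_measure R).
Context (Y : {RV P >-> R}) (p : R -> R).
Hypothesis pY : is_density_of P Y p.

Let mp : measurable_fun [set: R] p. Proof. by case: pY. Qed.
Let p0 x : 0 <= p x. Proof. by case: pY. Qed.
Let pE A : measurable A -> P (Y @^-1` A) = (\int[mu]_(x in A) (p x)%:E)%E.
Proof. by case: pY => _ _; exact. Qed.

Lemma integral_density : (\int[mu]_x (p x)%:E = 1)%E.
Proof. by rewrite -pE// preimage_setT probability_setT. Qed.

Lemma integrable_density : mu.-integrable [set: R] (EFin \o p).
Proof.
apply/integrableP; split; first exact/measurable_EFinP.
under eq_integral do rewrite /= ger0_norm//.
by rewrite integral_density ltry.
Qed.

(** The given density agrees almost everywhere with the Radon-Nikodym derivative of the law, for
    which a change of variables is available. *)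
Lemma ge0_density_integral (f : R -> R) : measurable_fun [set: R] f ->
  (forall x, 0 <= f x) ->
  (\int[P]_w (f (Y w))%:E = \int[mu]_x (f x * p x)%:E)%E.
Proof.
move=> mf f0; pose nu := law _ _ _ P Y.
have numu : nu `<< mu.
  apply/null_content_dominatesP => A mA A0.
  rewrite /nu lawE pE// null_set_integral//.
  by apply: measurable_funTS; exact/measurable_EFinP.
pose g := Radon_Nikodym_SigmaFinite.f nu mu.
have gp : ae_eq mu setT g (EFin \o p).
  apply: integral_ae_eq => //.
  - exact: Radon_Nikodym_SigmaFinite.f_integrable.
  - exact/measurable_EFinP.
  - by move=> A _ mA; rewrite -Radon_Nikodym_SigmaFinite.f_integral// -pE.
have mfE : measurable_fun [set: R] (EFin \o f) by exact/measurable_EFinP.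
have fE0 x : (0 <= (EFin \o f) x)%E by rewrite lee_fin.
rewrite -(ge0_integral_law _ _ _ P Y (EFin \o f) mfE fE0).
rewrite -(@Radon_Nikodym_SigmaFinite.change_of_variables _ _ _ nu mu numu _ setT fE0 measurableT mfE).
apply: ae_eq_integral => //.
- apply: emeasurable_funM; first exact/measurable_EFinP.
  exact: measurable_int (Radon_Nikodym_SigmaFinite.f_integrable numu).
- by apply/measurable_EFinP; exact: measurable_funM.
by apply: filterS gp => x /= gx _; rewrite -[X in (_ * X)%E]/(g x) (gx I).
Qed.

Lemma density_integrable (f : R -> R) : measurable_fun [set: R] f ->
  mu.-integrable [set: R] (fun x => (f x * p x)%:E) ->
  P.-integrable [set: T] (fun w => (f (Y w))%:E).
Proof.
move=> mf /integrableP[_ fp]; apply/integrableP; split.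
  by apply/measurable_EFinP; apply: measurableT_comp.
rewrite /=; have := ge0_density_integral (fun x => `|f x|) _ _ => /= ->//; last first.
  exact: measurableT_comp.
apply: le_lt_trans fp; rewrite le_eqVlt; apply/orP; left; apply/eqP.
by apply: eq_integral => x _; rewrite /= normrM (ger0_norm (p0 x)).
Qed.

Lemma density_expectation (f : R -> R) : measurable_fun [set: R] f ->
  mu.-integrable [set: R] (fun x => (f x * p x)%:E) ->
  (\int[P]_w (f (Y w))%:E = \int[mu]_x (f x * p x)%:E)%E.
Proof.
move=> mf ifp; have iP := density_integrable _ mf ifp.
have mn : measurable_fun [set: R] (fun x => `|f x|) by exact: measurableT_comp.
have ifn : mu.-integrable [set: R] (fun x => (`|f x| * p x)%:E).
  apply: (le_integrable measurableT _ _ ifp); last first.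
    by move=> x _; rewrite /= !normrM normr_id.
  by apply/measurable_EFinP; exact: measurable_funM.
have iPn := density_integrable _ mn ifn.
have ge0 x : 0 <= `|f x| + f x by rewrite -lerBlDr sub0r -normrN ler_norm.
(* The decomposition f = (|f| + f) - |f| reduces the claim to nonnegative functions. *)
have eP : (\int[P]_w (f (Y w))%:E =
    \int[P]_w ((`|f (Y w)| + f (Y w))%:E - (`|f (Y w)|)%:E))%E.
  by apply: eq_integral => w _; rewrite -EFinB addrAC subrr add0r.
have emu : (\int[mu]_x (f x * p x)%:E =
    \int[mu]_x (((`|f x| + f x) * p x)%:E - (`|f x| * p x)%:E))%E.
  by apply: eq_integral => x _; rewrite -EFinB -mulrBl addrAC subrr add0r.
rewrite eP emu !integralB//.
- rewrite (ge0_density_integral (fun x => `|f x| + f x))//; last exact: measurable_funD.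
  by rewrite (ge0_density_integral (fun x => `|f x|)).
- by under eq_fun do rewrite mulrDl EFinD; exact: integrableD.
- by under eq_fun do rewrite EFinD; exact: integrableD.
Qed.

End density.

Section poly_mean.
Context (R : realType) (d : measure_display) (T : measurableType d) (P : probability T R).
Context (Y : T -> R).

Definition poly_mean (q : {poly R}) : R := (\int[P]_w q.[Y w])%R.

Definition all_moments := forall q : {poly R},
  P.-integrable [set: T] (fun w => (q.[Y w])%:E).

Hypothesis mY : all_moments.

Lemma poly_mean_lin a p q : poly_mean (a *: p + q) = a * poly_mean p + poly_mean q.
Proof.
have ia := integrableZl measurableT a (mY p).
have iq := mY q.
rewrite /poly_mean -RintegralZl//; last exact: mY.
rewrite -RintegralD//; apply: eq_Rintegral => x _.
by rewrite hornerD hornerZ.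
Qed.

Lemma poly_mean1 : poly_mean 1 = 1.
Proof.
rewrite /poly_mean /Rintegral; under eq_integral do rewrite -polyC1 hornerC.
by rewrite integral_cst//= probability_setT mule1.
Qed.

Lemma poly_mean0 : poly_mean 0 = 0.
Proof. by have := poly_mean_lin (-1) 0 0; rewrite scaler0 addr0 mulN1r addNr. Qed.

Lemma poly_mean_sum (c : nat -> R) (h : nat -> {poly R}) m n :
  poly_mean (\sum_(m <= k < n) c k *: h k) = \sum_(m <= k < n) c k * poly_mean (h k).
Proof.
elim/big_rec2 : _ => [|k x p _ IH]; first exact: poly_mean0.
by rewrite poly_mean_lin IH.
Qed.

End poly_mean.

Section gauss_mean_sums.
Context (R : realType).

Lemma gauss_mean0 : gauss_mean R 0 = 0.
Proof. by have := gauss_mean_lin R (-1) 0 0; rewrite scaler0 addr0 mulN1r addNr. Qed.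

Lemma gauss_mean_sum (c : nat -> R) (h : nat -> {poly R}) m n :
  gauss_mean R (\sum_(m <= k < n) c k *: h k) = \sum_(m <= k < n) c k * gauss_mean R (h k).
Proof.
elim/big_rec2 : _ => [|k x p _ IH]; first exact: gauss_mean0.
by rewrite gauss_mean_lin IH.
Qed.

Lemma gauss_mean_hermite k l :
  gauss_mean R (hermite R 1 k * hermite R 1 l) = (k == l)%:R / k`!%:R.
Proof.
exact: (L_hermite_orth R _ (gauss_mean_lin R) (gauss_mean1 R) (gauss_meanX R)).
Qed.

Lemma gauss_mean_hermite1 k : (0 < k)%N -> gauss_mean R (hermite R 1 k) = 0.
Proof.
move=> k0; have := gauss_mean_hermite k 0; rewrite -[hermite R 1 0]/1 mulr1 => ->.
by rewrite gtn_eqF// mul0r.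
Qed.

Lemma gauss_mean_hermite_sqr (c : nat -> R) m n :
  gauss_mean R ((\sum_(m <= k < n) c k *: hermite R 1 k) ^+ 2) =
  \sum_(m <= k < n) c k ^+ 2 / k`!%:R.
Proof.
set q := \sum_(m <= k < n) c k *: hermite R 1 k.
have -> : q ^+ 2 = \sum_(m <= k < n) c k *: (hermite R 1 k * q).
  by rewrite expr2 {1}/q mulr_suml; apply: eq_bigr => k _; rewrite scalerAl.
rewrite (gauss_mean_sum c (fun k => hermite R 1 k * q)) !big_nat.
apply: eq_bigr => k kmn.
have -> : hermite R 1 k * q = \sum_(m <= l < n) c l *: (hermite R 1 k * hermite R 1 l).
  by rewrite /q mulr_sumr; apply: eq_bigr => l _; rewrite scalerAr.
rewrite (gauss_mean_sum c (fun l => hermite R 1 k * hermite R 1 l)).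
rewrite (bigD1_seq k) ?mem_index_iota ?iota_uniq//=.
rewrite gauss_mean_hermite eqxx big1 ?addr0; first by rewrite mul1r expr2 mulrA.
by move=> l lk; rewrite gauss_mean_hermite eq_sym (negbTE lk) mul0r mulr0.
Qed.

End gauss_mean_sums.

Section bessel.
Context (R : realType) (d : measure_display) (T : measurableType d) (P : probability T R).
Local Notation mu := (@lebesgue_measure R).
Context (Y : {RV P >-> R}) (p : R -> R).
Hypothesis pY : is_density_of P Y p.

Let G x := (p x / gauss x - 1) ^+ 2 * gauss x.
Hypothesis Glty : (\int[mu]_x (G x)%:E < +oo)%E.

Let mp : measurable_fun [set: R] p. Proof. by case: pY. Qed.
Let p0 x : 0 <= p x. Proof. by case: pY. Qed.

Let G0 x : 0 <= G x. Proof. by rewrite mulr_ge0 ?sqr_ge0// gauss_ge0. Qed.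

Let mG : measurable_fun [set: R] G.
Proof.
apply: measurable_funM; last exact: measurable_gauss.
apply: measurable_funX; apply: measurable_funB => //; apply: measurable_funM => //.
apply: continuous_measurable_fun => x.
by apply: cvgV; [rewrite gt_eqF// gauss_gt0|exact: continuous_gauss].
Qed.

Let iG : mu.-integrable [set: R] (fun x => (G x)%:E).
Proof.
apply/integrableP; split; first exact/measurable_EFinP.
by under eq_integral do rewrite /= ger0_norm//.
Qed.

(** Writing p = (c + 1) phi, the pointwise bound |h| (c + 1) <= h^2 + c^2 + 1 has three integrable
    terms after multiplication by phi. *)
Lemma chi2_integrable (h : R -> R) : measurable_fun [set: R] h ->
  mu.-integrable [set: R] (fun x => (h x ^+ 2 * gauss x)%:E) ->
  mu.-integrable [set: R] (fun x => (h x * p x)%:E).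
Proof.
move=> mh ih.
have ig : mu.-integrable [set: R] (fun x => (gauss x)%:E).
  by rewrite gaussE; exact: integrable_normal_pdf.
have i2 := integrableD measurableT (integrableD measurableT ih iG) ig.
apply: (le_integrable measurableT _ _ i2).
  by apply/measurable_EFinP; exact: measurable_funM.
move=> x _; rewrite -!EFinD !abse_EFin lee_fin normrM (ger0_norm (p0 x)).
apply: le_trans (ler_norm _); rewrite /G.
have g0 := gauss_gt0 R x; set y := gauss x in g0 *.
rewrite -[h x ^+ 2]real_normK ?num_real//; move: (`|h x|) (p x) => a b.
have -> : b = (b / y - 1 + 1) * y by rewrite subrK divfK// gt_eqF.
rewrite mulfK ?gt_eqF// addrK; move: (b / y - 1) => c.
have : 0 <= (a - (c + 1)) ^+ 2 * y by rewrite mulr_ge0 ?sqr_ge0// ltW.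
have : 0 <= (c - 1) ^+ 2 * y by rewrite mulr_ge0 ?sqr_ge0// ltW.
have : 0 <= a ^+ 2 * y by rewrite mulr_ge0 ?sqr_ge0// ltW.
lra.
Qed.

Lemma density_poly_integrable (q : {poly R}) :
  mu.-integrable [set: R] (fun x => (q.[x] * p x)%:E).
Proof.
apply: chi2_integrable; first exact: measurable_poly.
by have := integrable_horner_gauss R (q ^+ 2); under eq_fun do rewrite horner_exp.
Qed.

Lemma density_all_moments : all_moments _ _ _ P Y.
Proof.
move=> q; apply: (density_integrable _ _ _ _ _ _ pY (horner q)); first exact: measurable_poly.
exact: density_poly_integrable.
Qed.

(** The exponent 1/8 is chosen so that the square of e^(x^2/8) is e^(x^2/4), which is integrable
    against the Gaussian. *)
Lemma density_exp_moment :
  (\int[P]_w (expR (Y w ^+ 2 / 8%:R))%:E < +oo)%E.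
Proof.
have mh : measurable_fun [set: R] (fun x : R => expR (x ^+ 2 / 8%:R)).
  by apply: measurableT_comp => //; apply: measurable_funM => //; exact: measurable_funX.
have /integrableP[] : P.-integrable [set: T] (fun w => (expR (Y w ^+ 2 / 8%:R))%:E).
  apply: (density_integrable _ _ _ _ _ _ pY (fun x => expR (x ^+ 2 / 8%:R)) mh).
  apply: chi2_integrable => //.
  have := integrable_expR_gauss R; congr (_.-integrable _ _); apply/funext => x.
  by congr (EFin (_ * _)); rewrite (expr2 (expR _)) -expRD; congr expR; field.
move=> _; apply: le_lt_trans; rewrite le_eqVlt; apply/orP; left; apply/eqP.
by apply: eq_integral => x _; rewrite /= ger0_norm// expR_ge0.
Qed.

(** [q] is the projection of p/phi - 1 on degrees 1 to [M]. Pointwise 2 q p - (2 q + q^2) phi <=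
    (p/phi - 1)^2 phi, and the left side integrates to 2 A - A. *)
Lemma bessel_inequality M :
  ((\sum_(1 <= k < M.+1) k`!%:R * poly_mean _ _ _ P Y (hermite R 1 k) ^+ 2)%:E <=
  \int[mu]_x (G x)%:E)%E.
Proof.
pose a k := poly_mean _ _ _ P Y (hermite R 1 k).
pose q := \sum_(1 <= k < M.+1) (k`!%:R * a k) *: hermite R 1 k.
pose A := \sum_(1 <= k < M.+1) k`!%:R * a k ^+ 2.
have qY : poly_mean _ _ _ P Y q = A.
  rewrite (poly_mean_sum _ _ _ _ _ density_all_moments); apply: eq_bigr => k _.
  by rewrite -/(a k); ring.
have q1 : gauss_mean R q = 0.
  rewrite gauss_mean_sum big_nat big1// => k /andP[k1 _].
  by rewrite gauss_mean_hermite1// mulr0.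
have q2 : gauss_mean R (q ^+ 2) = A.
  rewrite gauss_mean_hermite_sqr; apply: eq_bigr => k _.
  by field; rewrite pnatr_eq0 -lt0n fact_gt0.
have iq := density_poly_integrable (2 *: q).
have ig := integrable_horner_gauss R (2 *: q + q ^+ 2).
have E : (\int[mu]_x (((2 *: q).[x] * p x)%:E - ((2 *: q + q ^+ 2).[x] * gauss x)%:E) = A%:E)%E.
  have qE : (\int[mu]_x ((2 *: q).[x] * p x)%:E = (2 * A)%:E)%E.
    rewrite -(density_expectation _ _ _ _ _ _ pY (horner (2 *: q)))//; last exact: measurable_poly.
    rewrite -[LHS]fineK; last exact: integrable_fin_num (density_all_moments (2 *: q)).
    congr EFin; rewrite -[LHS]/(poly_mean _ _ _ P Y (2 *: q)) -[2 *: q]addr0.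
    by rewrite poly_mean_lin ?qY ?poly_mean0 ?addr0//; exact: density_all_moments.
  have gE : (\int[mu]_x ((2 *: q + q ^+ 2).[x] * gauss x)%:E = A%:E)%E.
    rewrite -[LHS]fineK; last exact: integrable_fin_num ig.
    congr EFin; rewrite -[LHS]/(gauss_mean R (2 *: q + q ^+ 2)).
    by rewrite gauss_mean_lin q1 q2 mulr0 add0r.
  by rewrite integralB// qE gE -EFinB; congr EFin; ring.
rewrite -/A -E; apply: le_integral => //; first exact: integrableB.
move=> x _; rewrite -EFinB lee_fin /G.
have g0 := gauss_gt0 R x; set y := gauss x in g0 *.
rewrite hornerD hornerZ horner_exp; move: (q.[x]) (p x) => u b.
have -> : b = (b / y - 1 + 1) * y by rewrite subrK divfK// gt_eqF.
rewrite mulfK ?gt_eqF// addrK; move: (b / y - 1) => c.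
have : 0 <= (c - u) ^+ 2 * y by rewrite mulr_ge0 ?sqr_ge0// ltW.
lra.
Qed.
End bessel.

Section chi2.
Context (R : realType) (d : measure_display) (T : measurableType d) (P : probability T R).
Context (Y : {RV P >-> R}).

Lemma chi2_ge0 : (0 <= chi2 P Y)%E.
Proof.
apply: le_ereal_inf_tmp => _ [p _ <-]; apply: integral_ge0 => x _.
by rewrite lee_fin mulr_ge0 ?sqr_ge0// gauss_ge0.
Qed.

Lemma chi2_bessel M :
  ((\sum_(1 <= k < M.+1) k`!%:R * poly_mean _ _ _ P Y (hermite R 1 k) ^+ 2)%:E <=
  chi2 P Y)%E.
Proof.
apply: le_ereal_inf_tmp => _ [p pY <-].
have [Glty|] := ltP (\int[lebesgue_measure]_x
    (((p x / gauss x - 1) ^+ 2 * gauss x)%:E))%E +oo%E.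
  exact: (bessel_inequality _ _ _ _ _ p).
by rewrite leye_eq => /eqP ->; rewrite leey.
Qed.

Lemma chi2_lty_density : (chi2 P Y < +oo)%E ->
  exists2 p : R -> R, is_density_of P Y p &
    (\int[lebesgue_measure]_x (((p x / gauss x - 1) ^+ 2 * gauss x)%:E) < +oo)%E.
Proof. by move=> /ereal_inf_lt[_ [p pY <-] lty]; exists p. Qed.

Lemma chi2_all_moments : (chi2 P Y < +oo)%E -> all_moments _ _ _ P Y.
Proof. by move=> /chi2_lty_density[p pY]; exact: density_all_moments. Qed.

Lemma chi2_exp_moment : (chi2 P Y < +oo)%E ->
  (\int[P]_w (expR (Y w ^+ 2 / 8%:R))%:E < +oo)%E.
Proof. by move=> /chi2_lty_density[p pY]; exact: density_exp_moment. Qed.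

End chi2.

(** * Sums of independent variables *)

Section independence.
Context (R : realType) (d : measure_display) (T : measurableType d) (P : probability T R).

(** Both sides are finite measures of C that agree on rectangles, an intersection-stable generator.
    It is applied to preimages of sets under addition. *)
Lemma event_indep_pair (U V : {mfun T >-> R}) (E : set T) : measurable E ->
  (forall A B : set R, measurable A -> measurable B ->
     P (U @^-1` A `&` V @^-1` B `&` E) = (P (U @^-1` A `&` V @^-1` B) * P E)%E) ->
  forall C : set (R * R), measurable C ->
     P ((fun w => (U w, V w)) @^-1` C `&` E) =
     (P ((fun w => (U w, V w)) @^-1` C) * P E)%E.
Proof.
move=> mE UVE C mC.
have mUV : measurable_fun [set: T] (fun w => (U w, V w)).
  by apply: measurable_fun_pair.
pose UV : {mfun T >-> (R * R)%type} := mfun_Sub (mem_set mUV).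
have PE0 : 0 <= fine (P E) by rewrite fine_ge0.
pose m1 : {measure set (R * R) -> \bar R} := pushforward (mrestr P mE) UV.
pose m2 : {measure set (R * R) -> \bar R} := mscale (NngNum PE0) (pushforward P UV).
have : m1 mUV C = m2 mUV C.
  apply: (@measure_unique _ _ _ [set A `*` B | A in measurable & B in measurable]
     (fun=> setT)) => //.
  - exact: measurable_prod_measurableType.
  - move=> _ _ [A mA [B mB <-]] [A' mA' [B' mB' <-]].
    exists (A `&` A'); first exact: measurableI.
    exists (B `&` B'); first exact: measurableI.
    by rewrite setXI.
  - by move=> _; exists setT => //; exists setT => //; rewrite setXTT.
  - by rewrite bigcup_const//; exists 0%N.
  - move=> _ [A mA [B mB <-]].
    rewrite /m1 /m2 /= /mscale /pushforward /mrestr /=.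
    rewrite fineK ?fin_num_measure// muleC -UVE//.
  - move=> _; rewrite /m1 /= /pushforward /mrestr/= ; apply: le_lt_trans (probability_le1 P _) _.
      by rewrite preimage_setT setTI.
    by rewrite ltry.
rewrite /m1 /m2 /= /mscale /pushforward /mrestr /= fineK ?fin_num_measure// => ->.
by rewrite muleC.
Qed.

Definition indep_pair (U V : T -> R) := forall A B : set R,
  measurable A -> measurable B ->
  P (U @^-1` A `&` V @^-1` B) = (P (U @^-1` A) * P (V @^-1` B))%E.

(** The joint law of (U, V) is the product of the laws, as it agrees with it on rectangles; Fubini's
    theorem then separates the two polynomials. *)
Lemma indep_poly_mean (U V : {mfun T >-> R}) (p q : {poly R}) :
  indep_pair U V -> all_moments _ _ _ P U -> all_moments _ _ _ P V ->
  P.-integrable [set: T] (fun w => (p.[U w] * q.[V w])%:E) /\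
  (\int[P]_w (p.[U w] * q.[V w]))%R = poly_mean _ _ _ P U p * poly_mean _ _ _ P V q.
Proof.
move=> UV mU mV.
pose n1 := law _ _ _ P U; pose n2 := law _ _ _ P V.
have mUV : @measurable_fun _ _ T (measurableTypeR R * measurableTypeR R)%type setT
    (fun w => (U w, V w)).
  by apply: measurable_fun_pair; exact: measurable_fun_typeR.
pose W : {mfun T >-> (measurableTypeR R * measurableTypeR R)%type} :=
  @mfun_Sub _ _ T (measurableTypeR R * measurableTypeR R)%type _ (mem_set mUV).
have nE A : measurable A -> (n1 \x n2)%E A = distribution P W A.
  by apply: product_measure_unique => A1 A2 mA1 mA2; rewrite -UV.
pose h (z : measurableTypeR R * measurableTypeR R) := (p.[z.1] * q.[z.2])%:E.
have mh : measurable_fun setT h.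
  have mpoly r : @measurable_fun _ _ (measurableTypeR R) R setT (horner r).
    exact: measurable_poly.
  apply/measurable_EFinP; apply: measurable_funM.
    by apply: (measurableT_comp (mpoly p)).
  by apply: (measurableT_comp (mpoly q)).
have mpolyE (r : {poly R}) :
    @measurable_fun _ _ (measurableTypeR R) (\bar R) setT (fun x => (r.[x])%:E).
  by apply/measurable_EFinP; exact: measurable_poly.
have mpolyA (r : {poly R}) :
    @measurable_fun _ _ (measurableTypeR R) (\bar R) setT (fun x => `|(r.[x])%:E|%E).
  by apply: measurableT_comp => //; exact: mpolyE.
have law_int (X : {mfun T >-> R}) (r : {poly R}) : all_moments _ _ _ P X ->
    (\int[law _ _ _ P X]_x (r.[x])%:E = \int[P]_w (r.[X w])%:E)%E.
  move=> mX; apply: integral_distribution; last exact: mX.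
  by apply/measurable_EFinP; exact: measurable_poly.
have lawn_int (X : {mfun T >-> R}) (r : {poly R}) : all_moments _ _ _ P X ->
    (\int[law _ _ _ P X]_x `|(r.[x])%:E| = \int[P]_w `|(r.[X w])%:E|)%E.
  move=> mX; apply: ge0_integral_law => //.
  by apply: measurableT_comp => //; apply/measurable_EFinP; exact: measurable_poly.
have fin (X : {mfun T >-> R}) (r : {poly R}) : all_moments _ _ _ P X ->
    (\int[P]_w `|(r.[X w])%:E| \is a fin_num)%E.
  move=> mX; rewrite ge0_fin_numE; last exact: integral_ge0.
  by have /integrableP[] := mX r.
have absZ (m : probability (measurableTypeR R) R) (r : {poly R}) (k : \bar R) :
    (0 <= k)%E -> (\int[m]_y (k * `|(r.[y])%:E|) = k * \int[m]_y `|(r.[y])%:E|)%E.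
  by move=> k0; apply: ge0_integralZl => //; exact: mpolyA.
have ih : (n1 \x n2)%E.-integrable setT h.
  apply/integrable12ltyP => //.
  under eq_integral => x _.
    under eq_integral => y _ do rewrite /h /= normrM EFinM -!abse_EFin.
    rewrite absZ// lawn_int// muleC.
    over.
  rewrite /= absZ ?integral_ge0// lawn_int//.
  by rewrite -(fineK (fin U p mU)) -(fineK (fin V q mV)) -EFinM ltry.
have dist_int (f : measurableTypeR R * measurableTypeR R -> \bar R) :
    (\int[distribution P W]_z f z = \int[(n1 \x n2)%E]_z f z)%E.
  by apply: eq_measure_integral => A mA _; apply/esym; exact: nE.
have iP : P.-integrable [set: T] (h \o W).
  apply/integrableP; split; first exact: measurableT_comp.
  rewrite -(@ge0_integral_distribution _ _ _ _ _ _ W (fun z => `|h z|%E))//; last first.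
    exact: measurableT_comp.
  by rewrite dist_int; have /integrableP[] := ih.
split; first exact: iP.
rewrite /Rintegral -[X in fine X]/(\int[P]_w (h \o W) w)%E.
rewrite -integral_distribution// dist_int -integral12_prod_meas1//.
have law_intg (X : {mfun T >-> R}) (r : {poly R}) : all_moments _ _ _ P X ->
    (law _ _ _ P X).-integrable setT (fun x => (r.[x])%:E).
  move=> mX; apply/integrableP; split; first by apply/measurable_EFinP; exact: measurable_poly.
  by rewrite lawn_int//; have /integrableP[] := mX r.
have Efin (X : {mfun T >-> R}) (r : {poly R}) : all_moments _ _ _ P X ->
    (\int[law _ _ _ P X]_x (r.[x])%:E = (poly_mean _ _ _ P X r)%:E)%E.
  move=> mX; rewrite law_int// -[LHS]fineK//; exact: integrable_fin_num (mX r).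
rewrite /fubini_F; under eq_integral => x _.
  under eq_integral => y _ do rewrite /h /= EFinM.
  rewrite integralZl//; last exact: law_intg.
  rewrite Efin// muleC.
  over.
by rewrite /= integralZl ?Efin//= 1?mulrC//; exact: law_intg.
Qed.
End independence.

Section prefix_sums.
Context (R : realType) (d : measure_display) (T : measurableType d) (P : probability T R).
Context (n : nat) (X : 'I_n -> {RV P >-> R}).
Hypothesis indX : mutually_independent P (fun j => (X j : T -> R)).

Definition prefix_sum (k : nat) (w : T) : R := \sum_(i < n | (i < k)%N) X i w.

Lemma prefix_sumS (j : 'I_n) w : prefix_sum j.+1 w = prefix_sum j w + X j w.
Proof.
rewrite /prefix_sum (bigD1 j)//= addrC; congr (_ + _); apply: eq_bigl => i.
by rewrite ltnS ltn_neqAle andbC.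
Qed.

Lemma prefix_sum0 w : prefix_sum 0 w = 0.
Proof. by rewrite /prefix_sum big1. Qed.

Lemma prefix_sum_all w : prefix_sum n w = \sum_(i < n) X i w.
Proof. by apply: eq_bigl => i; rewrite ltn_ord. Qed.

Lemma measurable_prefix_sum k : measurable_fun [set: T] (prefix_sum k).
Proof.
have -> : prefix_sum k = \sum_(i < n | (i < k)%N) (X i : T -> R).
  by apply/funext => w; rewrite fct_sumE.
elim/big_ind : _ => [|f g mf mg|i _]; last exact: measurable_funPT.
  exact: measurable_cst.
exact: measurable_funD.
Qed.

Let S k : {mfun T >-> R} := mfun_Sub (mem_set (measurable_prefix_sum k)).

(** Induction on k. Events of index below k are the whole space, so X_k may join the prefix: the
    pair (S_k, X_k) is independent of the remaining events, hence so is S_k + X_k. *)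
Lemma prefix_sum_indep k (B : set R) (A : 'I_n -> set R) :
  (k <= n)%N -> measurable B -> (forall i, measurable (A i)) ->
  (forall i : 'I_n, (i < k)%N -> A i = setT) ->
  P (prefix_sum k @^-1` B `&` \bigcap_(i in [set: 'I_n]) (X i @^-1` A i)) =
  (P (prefix_sum k @^-1` B) * \prod_(i < n) P (X i @^-1` A i))%E.
Proof.
elim: k B A => [|k IH] B A kn mB mA AT.
  rewrite -(indX A mA); have [B0|B0] := pselect (B 0).
    have -> : prefix_sum 0 @^-1` B = setT.
      by apply/seteqP; split => // w _; rewrite /preimage /= prefix_sum0.
    by rewrite setTI probability_setT mul1e.
  have -> : prefix_sum 0 @^-1` B = set0.
    by apply/seteqP; split => // w; rewrite /preimage /= prefix_sum0.
  by rewrite set0I measure0 mul0e.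
pose j : 'I_n := Ordinal kn.
pose E := \bigcap_(i in [set: 'I_n]) (X i @^-1` A i).
have mE : measurable E.
  by apply: fin_bigcap_measurable => // i _; exact: measurable_funPTI.
(* Coordinate j carries the whole space in [A], so an arbitrary event can be inserted there. *)
pose A' (B' : set R) i := if i == j then B' else A i.
have mA' B' : measurable B' -> forall i, measurable (A' B' i).
  by move=> mB' i; rewrite /A'; case: ifP.
have A'T B' (i : 'I_n) : (i < k)%N -> A' B' i = setT.
  move=> ik; rewrite /A'; case: eqP => [ij|_]; last by rewrite AT// ltnW.
  by move: ik; rewrite ij /= ltnn.
have Aj : A j = setT by apply: AT => /=.
have EA' B' : \bigcap_(i in [set: 'I_n]) (X i @^-1` A' B' i) = X j @^-1` B' `&` E.
  apply/seteqP; split=> w.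
    move=> H; split; first by have := H j I; rewrite /A' eqxx.
    move=> i _; have := H i I; rewrite /A'; case: eqP => // ij _.
    by rewrite ij Aj.
  move=> [HB HE] i _; rewrite /A'; case: eqP => [->//|_]; exact: HE.
have pA' B' : measurable B' -> (\prod_(i < n) P (X i @^-1` A' B' i) =
    P (X j @^-1` B') * \prod_(i < n) P (X i @^-1` A i))%E.
  move=> mB'; rewrite (bigD1 j)//= [in RHS](bigD1 j)//= {1}/A' eqxx; congr (_ * _)%E.
  rewrite Aj preimage_setT probability_setT mul1e.
  by apply: eq_bigr => i ij; rewrite /A' (negbTE ij).
have PE : P E = (\prod_(i < n) P (X i @^-1` A i))%E by exact: indX.
have pair B1 B2 : measurable B1 -> measurable B2 ->
    P (S k @^-1` B1 `&` X j @^-1` B2 `&` E) =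
    (P (S k @^-1` B1) * (P (X j @^-1` B2) * P E))%E.
  move=> mB1 mB2; rewrite -setIA -EA' PE -pA'//.
  by apply: IH; [exact: ltnW|exact: mB1|exact: mA'|exact: A'T].
have pair2 B1 B2 : measurable B1 -> measurable B2 ->
    P (S k @^-1` B1 `&` X j @^-1` B2) = (P (S k @^-1` B1) * P (X j @^-1` B2))%E.
  move=> mB1 mB2; pose A2 (i : 'I_n) := if i == j then B2 else setT.
  have mA2 i : measurable (A2 i) by rewrite /A2; case: ifP.
  have A2T (i : 'I_n) : (i < k)%N -> A2 i = setT.
    by move=> ik; rewrite /A2; case: eqP => // ij; move: ik; rewrite ij /= ltnn.
  have := IH B1 A2 (ltnW kn) mB1 mA2 A2T.
  rewrite (bigD1 j)//= {2}/A2 eqxx big1 ?mule1; last first.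
    by move=> i ij; rewrite /A2 (negbTE ij) preimage_setT probability_setT.
  move=> <-; congr (P (_ `&` _)); apply/seteqP; split=> w.
    by move=> Bw i _; rewrite /A2; case: eqP => [->|].
  by move=> /(_ j I); rewrite /A2 eqxx.
have sE (C : set R) : prefix_sum k.+1 @^-1` C =
   (fun w => (S k w, X j w)) @^-1` ((fun z : R * R => z.1 + z.2) @^-1` C).
  by apply/seteqP; split => w; rewrite /preimage /= -(prefix_sumS j).
rewrite sE -PE; apply: event_indep_pair => //.
  by move=> B1 B2 mB1 mB2; rewrite pair// pair2// muleA.
have mD : measurable_fun [set: (R * R)%type] (fun z => z.1 + z.2 : R).
  by apply: measurable_funD; [exact: measurable_fst|exact: measurable_snd].
by rewrite -[X in measurable X]setTI; exact: mD.
Qed.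

Lemma prefix_sum_indep_pair (j : 'I_n) : indep_pair _ _ _ P (prefix_sum j) (X j).
Proof.
move=> B1 B2 mB1 mB2; pose A2 (i : 'I_n) := if i == j then B2 else setT.
have mA2 i : measurable (A2 i) by rewrite /A2; case: ifP.
have A2T (i : 'I_n) : (i < j)%N -> A2 i = setT.
  by move=> ik; rewrite /A2; case: eqP => // ij; move: ik; rewrite ij ltnn.
have := prefix_sum_indep j B1 A2 (ltnW (ltn_ord j)) mB1 mA2 A2T.
rewrite (bigD1 j)//= {2}/A2 eqxx big1 ?mule1; last first.
  by move=> i ij; rewrite /A2 (negbTE ij) preimage_setT probability_setT.
move=> <-; congr (P (_ `&` _)); apply/seteqP; split=> w.
  by move=> Bw i _; rewrite /A2; case: eqP => [->|].
by move=> /(_ j I); rewrite /A2 eqxx.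
Qed.

End prefix_sums.

Section moments_of_sums.
Context (R : realType) (d : measure_display) (T : measurableType d) (P : probability T R).

Lemma Rintegral_sum_nat (f : nat -> T -> R) m n :
  (forall i, P.-integrable [set: T] (fun w => (f i w)%:E)) ->
  P.-integrable [set: T] (fun w => (\sum_(m <= i < n) f i w)%:E) /\
  (\int[P]_w \sum_(m <= i < n) f i w)%R = \sum_(m <= i < n) (\int[P]_w f i w)%R.
Proof.
move=> fi; elim: (index_iota m n) => [|i s [IHi IHe]].
  under eq_fun do rewrite big_nil.
  rewrite big_nil; split; first exact: integrable0.
  under eq_Rintegral do rewrite big_nil.
  by rewrite /Rintegral integral0.
under eq_fun do rewrite big_cons EFinD.
rewrite big_cons.
split; first exact: integrableD.
under eq_Rintegral do rewrite big_cons.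
by rewrite -IHe RintegralD//; exact: fi.
Qed.

Lemma indep_sum_hermite (U V : {mfun T >-> R}) (v u : R) m :
  indep_pair _ _ _ P U V -> all_moments _ _ _ P U -> all_moments _ _ _ P V ->
  P.-integrable [set: T] (fun w => ((hermite R (v + u) m).[U w + V w])%:E) /\
  poly_mean _ _ _ P (fun w => U w + V w) (hermite R (v + u) m) =
  \sum_(0 <= i < m.+1) poly_mean _ _ _ P U (hermite R v i) *
                       poly_mean _ _ _ P V (hermite R u (m - i)).
Proof.
move=> UV mU mV.
have H i := indep_poly_mean _ _ _ _ _ _ (hermite R v i) (hermite R u (m - i)) UV mU mV.
have [I E] := Rintegral_sum_nat _ 0 m.+1 (fun i => (H i).1).
split; first by under eq_fun do rewrite hermite_add.
rewrite /poly_mean; under eq_Rintegral do rewrite hermite_add.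
rewrite E; apply: eq_bigr => i _. exact: (H i).2.
Qed.

(** Expanding [q] in Hermite polynomials makes the addition formula applicable, and it writes each
    of them at U + V as a sum of integrable products. *)
Lemma indep_sum_moments (U V : {mfun T >-> R}) :
  indep_pair _ _ _ P U V -> all_moments _ _ _ P U -> all_moments _ _ _ P V ->
  all_moments _ _ _ P (fun w => U w + V w).
Proof.
move=> UV mU mV q; have [c ->] := hermite_expansion R (1 + 0) q.
have I k := (indep_sum_hermite U V 1 0 k UV mU mV).1.
have Ic k : P.-integrable [set: T]
    (fun w => (c k * (hermite R (1 + 0) k).[U w + V w])%:E).
  by under eq_fun do rewrite EFinM; exact: integrableZl.
have [] := Rintegral_sum_nat _ 0 (size q) Ic.
by under [X in _ -> _ -> _.-integrable _ X]eq_fun do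
  (rewrite horner_sum; under eq_bigr do rewrite hornerZ).
Qed.

Context (n : nat) (X : 'I_n -> {RV P >-> R}) (M : nat).
Hypothesis indX : mutually_independent P (fun j => (X j : T -> R)).
Hypothesis mX : forall j, all_moments _ _ _ P (X j).

Let hpoly (j : 'I_n) := \poly_(m < M.+1) poly_mean _ _ _ P (X j) (hermite R 1 m).

(** The variance of the Hermite family grows with the number of summands. Coefficients of degree at
    most [M] in a product depend only on those of the factors, so the truncation in [hpoly] changes
    nothing. *)
Lemma prefix_sum_moments k : (k <= n)%N ->
  all_moments _ _ _ P (prefix_sum _ _ _ _ _ X k) /\
  forall m, (m <= M)%N ->
    poly_mean _ _ _ P (prefix_sum _ _ _ _ _ X k) (hermite R k%:R m) =
    (\prod_(j < n | (j < k)%N) hpoly j)`_m.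
Proof.
elim: k => [|k IH] kn.
  have -> : prefix_sum _ _ _ _ _ X 0 = cst 0.
    by apply/funext => w; rewrite prefix_sum0.
  split.
    by move=> q; exact: (finite_measure_integrable_cst P q.[0]).
  move=> m _; rewrite big1// coefC /poly_mean /Rintegral.
  rewrite (integral_cst P measurableT (EFin (hermite R 0 m).[0])).
  rewrite [X in (_ * X)%E](@probability_setT _ _ _ P) mule1 /=.
  (* Scaling by c = 0 evaluates the family of variance 0 at the point 0: it gives 0^m. *)
  rewrite -[X in _.[X]](mul0r 0) (hermite_scale R 1) ?expr0n ?mul0r//.
  by case: m => [|m]; rewrite ?horner_hermite0 ?mulr1 ?mul0r.
have [IHm IHe] := IH (ltnW kn); pose j := Ordinal kn.
pose U : {mfun T >-> R} := mfun_Sub (mem_set (measurable_prefix_sum _ _ _ _ _ X k)).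
have UV : indep_pair _ _ _ P U (X j) by exact: (prefix_sum_indep_pair _ _ _ _ _ _ indX j).
have -> : prefix_sum _ _ _ _ _ X k.+1 = (fun w => U w + X j w).
  by apply/funext => w; rewrite -(prefix_sumS _ _ _ _ _ X j).
split; first exact: indep_sum_moments.
move=> m mM; rewrite -natr1 (indep_sum_hermite U (X j) k%:R 1 m UV IHm (mX j)).2.
rewrite (bigD1 j) /=; last exact: ltnSn.
rewrite (eq_bigl (fun i : 'I_n => (i < k)%N)); last first.
  by move=> i; rewrite ltnS (ltn_neqAle i k) andbC.
rewrite mulrC coefM big_mkord; apply: eq_bigr => i _.
rewrite -IHe; last by rewrite (leq_trans _ mM)// -ltnS.
by rewrite coef_poly ltnS (leq_trans (leq_subr _ _) mM).
Qed.

End moments_of_sums.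

(** * Density of polynomials *)

Section polynomial_density.
Context (R : realType) (m : {measure set (measurableTypeR R) -> \bar R}) (c0 : R).
Local Notation U := (measurableTypeR R).
Hypothesis c00 : 0 < c0.
Hypothesis expm : (\int[m]_(x in [set: U]) (expR (c0 * x ^+ 2))%:E < +oo)%E.

(** Closure of the polynomials in L^2(m), for functions rather than for classes of functions. *)
Definition l2_poly_closure (f : U -> R) := measurable_fun [set: U] f /\
  forall e : R, 0 < e -> exists q : {poly R},
    (\int[m]_(x in [set: U]) ((f x - q.[x]) ^+ 2)%:E <= e%:E)%E.

Let mhorner (q : {poly R}) : measurable_fun [set: U] (horner q).
Proof. exact: measurable_poly. Qed.

Lemma l2_triangle (f g h : U -> R) (a b : R) :
  measurable_fun [set: U] f -> measurable_fun [set: U] g -> measurable_fun [set: U] h ->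
  (\int[m]_(x in [set: U]) ((f x - g x) ^+ 2)%:E <= a%:E)%E ->
  (\int[m]_(x in [set: U]) ((g x - h x) ^+ 2)%:E <= b%:E)%E ->
  (\int[m]_(x in [set: U]) ((f x - h x) ^+ 2)%:E <= (2 * a + 2 * b)%:E)%E.
Proof.
move=> mf mg mh fg gh.
have mB (u v : U -> R) : measurable_fun [set: U] u -> measurable_fun [set: U] v ->
    measurable_fun [set: U] (fun x => ((u x - v x) ^+ 2)%:E).
  by move=> mu mv; apply/measurable_EFinP; apply: measurable_funX; exact: measurable_funB.
apply: (@le_trans _ _ (\int[m]_(x in [set: U])
   (2%:E * ((f x - g x) ^+ 2)%:E + 2%:E * ((g x - h x) ^+ 2)%:E))%E).
  apply: ge0_le_integral => //.
  - by move=> x _; rewrite lee_fin sqr_ge0.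
  - exact: mB.
  - by apply: emeasurable_funD; apply: measurable_funeM; exact: mB.
  - move=> x _; rewrite -!EFinM -EFinD lee_fin.
    have := sqr_ge0 ((f x - g x) - (g x - h x)); lra.
rewrite ge0_integralD//; first last.
- by apply: measurable_funeM; exact: mB.
- by move=> x _; rewrite -EFinM lee_fin mulr_ge0// sqr_ge0.
- by apply: measurable_funeM; exact: mB.
- by move=> x _; rewrite -EFinM lee_fin mulr_ge0// sqr_ge0.
rewrite !ge0_integralZl//; first last.
- by move=> x _; rewrite lee_fin sqr_ge0.
- exact: mB.
- by move=> x _; rewrite lee_fin sqr_ge0.
- exact: mB.
by rewrite [leRHS]EFinD !EFinM leeD// lee_pmul2l.
Qed.

Lemma l2_poly_closure_poly q : l2_poly_closure (horner q).
Proof.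
split=> // e e0; exists q; under eq_integral do rewrite subrr expr0n.
by rewrite integral0 lee_fin ltW.
Qed.

Lemma l2_poly_closure_approx (f : U -> R) : measurable_fun [set: U] f ->
  (forall e : R, 0 < e -> exists2 g, l2_poly_closure g &
    (\int[m]_(x in [set: U]) ((f x - g x) ^+ 2)%:E <= e%:E)%E) -> l2_poly_closure f.
Proof.
move=> mf H; split=> // e e0; have e4 : 0 < e / 4 by rewrite divr_gt0.
have [g [mg Hg] fg] := H _ e4; have [q gq] := Hg _ e4.
exists q; apply: le_trans (l2_triangle f g (horner q) (e / 4) (e / 4) mf mg _ fg gq) _ => //.
by rewrite lee_fin; lra.
Qed.

Lemma l2_poly_closure_lin a (f g : U -> R) :
  l2_poly_closure f -> l2_poly_closure g -> l2_poly_closure (fun x => a * f x + g x).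
Proof.
move=> [mf Hf] [mg Hg].
have mag : measurable_fun [set: U] (fun x => a * f x + g x).
  by apply: measurable_funD => //; exact: measurable_funM.
split=> // e e0; pose b := a ^+ 2 + 1.
have b0 : 0 < b by rewrite ltr_wpDl// sqr_ge0.
have e1 : 0 < e / (4 * b) by rewrite divr_gt0// mulr_gt0.
have e2 : 0 < e / 4 by rewrite divr_gt0.
have [p fp] := Hf _ e1; have [q gq] := Hg _ e2; exists (a *: p + q).
have mp : measurable_fun [set: U] (fun x => a * p.[x] + g x).
  by apply: measurable_funD => //; apply: measurable_funM => //; exact: mhorner.
apply: le_trans (l2_triangle _ (fun x => a * p.[x] + g x) _ (e / 4) (e / 4) mag mp _ _ _) _.
- exact: mhorner.
- under eq_integral => x _.
    have -> : (a * f x + g x - (a * p.[x] + g x)) ^+ 2 = a ^+ 2 * (f x - p.[x]) ^+ 2 by ring.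
    rewrite EFinM; over.
  rewrite ge0_integralZl//; first last.
  + by rewrite lee_fin sqr_ge0.
  + by move=> x _; rewrite lee_fin sqr_ge0.
  + apply/measurable_EFinP; apply: measurable_funX; apply: measurable_funB.
      exact: mf.
    exact: mhorner.
  apply: (@le_trans _ _ ((a ^+ 2)%:E * (e / (4 * b))%:E)%E).
    by apply: lee_wpmul2l => //; rewrite lee_fin sqr_ge0.
  rewrite -EFinM lee_fin.
  have -> : a ^+ 2 * (e / (4 * b)) = (e / 4) * (a ^+ 2 / b) by field; rewrite gt_eqF.
  by rewrite ler_piMr ?(ltW e2)// ler_pdivrMr// mul1r /b lerDl ler01.
- under eq_integral => x _.
    have -> : (a * p.[x] + g x - (a *: p + q).[x]) ^+ 2 = (g x - q.[x]) ^+ 2.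
      by rewrite hornerD hornerZ; ring.
    over.
  exact: gq.
- by rewrite lee_fin; lra.
Qed.

Lemma l2_poly_closure_lim (f : U -> R) (f_ : nat -> U -> R) (g : U -> R) :
  measurable_fun [set: U] f -> (forall n, l2_poly_closure (f_ n)) ->
  (forall x, f_ n x @[n --> \oo] --> f x) ->
  m.-integrable [set: U] (EFin \o g) ->
  (forall n x, (f_ n x - f x) ^+ 2 <= g x) -> l2_poly_closure f.
Proof.
move=> mf f_V f_f ig f_g; apply: l2_poly_closure_approx => // e e0.
have [||||_ _ c1] := @dominated_convergence _ _ _ m setT measurableT
  (fun n x => ((f x - f_ n x) ^+ 2)%:E) (cst 0%E) (EFin \o g) _ (measurable_cst _).
- move=> n; apply/measurable_EFinP; apply: measurable_funX; apply: measurable_funB => //.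
  exact: (f_V n).1.
- apply: aeW => x _; apply/cvg_EFin; first exact: nearW.
  have c : f x - f_ n x @[n --> \oo] --> 0.
    by rewrite -(subrr (f x)); apply: cvgB; [exact: cvg_cst|exact: f_f].
  by under eq_fun do rewrite expr2; rewrite -(mulr0 0); exact: cvgM.
- exact: ig.
- by apply: aeW => x n _; rewrite abse_EFin lee_fin ger0_norm ?sqr_ge0// -sqrrN opprB.
rewrite integral0 in c1.
have ne : nbhs (0 : \bar R) [set y | (y < e%:E)%E].
  by apply: open_nbhs_nbhs; split; [exact: open_ereal_lt_ereal|rewrite /= lte_fin].
have [n _ Hn] := c1 _ ne; exists (f_ n) => //.
by apply: ltW; exact: (Hn n (leqnn n)).
Qed.

End polynomial_density.

Section multipliers.
Context (R : realType) (m : {measure set (measurableTypeR R) -> \bar R}) (c0 : R).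
Local Notation U := (measurableTypeR R).
Local Notation V := (l2_poly_closure R m).
Hypothesis c00 : 0 < c0.
Hypothesis expm : (\int[m]_(x in [set: U]) (expR (c0 * x ^+ 2))%:E < +oo)%E.

Let mhorner (q : {poly R}) : measurable_fun [set: U] (horner q).
Proof. exact: measurable_poly. Qed.

Let mexp (c : R) : measurable_fun [set: U] (fun x : U => expR (c * x ^+ 2)).
Proof.
by apply: measurableT_comp => //; apply: measurable_funM.
Qed.

(** Half of the exponent [c0] absorbs q^2; the other half dominates the exponential series in
    [l2_multiplier_bump]. *)
Lemma integrable_sqr_poly_exp (q : {poly R}) :
  m.-integrable [set: U] (EFin \o (fun x : U => q.[x] ^+ 2 * expR (c0 / 2 * x ^+ 2))).
Proof.
have [|C C0 qC] := horner_le_expR R q (c0 / 4); first by rewrite divr_gt0.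
apply/integrableP; split.
  apply/measurable_EFinP; apply: measurable_funM => //; apply: measurable_funX.
  exact: mhorner.
apply: (@le_lt_trans _ _ (\int[m]_(x in [set: U])
    ((C ^+ 2)%:E * (expR (c0 * x ^+ 2))%:E))%E).
  apply: ge0_le_integral => //.
  - apply: measurableT_comp => //; apply/measurable_EFinP.
    apply: measurable_funM => //; apply: measurable_funX; exact: mhorner.
  - by apply: measurable_funeM; apply/measurable_EFinP.
  move=> x _; rewrite abse_EFin -EFinM lee_fin ger0_norm; last first.
    by rewrite mulr_ge0 ?sqr_ge0 ?expR_ge0.
  have -> : expR (c0 * x ^+ 2) = expR (c0 / 4 * x ^+ 2) ^+ 2 * expR (c0 / 2 * x ^+ 2).
    by rewrite (expr2 (expR _)) -!expRD; congr expR; field.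
  rewrite [leRHS]mulrA ler_pM2r ?expR_gt0// -[leRHS]exprMn -[leLHS]real_normK ?num_real//.
  by rewrite lerXn2r// ?nnegrE ?mulr_ge0// expR_ge0.
rewrite ge0_integralZl ?lee_fin ?sqr_ge0//; last first.
  by apply/measurable_EFinP.
by rewrite lte_mul_pinfty// lee_fin sqr_ge0.
Qed.

Lemma integrable_sqr_poly (q : {poly R}) :
  m.-integrable [set: U] (EFin \o (fun x : U => q.[x] ^+ 2)).
Proof.
apply: (le_integrable measurableT _ _ (integrable_sqr_poly_exp q)).
  by apply/measurable_EFinP; apply: measurable_funX; exact: mhorner.
move=> x _; have q0 := sqr_ge0 q.[x]; have e0 := expR_ge0 (c0 / 2 * x ^+ 2).
rewrite /= lee_fin ger0_norm// (ger0_norm (mulr_ge0 q0 e0)) ler_peMr// leNgt expR_lt1 -leNgt.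
by apply: mulr_ge0; [rewrite divr_ge0// ltW|rewrite sqr_ge0].
Qed.

(** Asking that h map all polynomials into the closure, rather than that h lie in it, makes these
    functions stable under products. The aim is to reach every bounded measurable function. *)
Definition l2_multiplier (h : U -> R) := [/\ measurable_fun [set: U] h,
  exists K, forall x, `|h x| <= K & forall q : {poly R}, V (fun x => h x * q.[x])].

(** A bound K on h makes multiplication by h continuous in L^2, so the property extends from
    polynomials to their closure. *)
Lemma l2_multiplier_mul h f : l2_multiplier h -> V f -> V (fun x => h x * f x).
Proof.
move=> [mh [K hK] Vh] [mf Hf].
have K0 : 0 <= K by apply: le_trans (hK 0); rewrite normr_ge0.
have mhf : measurable_fun [set: U] (fun x => h x * f x) by exact: measurable_funM.
apply: l2_poly_closure_approx => // e e0.
pose b := K ^+ 2 + 1; have b0 : 0 < b by rewrite ltr_wpDl// sqr_ge0.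
have [q fq] := Hf (e / b) (divr_gt0 e0 b0).
have mfq : measurable_fun [set: U] (fun x => ((f x - q.[x]) ^+ 2)%:E).
  apply/measurable_EFinP; apply: measurable_funX; apply: measurable_funB; first exact: mf.
  exact: mhorner.
exists (fun x => h x * q.[x]) => //.
apply: (@le_trans _ _ (\int[m]_(x in [set: U]) (b%:E * ((f x - q.[x]) ^+ 2)%:E))%E).
  apply: ge0_le_integral => //.
  - by move=> x _; rewrite lee_fin sqr_ge0.
  - apply/measurable_EFinP; apply: measurable_funX; apply: measurable_funB; first exact: mhf.
    by apply: measurable_funM; [exact: mh|exact: mhorner].
  - exact: measurable_funeM.
  move=> x _; rewrite -EFinM lee_fin -mulrBr exprMn ler_wpM2r ?sqr_ge0//.
  by rewrite /b -[leLHS]real_normK ?num_real// ler_wpDr// lerXn2r// nnegrE.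
rewrite ge0_integralZl//.
- apply: (@le_trans _ _ (b%:E * (e / b)%:E)%E).
    by apply: lee_wpmul2l => //; rewrite lee_fin ltW.
  by rewrite -EFinM lee_fin mulrC divfK// gt_eqF.
- by move=> x _; rewrite lee_fin sqr_ge0.
- by rewrite lee_fin ltW.
Qed.

Lemma l2_multiplier_cst k : l2_multiplier (cst k).
Proof.
split; [exact: measurable_cst|by exists `|k| => x|move=> q].
have := l2_poly_closure_poly R m (k *: q); congr V.
by apply/funext => x; rewrite hornerZ.
Qed.

Lemma l2_multiplierM h g : l2_multiplier h -> l2_multiplier g ->
  l2_multiplier (fun x => h x * g x).
Proof.
move=> Hh [mg [L gL] Vg]; have [mh [K hK] Vh] := Hh.
split; first exact: measurable_funM.
  by exists (K * L) => x; rewrite normrM ler_pM.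
move=> q; have := l2_multiplier_mul h _ Hh (Vg q); congr V.
by apply/funext => x; rewrite mulrA.
Qed.

Lemma l2_multiplierD h g : l2_multiplier h -> l2_multiplier g ->
  l2_multiplier (fun x => h x + g x).
Proof.
move=> [mh [K hK] Vh] [mg [L gL] Vg]; split; first exact: measurable_funD.
  by exists (K + L) => x; apply: le_trans (ler_normD _ _) _; exact: lerD.
move=> q; have := l2_poly_closure_lin R m 1 _ _ (Vh q) (Vg q); congr V.
by apply/funext => x; rewrite mul1r mulrDl.
Qed.

Lemma l2_multiplierZ k h : l2_multiplier h -> l2_multiplier (fun x => k * h x).
Proof. by move=> Hh; exact: l2_multiplierM (l2_multiplier_cst k) Hh. Qed.

Lemma l2_multiplier_lim (f_ : nat -> U -> R) (f : U -> R) (K : R) :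
  (forall n, l2_multiplier (f_ n)) -> (forall n x, `|f_ n x| <= K) ->
  (forall x, f_ n x @[n --> \oo] --> f x) -> l2_multiplier f.
Proof.
move=> Hf fK f_f.
have mf : measurable_fun [set: U] f.
  apply: (@measurable_fun_cvg _ U R setT f_) => // n.
  by have [] := Hf n.
have fK' x : `|f x| <= K.
  have c : `|f_ n x| @[n --> \oo] --> `|f x| by apply: cvg_norm; exact: f_f.
  rewrite -(cvg_lim (@Rhausdorff R) c); apply: limr_le; first by apply/cvg_ex; exists `|f x|.
  by apply: nearW => n; exact: fK.
have K0 : 0 <= K := le_trans (normr_ge0 _) (fK' 0).
split=> //; first by exists K.
move=> q; apply: (l2_poly_closure_lim _ _ _ (fun n x => f_ n x * q.[x])
    (fun x => (2 * K) ^+ 2 * q.[x] ^+ 2)).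
- by apply: measurable_funM => //; exact: mhorner.
- by move=> n; have [_ _] := Hf n.
- by move=> x; apply: cvgM; [exact: f_f|exact: cvg_cst].
- have := integrableZl measurableT ((2 * K) ^+ 2) (integrable_sqr_poly q).
  by congr (_.-integrable _ _); apply/funext => x; rewrite /= EFinM.
- move=> n x; rewrite -mulrBl exprMn ler_wpM2r ?sqr_ge0// -[leLHS]real_normK ?num_real//.
  rewrite lerXn2r// ?nnegrE ?mulr_ge0//; apply: le_trans (ler_normB _ _) _.
  by rewrite mulr_natl mulr2n lerD.
Qed.

End multipliers.

Section sign_iteration.
Context (R : realType).

(** The Newton-Schulz iteration for the sign: an odd cubic fixing -1, 0 and 1. Being polynomial, it
    maps multipliers to multipliers, and its iterates converge to the sign on [-1, 1]. *)
Definition sign_step (t : R) : R := t * (3 - t ^+ 2) / 2.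

Lemma sign_stepN t : sign_step (- t) = - sign_step t.
Proof. by rewrite /sign_step; ring. Qed.

Lemma iter_sign_stepN n t : iter n sign_step (- t) = - iter n sign_step t.
Proof. by elim: n => //= n ->; rewrite sign_stepN. Qed.

(** 1 - [sign_step] t = (1 - t)^2 (2 + t)/2, and (1 - t)(2 + t)/2 <= 1 - u/2. The lower bound u
    persists, so the contraction factor is the same at every step. *)
Lemma sign_step_bounds u t : 0 <= u <= 1 -> u <= t <= 1 ->
  u <= sign_step t <= 1 /\ 1 - sign_step t <= (1 - u / 2) * (1 - t).
Proof.
move=> /andP[u0 u1] /andP[ut t1]; have t0 := le_trans u0 ut; rewrite /sign_step.
have h1 : 1 - t * (3 - t ^+ 2) / 2 = (1 - t) ^+ 2 * (2 + t) / 2 by field.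
have h2 : t * (3 - t ^+ 2) / 2 - t = t * (1 - t) * (1 + t) / 2 by field.
have h3 : 0 <= t * (1 - t) * (1 + t) / 2.
  by rewrite divr_ge0// !mulr_ge0// ?subr_ge0// addr_ge0.
have h4 : 0 <= (1 - t) ^+ 2 * (2 + t) / 2.
  by rewrite divr_ge0// mulr_ge0 ?sqr_ge0// addr_ge0.
split; first by apply/andP; split; lra.
rewrite h1; have -> : (1 - t) ^+ 2 * (2 + t) / 2 = ((1 - t) * (2 + t) / 2) * (1 - t) by field.
by rewrite ler_wpM2r ?subr_ge0//; nra.
Qed.

Lemma cvg_iter_sign_step_gt0 t : 0 < t -> t <= 1 ->
  iter n sign_step t @[n --> \oo] --> (1 : R).
Proof.
move=> t0 t1.
have H n : t <= iter n sign_step t <= 1 /\ 1 - iter n sign_step t <= (1 - t / 2) ^+ n.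
  elim: n => [|n [IH1 IH2]]; first by rewrite /= lexx t1 expr0; split=> //; lra.
  have [|h1 h2] := sign_step_bounds t (iter n sign_step t) _ IH1; first by rewrite (ltW t0).
  split=> //; rewrite iterS exprS; apply: le_trans h2 _.
  by rewrite ler_wpM2l//; lra.
have g : (1 - t / 2) ^+ n @[n --> \oo] --> (0 : R).
  by apply: cvg_expr; rewrite ger0_norm; lra.
have c : 1 - iter n sign_step t @[n --> \oo] --> (0 : R).
  apply: (@squeeze_cvgr _ _ _ _ (cst 0) (fun n => (1 - t / 2) ^+ n)) => //.
    by apply: nearW => n; have [/andP[_ h] h'] := H n; rewrite h' andbT subr_ge0.
  exact: cvg_cst.
have -> : (fun n => iter n sign_step t) = (fun n => 1 - (1 - iter n sign_step t)).
  by apply/funext => n; rewrite opprB addrC subrK.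
by rewrite -[X in _ --> X](subr0 1); apply: cvgB => //; exact: cvg_cst.
Qed.

Lemma cvg_iter_sign_step t : `|t| <= 1 -> iter n sign_step t @[n --> \oo] --> Num.sg t.
Proof.
rewrite ler_norml => /andP[tN1 t1]; have [t0|t0|<-] := ltgtP 0 t.
- by rewrite gtr0_sg//; exact: cvg_iter_sign_step_gt0.
- rewrite ltr0_sg// -[t]opprK; under eq_fun do rewrite iter_sign_stepN.
  by apply: cvgN; apply: cvg_iter_sign_step_gt0; [rewrite oppr_gt0|lra].
- rewrite sgr0; have -> : (fun n => iter n sign_step 0) = cst 0; last exact: cvg_cst.
  by apply/funext; elim=> //= n ->; rewrite /sign_step mul0r mul0r.
Qed.

Lemma iter_sign_step_le1 n t : `|t| <= 1 -> `|iter n sign_step t| <= 1.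
Proof.
move=> t1; elim: n => //= n; move: (iter n sign_step t) => u.
wlog u0 : u / 0 <= u.
  move=> H; have [|u0] := leP 0 u; first exact: H.
  by rewrite -normrN => /H; rewrite sign_stepN normrN; apply; rewrite oppr_ge0 ltW.
rewrite (ger0_norm u0) => u1.
have H0 : ((0 : R) <= 0) && ((0 : R) <= 1) by rewrite lexx ler01.
have H1 : 0 <= u <= 1 by rewrite u0.
have [/andP[h1 h2] _] := sign_step_bounds 0 u H0 H1.
by rewrite ger0_norm.
Qed.

End sign_iteration.

Section multiplier_sets.
Import HBNNSimple.
Context (R : realType) (m : {measure set (measurableTypeR R) -> \bar R}) (c0 : R).
Local Notation U := (measurableTypeR R).
Local Notation V := (l2_poly_closure R m).
Local Notation A := (l2_multiplier R m).
Hypothesis c00 : 0 < c0.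
Hypothesis expm : (\int[m]_(x in [set: U]) (expR (c0 * x ^+ 2))%:E < +oo)%E.

Let lim := l2_multiplier_lim R m c0 c00 expm.

(** Damping makes x - a bounded and keeps its sign. The partial sums of the series of e^(-c x^2), c
    = c0/4, are polynomials at distance at most 2 e^(c x^2) from their limit, and the square of this
    is integrable against r^2. *)
Lemma l2_multiplier_bump a :
  A (fun x : U => (x - a) * expR (- (c0 / 4 * x ^+ 2))).
Proof.
pose c := c0 / 4; have c_gt0 : 0 < c by rewrite divr_gt0.
have mf (q : {poly R}) :
    measurable_fun [set: U] (fun x : U => q.[x] * expR (- (c * x ^+ 2))).
  apply: measurable_funM; first exact: measurable_poly.
  by apply: measurableT_comp => //; apply: measurableT_comp => //; apply: measurable_funM.
have pE (q : {poly R}) : (fun x : U => (x - a) * expR (- (c * x ^+ 2)) * q.[x]) =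
    (fun x => (('X - a%:P) * q).[x] * expR (- (c * x ^+ 2))).
  by apply/funext => x; rewrite hornerM hornerXsubC; ring.
split.
- by have := mf ('X - a%:P); under eq_fun do rewrite hornerXsubC.
- have [C C0 HC] := horner_le_expR R ('X - a%:P) c c_gt0; exists C => x.
  have := HC x; rewrite hornerXsubC => h.
  by rewrite normrM (ger0_norm (expR_ge0 _)) expRN ler_pdivrMr ?expR_gt0.
move=> q; rewrite pE; set r := ('X - a%:P) * q.
apply: (l2_poly_closure_lim _ _ _
   (fun n x => r.[x] * series (exp_coeff (- (c * x ^+ 2))) n)
   (fun x => 4 * (r.[x] ^+ 2 * expR (c0 / 2 * x ^+ 2)))).
- exact: mf.
- move=> n; have := l2_poly_closure_poly R m
    (r * \sum_(0 <= k < n) k`!%:R^-1 *: ((- c) *: 'X^2) ^+ k).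
  congr V; apply/funext => x; rewrite hornerM horner_sum; congr (_ * _).
  apply: eq_bigr => k _; rewrite hornerZ horner_exp hornerZ hornerXn /exp_coeff /=.
  by rewrite mulNr mulrC.
- move=> x; apply: cvgM; first exact: cvg_cst.
  exact: is_cvg_series_exp_coeff.
- have := integrableZl measurableT 4 (integrable_sqr_poly_exp R m c0 c00 expm r).
  by congr (_.-integrable _ _); apply/funext => x; rewrite /= EFinM.
- move=> n x; rewrite -mulrBr exprMn [leRHS]mulrCA ler_wpM2l ?sqr_ge0//.
  have -> : 4 * expR (c0 / 2 * x ^+ 2) = (2 * expR (c * x ^+ 2)) ^+ 2.
    rewrite exprMn (expr2 (expR _)) -expRD -natrX; congr (_ * expR _).
    by rewrite /c; field.
  have cx0 : 0 <= c * x ^+ 2 by rewrite mulr_ge0 ?sqr_ge0// ltW.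
  rewrite -[leLHS]real_normK ?num_real// lerXn2r// ?nnegrE ?mulr_ge0 ?expR_ge0//.
  apply: le_trans (ler_normB _ _) _; rewrite mulr_natl mulr2n lerD//.
    apply: (@le_trans _ _ (series (exp_coeff (c * x ^+ 2)) n)).
      apply: le_trans (ler_norm_sum _ _ _) _; apply: ler_sum => k _.
      by rewrite /exp_coeff /= normrM normrX normrN (ger0_norm cx0) ger0_norm// invr_ge0.
    apply: nondecreasing_cvgn_le; last exact: is_cvg_series_exp_coeff.
    apply: nondecreasing_series => k _ _; exact: exp_coeff_ge0.
  by rewrite (ger0_norm (expR_ge0 _)) ler_expR; lra.
Qed.

Lemma l2_multiplier_sign a : A (fun x : U => Num.sg (x - a)).
Proof.
have Ab := l2_multiplier_bump a; have [_ [K hK] _] := Ab.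
pose L := `|K| + 1; have L0 : 0 < L by rewrite ltr_wpDl.
pose u (x : U) := L^-1 * ((x - a) * expR (- (c0 / 4 * x ^+ 2))).
have Au : A u := l2_multiplierZ R m _ _ Ab.
have u1 x : `|u x| <= 1.
  rewrite normrM gtr0_norm ?invr_gt0// ler_pdivrMl// mulr1.
  by apply: le_trans (hK x) _; rewrite (le_trans (ler_norm K))// lerDl.
have uE x : Num.sg (u x) = Num.sg (x - a).
  by rewrite /u !sgrM gtr0_sg ?invr_gt0// mul1r (gtr0_sg (expR_gt0 _)) mulr1.
apply: (lim (fun n x => iter n (sign_step R) (u x)) _ 1).
- elim=> [|n IH]//=.
  have -> : (fun x => sign_step R (iter n (sign_step R) (u x))) =
     (fun x => 2^-1 * (iter n (sign_step R) (u x) * (3 + (-1) * (iter n (sign_step R) (u x) *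
        iter n (sign_step R) (u x))))).
    by apply/funext => x; rewrite /sign_step; field.
  apply: l2_multiplierZ; apply: l2_multiplierM => //; apply: l2_multiplierD.
    exact: l2_multiplier_cst.
  by apply: l2_multiplierZ; apply: l2_multiplierM.
- by move=> n x; exact: iter_sign_step_le1.
- by move=> x; rewrite -uE; exact: cvg_iter_sign_step.
Qed.

Lemma l2_multiplier_ray a : A (\1_`]a, +oo[%classic : U -> R).
Proof.
have Hs := l2_multiplier_sign a.
have -> : (\1_`]a, +oo[%classic : U -> R) =
   (fun x : U => 2^-1 * (Num.sg (x - a) * Num.sg (x - a) + Num.sg (x - a))).
  apply/funext => x; rewrite indicE mem_setE in_itv/= andbT -subr_gt0.
  by case: sgrP => /= _; field.
by apply: l2_multiplierZ; apply: l2_multiplierD => //; apply: l2_multiplierM.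
Qed.

Lemma l2_multiplier_setC (B : set U) : A (\1_B : U -> R) -> A (\1_(~` B) : U -> R).
Proof.
move=> AB; have -> : (\1_(~` B) : U -> R) = (fun x => 1 + (-1) * \1_B x).
  by apply/funext => x; rewrite !indicE in_setC; case: (x \in B); rewrite /=; ring.
by apply: l2_multiplierD; [exact: l2_multiplier_cst|exact: l2_multiplierZ].
Qed.

(** The sets whose indicator is a multiplier form a sigma-algebra: products give finite
    intersections, bounded limits countable ones. Open rays belong to it and generate the Borel
    sets. *)
Lemma l2_multiplier_measurable (B : set U) : measurable B -> A (\1_B : U -> R).
Proof.
have s : sigma_algebra [set: U] [set E : set U | A (\1_E : U -> R)].
  split=> [|E AE|F AF] /=.
  - by rewrite indic0; exact: l2_multiplier_cst.
  - by rewrite setTD; exact: l2_multiplier_setC.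
  - have AF' n : A (\1_(\bigcap_(i < n) ~` F i) : U -> R).
      elim: n => [|n IH].
        by rewrite bigcap_mkord big_ord0 indicT; exact: l2_multiplier_cst.
      have -> : \bigcap_(i < n.+1) ~` F i = (\bigcap_(i < n) ~` F i) `&` ~` F n.
        by rewrite !bigcap_mkord big_ord_recr.
      rewrite indicI.
      by apply: l2_multiplierM => //; exact: l2_multiplier_setC _ (AF n).
    rewrite -[\bigcup_ _ _]setCK setC_bigcup; apply: l2_multiplier_setC.
    apply: (lim (fun n => \1_(\bigcap_(i < n) ~` F i)) _ 1) => //.
      by move=> n x; rewrite indicE; case: (_ \in _); rewrite /= ?normr1 ?normr0.
    move=> x; have [Fx|/existsNP[k Fk]] := pselect (forall i, ~ F i x).
      by apply: cvg_near_cst; apply: nearW => n; rewrite !indicE !mem_set//=; move=> i _; exact: Fx.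
    apply: cvg_near_cst; near=> n; rewrite !indicE !memNset//.
      by move=> /(_ k Logic.I).
    move=> /(_ k) /=; apply: contra_not Fk => H; apply: H.
    by near: n; exact: nbhs_infty_gt.
rewrite RGenOInfty.measurableE => mB.
have sub : @RGenOInfty.G R `<=` [set E : set U | A (\1_E : U -> R)].
  by move=> _ [a ->] /=; exact: l2_multiplier_ray.
exact: (smallest_sub s sub mB).
Unshelve. all: by end_near. Qed.

Lemma l2_multiplier_sum (I : Type) (r : seq I) (F : I -> U -> R) :
  (forall i, A (F i)) -> A (fun x => \sum_(i <- r) F i x).
Proof.
move=> AF; elim: r => [|i r IH].
  by under eq_fun do rewrite big_nil; exact: l2_multiplier_cst.
by under eq_fun do rewrite big_cons; exact: l2_multiplierD.
Qed.

Lemma l2_multiplier_nnsfun (f : {nnsfun U >-> R}) : A (fun x => f x).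
Proof.
have -> : (fun x => f x) = (fun x : U => \sum_(y <- finmap.enum_fset (fset_set (range f))) y * \1_(f @^-1` [set y]) x).
  by apply/funext => x; rewrite [LHS]fimfunE fsbig_finite.
by apply: l2_multiplier_sum => y; apply: l2_multiplierZ; exact: l2_multiplier_measurable.
Qed.

Lemma l2_multiplier_bounded (f : U -> R) (K : R) : measurable_fun [set: U] f ->
  (forall x, `|f x| <= K) -> A f.
Proof.
move=> mf fK; have fK' x := fK x.
(* The shift makes the function nonnegative, hence a limit of bounded simple functions. *)
pose g (x : U) := f x + K.
have g0 x : 0 <= g x by rewrite /g -lerBlDr sub0r; have := fK x; rewrite ler_norml => /andP[].
have mg : measurable_fun [set: U] (EFin \o g).
  by apply/measurable_EFinP; apply: measurable_funD.
pose h := nnsfun_approx measurableT mg.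
have hg x : (EFin \o h^~ x) n @[n --> \oo] --> (g x)%:E.
  by apply: cvg_nnsfun_approx => // y _; rewrite lee_fin.
have hg' x : h n x @[n --> \oo] --> g x by have /fine_cvgP[] := hg x.
have Ag : A g.
  apply: (lim (fun n x => h n x) g (2 * K)) => // [n|n x].
    exact: l2_multiplier_nnsfun.
  rewrite ger0_norm ?fun_ge0//; apply: (@le_trans _ _ (g x)).
    rewrite -lee_fin nnsfun_approxE.
    have gE0 y : setT y -> (0 <= (EFin \o g) y)%E by move=> _; rewrite lee_fin.
    exact: (le_approx n gE0 I).
  rewrite /g; have := fK x; rewrite ler_norml => /andP[_]; lra.
have -> : f = (fun x => g x + (- K)) by apply/funext => x; rewrite /g addrK.
by apply: l2_multiplierD => //; exact: l2_multiplier_cst.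
Qed.

Lemma l2_poly_closure_bounded (f : U -> R) (K : R) : measurable_fun [set: U] f ->
  (forall x, `|f x| <= K) -> V f.
Proof.
move=> mf fK; have [_ _ /(_ 1)] := l2_multiplier_bounded f K mf fK.
by congr V; apply/funext => x; rewrite -polyC1 hornerC mulr1.
Qed.

End multiplier_sets.

(** * The upper bound on chi2 *)

Section standard_gaussian.
Context (R : realType).
Local Notation U := (measurableTypeR R).
Local Notation mu := (@lebesgue_measure R).

Definition gauss_prob : probability U R := normal_prob 0 1.

Lemma measurable_id_typeR : @measurable_fun _ _ U R setT id.
Proof. exact: (@measurable_id _ R setT). Qed.

(** Under the Gaussian law the identity has density phi, so the results on densities apply to
    Gaussian integrals. *)
Definition idRV : {RV gauss_prob >-> R} :=
  @mfun_Sub _ _ U R id (mem_set measurable_id_typeR).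

Lemma gauss_prob_density : is_density_of gauss_prob idRV gauss.
Proof.
split; [exact: measurable_gauss|exact: gauss_ge0|move=> A mA].
by rewrite gaussE.
Qed.

Lemma integrable_gauss_prob (f : R -> R) : measurable_fun [set: R] f ->
  mu.-integrable [set: R] (fun x => (f x * gauss x)%:E) ->
  gauss_prob.-integrable [set: U] (EFin \o f).
Proof. exact: density_integrable gauss_prob_density f. Qed.

Lemma Rintegral_gauss_prob (f : R -> R) : measurable_fun [set: R] f ->
  mu.-integrable [set: R] (fun x => (f x * gauss x)%:E) ->
  (\int[gauss_prob]_x f x)%R = (\int[mu]_x (f x * gauss x))%R.
Proof.
move=> mf If; congr fine.
exact: (density_expectation _ _ _ _ _ _ gauss_prob_density f mf If).
Qed.

End standard_gaussian.

Section bounded_integrals.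
Context (R : realType) (d : measure_display) (T : measurableType d).

Lemma bounded_integrable_prob (mu : probability T R) (f : T -> R) (K : R) :
  measurable_fun [set: T] f -> (forall x, `|f x| <= K) ->
  mu.-integrable [set: T] (EFin \o f).
Proof.
move=> mf fK; apply: (le_integrable measurableT _ _ (finite_measure_integrable_cst mu K measurableT)).
  exact/measurable_EFinP.
by move=> x _; rewrite /= lee_fin (le_trans (fK x))// ler_norm.
Qed.

Lemma Rintegral_lin3 (mu : probability T R) (a b c : R) (f g h : T -> R) :
  mu.-integrable [set: T] (EFin \o f) -> mu.-integrable [set: T] (EFin \o g) ->
  mu.-integrable [set: T] (EFin \o h) ->
  mu.-integrable [set: T] (EFin \o (fun x => a * f x + b * g x + c * h x)) /\
  (\int[mu]_x (a * f x + b * g x + c * h x))%R =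
  a * (\int[mu]_x f x)%R + b * (\int[mu]_x g x)%R + c * (\int[mu]_x h x)%R.
Proof.
move=> jf jg jh.
have jZ k u : mu.-integrable [set: T] (EFin \o u) ->
    mu.-integrable [set: T] (EFin \o (fun x => k * u x)).
  by move=> /(integrableZl measurableT k); congr (_.-integrable _ _); apply/funext => x; rewrite /= EFinM.
have jD u v : mu.-integrable [set: T] (EFin \o u) -> mu.-integrable [set: T] (EFin \o v) ->
    mu.-integrable [set: T] (EFin \o (fun x => u x + v x)).
  by move=> ju /(integrableD measurableT ju); congr (_.-integrable _ _); apply/funext => x; rewrite /= EFinD.
split; first by apply: (jD (fun x => a * f x + b * g x)); [apply: jD|]; exact: jZ.
rewrite (RintegralD (f1 := fun x => a * f x + b * g x))//; [|by apply: jD; exact: jZ|exact: jZ].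
by rewrite RintegralD ?RintegralZl//; exact: jZ.
Qed.

End bounded_integrals.

Section chi2_bound.
Context (R : realType) (d : measure_display) (T : measurableType d) (P : probability T R).
Local Notation U := (measurableTypeR R).
Local Notation mu := (@lebesgue_measure R).
Context (S : {RV P >-> R}) (C c0 : R).
Hypothesis mS : all_moments _ _ _ P S.
Hypothesis c00 : 0 < c0.
Hypothesis expS : (\int[P]_w (expR (c0 * S w ^+ 2))%:E < +oo)%E.
Hypothesis HC : forall M,
  \sum_(1 <= k < M.+1) k`!%:R * poly_mean _ _ _ P S (hermite R 1 k) ^+ 2 <= C.

Let nu := law _ _ _ P S.
Let gam := gauss_prob R.

Lemma law_poly_integrable q : nu.-integrable [set: U] (EFin \o horner q).
Proof.
have mq : measurable_fun [set: R] (EFin \o horner q) by apply/measurable_EFinP; exact: measurable_poly.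
apply/integrableP; split=> //.
rewrite (ge0_integral_law _ _ _ P S (fun x => `|(EFin \o horner q) x|%E))//; last first.
  exact: measurableT_comp.
by have /integrableP[] := mS q.
Qed.

Lemma law_poly_mean q : (\int[nu]_x q.[x])%R = poly_mean _ _ _ P S q.
Proof.
congr fine; apply: integral_distribution; last exact: mS.
by apply/measurable_EFinP; exact: measurable_poly.
Qed.

Lemma gauss_prob_poly_integrable q : gam.-integrable [set: U] (EFin \o horner q).
Proof.
by apply: integrable_gauss_prob; [exact: measurable_poly|exact: integrable_horner_gauss].
Qed.

Lemma gauss_prob_poly_mean q : (\int[gam]_x q.[x])%R = gauss_mean R q.
Proof.
by apply: Rintegral_gauss_prob; [exact: measurable_poly|exact: integrable_horner_gauss].
Qed.

(** In Hermite coefficients, 2 c_k a_k - c_k^2/k! <= k! a_k^2 for k >= 1. Degree 0 contributes 2 c_0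
    to both sides and c_0^2 >= 0 to the right one. *)
Lemma poly_mean_duality q :
  2 * poly_mean _ _ _ P S q <= C + gauss_mean R (2 *: q + q ^+ 2).
Proof.
have [c qE] := hermite_expansion R 1 q.
rewrite gauss_mean_lin {2 3}qE gauss_mean_hermite_sqr {1}qE gauss_mean_sum.
rewrite (poly_mean_sum _ _ _ _ _ mS).
case: (size q) => [|N].
  by rewrite !big_geq// !mulr0 !addr0; have := HC 0; rewrite big_geq.
rewrite !(big_ltn (ltn0Sn N)).
rewrite (_ : hermite R 1 0 = 1)// poly_mean1 gauss_mean1 !mulr1.
have -> : \sum_(1 <= k < N.+1) c k * gauss_mean R (hermite R 1 k) = 0.
  by rewrite big_nat big1// => k /andP[k0 _]; rewrite gauss_mean_hermite1// mulr0.
have h : \sum_(1 <= k < N.+1) (2 * (c k * poly_mean _ _ _ P S (hermite R 1 k)) - c k ^+ 2 / k`!%:R) <=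
    \sum_(1 <= k < N.+1) k`!%:R * poly_mean _ _ _ P S (hermite R 1 k) ^+ 2.
  apply: ler_sum => k _; set a := poly_mean _ _ _ _ _ _.
  have f0 : 0 < k`!%:R :> R by rewrite ltr0n fact_gt0.
  rewrite -subr_ge0; have -> : k`!%:R * a ^+ 2 - (2 * (c k * a) - c k ^+ 2 / k`!%:R) =
    k`!%:R * (a - c k / k`!%:R) ^+ 2 by field; rewrite gt_eqF.
  by rewrite mulr_ge0 ?sqr_ge0// ltW.
move: h; rewrite sumrB -mulr_sumr => h; have := HC N.
have : 0 <= c 0 ^+ 2 / 0`!%:R by rewrite divr_ge0 ?sqr_ge0.
move: h; set u := \sum_(1 <= k < N.+1) _; set v := \sum_(1 <= k < N.+1) _;
  set w := \sum_(1 <= k < N.+1) _; rewrite addr0; lra.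
Qed.

Let m : {measure set U -> \bar R} := measure_add gam nu.
(** An exponent admissible for both summands of [m]: c0 for the law of S, 1/4 for the Gaussian. *)
Let c1 : R := Num.min c0 4^-1.

Let c10 : 0 < c1. Proof. by rewrite lt_min c00 invr_gt0/=. Qed.

Let mexp (c : R) : measurable_fun [set: U] (fun x : U => (expR (c * x ^+ 2))%:E).
Proof.
apply/measurable_EFinP; apply: measurableT_comp => //.
by apply: (@measurable_funM _ R R setT (cst c) (fun x => x ^+ 2)).
Qed.

Let expm : (\int[m]_(x in [set: U]) (expR (c1 * x ^+ 2))%:E < +oo)%E.
Proof.
rewrite ge0_integral_measure_add//.
apply: lte_add_pinfty.
  apply: (@le_lt_trans _ _ (\int[gam]_(x in [set: U]) (expR (4^-1 * x ^+ 2))%:E)%E).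
    apply: ge0_le_integral => //.
    by move=> x _; rewrite lee_fin ler_expR ler_wpM2r ?sqr_ge0// ge_min lexx orbT.
  have /integrableP[_] : gam.-integrable [set: U] (EFin \o (fun x : R => expR (4^-1 * x ^+ 2))).
    apply: integrable_gauss_prob; first by apply/measurable_EFinP; exact: (mexp 4^-1).
    have := integrable_expR_gauss R; congr (_.-integrable _ _).
    by apply/funext => x; rewrite (mulrC (x ^+ 2)).
  by under eq_integral do rewrite /= ger0_norm ?expR_ge0//.
apply: (@le_lt_trans _ _ (\int[nu]_(x in [set: U]) (expR (c0 * x ^+ 2))%:E)%E).
  apply: ge0_le_integral => //.
  by move=> x _; rewrite lee_fin ler_expR ler_wpM2r ?sqr_ge0// ge_min lexx.
rewrite (ge0_integral_law _ _ _ P S (fun x => (expR (c0 * x ^+ 2))%:E)); [exact: expS|exact: (mexp c0)|].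
by move=> x; rewrite lee_fin expR_ge0.
Qed.

Lemma bounded_duality (f : U -> R) (K : R) : measurable_fun [set: U] f ->
  (forall x, `|f x| <= K) ->
  2 * (\int[nu]_x f x)%R <= C + (\int[gam]_x (2 * f x + f x ^+ 2))%R.
Proof.
move=> mf fK; have K0 : 0 <= K := le_trans (normr_ge0 _) (fK 0).
have [_ Vf] := l2_poly_closure_bounded R m c1 c10 expm f K mf fK.
(* D B bounds the total error: 2 D from the law, then D^2 + D <= 2 D and D (1 + K)^2 from the
   Gaussian side. *)
pose B := 4 + (1 + K) ^+ 2; have B0 : 0 < B by rewrite ltr_wpDr// sqr_ge0.
apply/ler_addgt0Pr => e e0.
pose D := Num.min 1 (e / B); have D0 : 0 < D by rewrite lt_min ltr01 divr_gt0.
have D1 : D <= 1 by rewrite ge_min lexx.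
have DB : D * B <= e by rewrite -ler_pdivlMr// ge_min lexx orbT.
have D20 : 0 < D ^+ 2 by rewrite exprn_gt0.
have [q fq] := Vf _ D20.
pose r x := (f x - q.[x]) ^+ 2.
have mr : measurable_fun [set: U] r.
  by apply: measurable_funX; apply: measurable_funB; [exact: mf|exact: measurable_poly].
have r0 x : 0 <= r x by exact: sqr_ge0.
have mrE : measurable_fun [set: U] (fun x => (r x)%:E) by exact/measurable_EFinP.
have split_r : ((\int[gam]_(x in [set: U]) (r x)%:E + \int[nu]_(x in [set: U]) (r x)%:E)%E <= (D ^+ 2)%:E)%E.
  by rewrite -ge0_integral_measure_add// => x _; rewrite lee_fin.
have ir (l : probability U R) : (\int[l]_(x in [set: U]) (r x)%:E <= (D ^+ 2)%:E)%E ->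
    l.-integrable [set: U] (EFin \o r) /\ (\int[l]_x r x)%R <= D ^+ 2.
  move=> h; have il : l.-integrable [set: U] (EFin \o r).
    apply/integrableP; split; first exact: mrE.
    under eq_integral do rewrite /= ger0_norm//.
    by rewrite (le_lt_trans h)// ltry.
  split=> //; rewrite -lee_fin fineK//; exact: integrable_fin_num.
have [ig rg] : gam.-integrable [set: U] (EFin \o r) /\ (\int[gam]_x r x)%R <= D ^+ 2.
  apply: ir; apply: le_trans split_r; rewrite leeDl// integral_ge0// => x _.
  by rewrite lee_fin.
have [iv rv] : nu.-integrable [set: U] (EFin \o r) /\ (\int[nu]_x r x)%R <= D ^+ 2.
  apply: ir; apply: le_trans split_r; rewrite leeDr// integral_ge0// => x _.
  by rewrite lee_fin.
have i1 (l : probability U R) : l.-integrable [set: U] (EFin \o cst (1 : R)).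
  exact: finite_measure_integrable_cst.
have E1 (l : probability U R) : (\int[l]_x (cst (1 : R) x))%R = 1.
  by rewrite Rintegral_cst// [X in fine X](@probability_setT _ _ _ l) mul1r.
(* Young's inequality 2 f <= 2 q + D + (f - q)^2/D; the last term integrates to at most D^2/D. *)
have hv : 2 * (\int[nu]_x f x)%R <= 2 * poly_mean _ _ _ P S q + 2 * D.
  have [jv ev] := Rintegral_lin3 _ _ _ nu 2 D D^-1 _ _ _ (law_poly_integrable q) (i1 nu) iv.
  have jf := bounded_integrable_prob _ _ _ nu f K mf fK.
  have [jf2 ef2] := Rintegral_lin3 _ _ _ nu 2 0 0 _ _ _ jf jf jf.
  have hx x : 2 * f x + 0 * f x + 0 * f x <= 2 * q.[x] + D * cst 1 x + D^-1 * r x.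
    rewrite !mul0r !addr0 /cst mulr1 /r; set u := f x; set v := q.[x].
    have -> : 2 * u = 2 * v + D + D^-1 * (u - v) ^+ 2 - D^-1 * (u - v - D) ^+ 2.
      by field; rewrite gt_eqF.
    by rewrite gerBl mulr_ge0 ?sqr_ge0// invr_ge0 ltW.
  have := le_Rintegral measurableT jf2 jv (fun x _ => hx x).
  rewrite ef2 ev !mul0r !addr0 law_poly_mean E1 mulr1.
  have : D^-1 * (\int[nu]_x r x)%R <= D by rewrite ler_pdivrMl// -expr2.
  lra.
(* Pointwise 2 q + q^2 <= 2 f + f^2 + (1 + 1/D)(f - q)^2 + D (1 + f)^2, the gap being a square
   divided by D. *)
have hg : gauss_mean R (2 *: q + q ^+ 2) <= (\int[gam]_x (2 * f x + f x ^+ 2))%R +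
     (1 + D^-1) * D ^+ 2 + D * (1 + K) ^+ 2.
  have jf : gam.-integrable [set: U] (EFin \o (fun x => 2 * f x + f x ^+ 2)).
    apply: (bounded_integrable_prob _ _ _ gam _ (2 * K + K ^+ 2)).
      by apply: measurable_funD; [exact: measurable_funM|exact: measurable_funX].
    move=> x; apply: le_trans (ler_normD _ _) _; rewrite normrM normrX ger0_norm//.
    by rewrite lerD ?ler_pM2l// lerXn2r// nnegrE.
  have [jv ev] := Rintegral_lin3 _ _ _ gam 1 (1 + D^-1) (D * (1 + K) ^+ 2) _ _ _ jf ig (i1 gam).
  have hx x : (2 *: q + q ^+ 2).[x] <= 1 * (2 * f x + f x ^+ 2) + (1 + D^-1) * r x +
      D * (1 + K) ^+ 2 * cst 1 x.
    rewrite /cst mulr1 mul1r /r hornerD hornerZ horner_exp.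
    have := fK x; set u := f x; set v := q.[x] => uK.
    have : (1 + u) ^+ 2 <= (1 + K) ^+ 2.
      rewrite -[leLHS]real_normK ?num_real// lerXn2r ?nnegrE ?addr_ge0//.
      by apply: le_trans (ler_normD _ _) _; rewrite normr1 lerD2l.
    move=> h2; have h3 : D * (1 + u) ^+ 2 <= D * (1 + K) ^+ 2 by rewrite ler_pM2l.
    have h4 : 2 * v + v ^+ 2 = 2 * u + u ^+ 2 + (1 + D^-1) * (u - v) ^+ 2 + D * (1 + u) ^+ 2
       - D^-1 * (u - v + D * (1 + u)) ^+ 2.
      by field; rewrite gt_eqF.
    have h5 : 0 <= D^-1 * (u - v + D * (1 + u)) ^+ 2.
      by rewrite mulr_ge0 ?sqr_ge0// invr_ge0 ltW.
    lra.
  have := le_Rintegral measurableT (gauss_prob_poly_integrable (2 *: q + q ^+ 2)) jv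
    (fun x _ => hx x).
  rewrite gauss_prob_poly_mean ev E1 mulr1 mul1r => h; apply: le_trans h _.
  by rewrite lerD2r lerD2l ler_pM2l// ltr_wpDr// invr_ge0 ltW.
have h := poly_mean_duality q.
have h2 : (1 + D^-1) * D ^+ 2 = D ^+ 2 + D by field; rewrite gt_eqF.
have h3 : D ^+ 2 <= D by rewrite expr2 ger_pMr.
move: DB; rewrite /B; lra.
Qed.

End chi2_bound.

Section chi2_upper_bound.
Context (R : realType) (d : measure_display) (T : measurableType d) (P : probability T R).
Local Notation U := (measurableTypeR R).
Local Notation mu := (@lebesgue_measure R).
Context (S : {RV P >-> R}) (C c0 : R).
Hypothesis mS : all_moments _ _ _ P S.
Hypothesis c00 : 0 < c0.
Hypothesis expS : (\int[P]_w (expR (c0 * S w ^+ 2))%:E < +oo)%E.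
Hypothesis HC : forall M,
  \sum_(1 <= k < M.+1) k`!%:R * poly_mean _ _ _ P S (hermite R 1 k) ^+ 2 <= C.

Let nu := law _ _ _ P S.
Let gam := gauss_prob R.
Let duality := bounded_duality R d T P S C c0 mS c00 expS HC.

(** If A is Lebesgue-null, the Gaussian side of the duality vanishes at f = t 1_A, so 2 t nu(A) <= C
    for every real t. *)
Lemma law_dominated : nu `<< mu.
Proof.
apply/null_content_dominatesP => A mA A0.
have gA : gam A = 0%E.
  by have /null_content_dominatesP H := @normal_prob_dominates R 0 1; exact: H.
have mI (t : R) : measurable_fun [set: U] (fun x => t * \1_A x : R).
  by apply: measurable_funM => //; exact: measurable_indic.
have bI (t : R) x : `|t * \1_A x| <= `|t|.
  by rewrite normrM indicE; case: (x \in A); rewrite /= ?normr1 ?normr0 ?mulr1 ?mulr0.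
have EI (l : probability U R) (t : R) : (\int[l]_x (t * \1_A x))%R = t * fine (l A).
  rewrite RintegralZl//; last first.
    apply: (bounded_integrable_prob _ _ _ l _ 1); first exact: measurable_indic.
    by move=> x; have := bI 1 x; rewrite mul1r normr1.
  by rewrite /Rintegral integral_indic// setIT.
have h (t : R) : 2 * (t * fine (nu A)) <= C.
  have := duality (fun x => t * \1_A x) `|t| (mI t) (bI t); rewrite EI => h.
  apply: le_trans h _; rewrite (_ : (\int[gam]_x _)%R = (2 * t + t ^+ 2) * fine (gam A)).
    by rewrite gA mulr0 addr0.
  rewrite -EI; apply: eq_Rintegral => x _.
  by rewrite indicE; case: (x \in A); rewrite /=; ring.
have nA : 0 <= fine (nu A) by exact: fine_ge0.
rewrite -[LHS]fineK ?fin_num_measure//; congr EFin; apply/eqP.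
rewrite eq_le nA andbT leNgt; apply/negP => n0.
have := h ((`|C| + 1) / fine (nu A)); rewrite divfK ?gt_eqF//.
by have := ler_norm C; have := normr_ge0 C; lra.
Qed.

Let p x := fine (Radon_Nikodym_SigmaFinite.f nu mu x).

Lemma law_density : is_density_of P S p.
Proof.
have ac := law_dominated; have fin := Radon_Nikodym_SigmaFinite.f_fin_num ac.
have mf := measurable_int _ (Radon_Nikodym_SigmaFinite.f_integrable ac).
split.
- by apply: (measurableT_comp (f := fine)) => //; exact: measurable_fine.
- by move=> x; apply: fine_ge0; exact: Radon_Nikodym_SigmaFinite.f_ge0.
move=> A mA; rewrite -[LHS](lawE _ _ _ P S).
rewrite (Radon_Nikodym_SigmaFinite.f_integral ac mA).
by apply: eq_integral => x _; rewrite /p fineK.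
Qed.

(** For psi = u 1_{|u| <= n} one has psi u = psi^2, so 2 psi p = (2 psi + psi^2) phi + psi^2 phi.
    The duality leaves at most C for the integral of psi^2 phi, and monotone convergence lets n
    grow. *)
Lemma chi2_le_hermite : (chi2 P S <= C%:E)%E.
Proof.
have pS := law_density; have [mp p0 _] := pS.
apply: (@le_trans _ _ (\int[mu]_x (((p x / gauss x - 1) ^+ 2 * gauss x)%:E))%E).
  by apply: ereal_inf_lbound; exists p.
pose u (x : R) := p x / gauss x - 1.
have mu_ : measurable_fun [set: R] u.
  apply: measurable_funB => //; apply: measurable_funM => //.
  apply: continuous_measurable_fun => x.
  by apply: cvgV; [rewrite gt_eqF// gauss_gt0|exact: continuous_gauss].
pose psi (n : nat) x := if `|u x| <= n%:R then u x else 0.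
have mpsi n : measurable_fun [set: R] (psi n).
  apply: measurable_fun_ifT => //.
  by apply: measurable_fun_ler => //; exact: measurableT_comp.
have bpsi n x : `|psi n x| <= n%:R.
  by rewrite /psi; case: ifP => //; rewrite normr0.
have ig : mu.-integrable [set: R] (fun x => (gauss x)%:E).
  by rewrite gaussE; exact: integrable_normal_pdf.
have ip := integrable_density _ _ _ P S p pS.
have ib (f : R -> R) (w : R -> R) K : measurable_fun [set: R] f -> measurable_fun [set: R] w ->
    (forall x, 0 <= w x) ->
    (forall x, `|f x| <= K) -> mu.-integrable [set: R] (fun x => (w x)%:E) ->
    mu.-integrable [set: R] (fun x => (f x * w x)%:E).
  move=> mf mw w0 fK iw; have := integrableZl measurableT K iw => iK.
  apply: (le_integrable measurableT _ _ iK).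
    by apply/measurable_EFinP; exact: measurable_funM.
  move=> x _; rewrite -EFinM !abse_EFin lee_fin !normrM ler_wpM2r//.
  by rewrite (le_trans (fK x))// ler_norm.
have mg := measurable_gauss R.
have g0 := gauss_gt0 R.
have b2 n x : `|2 * psi n x + psi n x ^+ 2| <= 2 * n%:R + n%:R ^+ 2.
  apply: le_trans (ler_normD _ _) _; rewrite normrM normrX ger0_norm//.
  by rewrite lerD ?ler_pM2l// lerXn2r ?nnegrE.
have m2 n : measurable_fun [set: R] (fun x => 2 * psi n x + psi n x ^+ 2).
  by apply: measurable_funD; [exact: measurable_funM|exact: measurable_funX].
have mI n : measurable_fun [set: R] (fun x => (psi n x ^+ 2 * gauss x)%:E).
  by apply/measurable_EFinP; apply: measurable_funM => //; exact: measurable_funX.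
have bnd n : (\int[mu]_x ((psi n x ^+ 2 * gauss x)%:E) <= C%:E)%E.
  have ipp := ib (psi n) p n%:R (mpsi n) mp p0 (bpsi n) ip.
  have ipg := ib _ _ _ (m2 n) mg (fun x => ltW (g0 x)) (b2 n) ig.
  have mps : measurable_fun [set: R] (fun x => psi n x ^+ 2) by exact: measurable_funX.
  have bps x : `|psi n x ^+ 2| <= n%:R ^+ 2 by rewrite normrX lerXn2r ?nnegrE.
  have ips := ib _ _ _ mps mg (fun x => ltW (g0 x)) bps ig.
  have := duality (psi n) n%:R (mpsi n) (bpsi n).
  rewrite (Rintegral_gauss_prob R _ (m2 n) ipg).
  have -> : (\int[nu]_x psi n x)%R = (\int[mu]_x (psi n x * p x))%R.
    congr fine; rewrite -(density_expectation _ _ _ _ _ _ pS (psi n) (mpsi n) ipp).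
    apply: integral_distribution; first by apply/measurable_EFinP; exact: (mpsi n).
    exact: (density_integrable _ _ _ _ _ _ pS (psi n) (mpsi n) ipp).
  rewrite -RintegralZl//.
  have -> : (\int[mu]_x (2 * (psi n x * p x)))%R =
     (\int[mu]_x ((2 * psi n x + psi n x ^+ 2) * gauss x + psi n x ^+ 2 * gauss x))%R.
    apply: eq_Rintegral => x _.
    have -> : p x = (u x + 1) * gauss x by rewrite /u subrK divfK// gt_eqF.
    by rewrite /psi; case: ifP => _; move: (u x) (gauss x) => a b; ring.
  rewrite RintegralD// [leLHS]addrC lerD2r => h.
  by rewrite -[leLHS]fineK ?lee_fin; [exact: h|exact: integrable_fin_num ips].
apply: (@le_trans _ _ (limn (fun n => \int[mu]_x ((psi n x ^+ 2 * gauss x)%:E)))%E).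
  rewrite -monotone_convergence//.
  - rewrite le_eqVlt; apply/orP; left; apply/eqP; apply: eq_integral => x _.
    apply/esym/cvg_lim => //; apply: cvg_near_cst; near=> n; rewrite /psi ifT//.
    by near: n; exact: nbhs_infty_ger.
  - by move=> n x _; rewrite lee_fin mulr_ge0 ?sqr_ge0// ltW.
  - move=> x _ a b ab; rewrite lee_fin ler_wpM2r ?(ltW (g0 x))// /psi.
    have [xa|_] := leP `|u x| a%:R; last by rewrite expr0n sqr_ge0.
    by rewrite (le_trans xa)// ler_nat.
apply: lime_le; last by apply: nearW => n; exact: bnd.
apply: ereal_nondecreasing_is_cvgn => a b ab; apply: ge0_le_integral => //.
- by move=> x _; rewrite lee_fin mulr_ge0 ?sqr_ge0// ltW.
- exact: mI.
- exact: mI.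
move=> x _; rewrite lee_fin ler_wpM2r ?(ltW (g0 x))// /psi.
have [xa|_] := leP `|u x| a%:R; last by rewrite expr0n sqr_ge0.
by rewrite (le_trans xa)// ler_nat.
Unshelve. all: by end_near. Qed.

End chi2_upper_bound.

(** * The theorem *)

Section normalized_sum.
Context (R : realType) (d : measure_display) (T : measurableType d) (P : probability T R).
Context (n : nat) (X : 'I_n -> {RV P >-> R}).
Hypothesis n0 : (0 < n)%N.
Hypothesis indX : mutually_independent P (fun j => (X j : T -> R)).
Hypothesis finX : forall j, (chi2 P (X j) < +oo)%E.

Let S w := (\sum_(j < n) X j w) / Num.sqrt n%:R.

Let sn0 : 0 < Num.sqrt (n%:R : R). Proof. by rewrite sqrtr_gt0 ltr0n. Qed.

Let SE : S = fun w => (Num.sqrt n%:R)^-1 * prefix_sum _ _ _ _ _ X n w.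
Proof. by apply/funext => w; rewrite prefix_sum_all mulrC. Qed.

Lemma measurable_normalized_sum : measurable_fun [set: T] S.
Proof.
rewrite SE; apply: measurable_funM; first exact: measurable_cst.
exact: measurable_prefix_sum.
Qed.

Let mX j : all_moments _ _ _ P (X j). Proof. exact: chi2_all_moments. Qed.

Lemma normalized_sum_moments : all_moments _ _ _ P S.
Proof.
move=> q; have [/(_ (q \Po ((Num.sqrt n%:R)^-1 *: 'X))) + _] :=
  prefix_sum_moments _ _ _ _ _ X 0 indX mX n (leqnn n).
congr (_.-integrable _ _); apply/funext => w.
by rewrite horner_comp hornerZ hornerX SE.
Qed.

Let hpoly M j := \poly_(m < M.+1) poly_mean _ _ _ P (X j) (hermite R 1 m).

Lemma normalized_sum_energy M :
  \sum_(1 <= k < M.+1) k`!%:R * poly_mean _ _ _ P S (hermite R 1 k) ^+ 2 =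
  hermite_energy R M n%:R (\prod_(j < n) hpoly M j).
Proof.
apply: eq_big_nat => k /andP[_ kM].
have -> : poly_mean _ _ _ P S (hermite R 1 k) =
    (Num.sqrt n%:R)^-1 ^+ k * (\prod_(j < n) hpoly M j)`_k.
  have [mS /(_ k kM) E] := prefix_sum_moments _ _ _ _ _ X M indX mX n (leqnn n).
  rewrite (eq_bigl (fun j : 'I_n => (j < n)%N)); last by move=> j; rewrite ltn_ord.
  rewrite -E /poly_mean -RintegralZl//; last exact: mS.
  apply: eq_Rintegral => w _; rewrite SE; apply: hermite_scale.
  by rewrite exprVn sqr_sqrtr// mulVf// pnatr_eq0 -lt0n.
rewrite exprMn -exprM mulnC exprM exprVn sqr_sqrtr// exprVn mulrA.
by [].
Qed.

(** By Cauchy-Schwarz S^2 is at most the sum of the X_j^2, so some X_j^2 is at least S^2/n, and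
    e^(S^2/(8n)) is at most the sum of the e^(X_j^2/8). *)
Lemma normalized_sum_exp_moment :
  (\int[P]_w (expR ((8%:R * n%:R)^-1 * S w ^+ 2))%:E < +oo)%E.
Proof.
have mexp j : measurable_fun [set: T] (fun w => (expR (X j w ^+ 2 / 8%:R))%:E).
  apply/measurable_EFinP; apply: measurableT_comp => //.
  by apply: measurable_funM => //; exact: measurable_funX.
apply: (@le_lt_trans _ _ (\int[P]_w (\sum_(j < n) (expR (X j w ^+ 2 / 8%:R))%:E)%E)%E).
  apply: ge0_le_integral => //.
  - apply/measurable_EFinP; apply: measurableT_comp => //.
    apply: measurable_funM => //; apply: measurable_funX; exact: measurable_normalized_sum.
  - exact: emeasurable_sum.
  move=> w _; rewrite sumEFin lee_fin.
  have CS : S w ^+ 2 <= \sum_(j < n) X j w ^+ 2.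
    rewrite /S expr_div_n sqr_sqrtr// ler_pdivrMr ?ltr0n//.
    have := cauchy_schwarz_sum R 'I_n (index_enum _) xpredT (fun=> 1) (fun j => X j w) (fun=> 1)
      (fun _ _ => ltr01).
    rewrite (eq_bigr (fun j => X j w)) => [|j _]; last by rewrite mulr1.
    rewrite [X in _ <= X * _](eq_bigr (fun j => X j w ^+ 2)) => [|j _]; last by rewrite mul1r.
    rewrite [X in _ <= _ * X](eq_bigr (fun=> 1)) => [|j _]; last by rewrite expr1n divr1.
    by rewrite sumr_const card_ord.
  have [j Sj] : exists j, S w ^+ 2 / n%:R <= X j w ^+ 2.
    apply/not_existsP => H; move: CS; apply/negP; rewrite -ltNge.
    have -> : S w ^+ 2 = \sum_(j < n) S w ^+ 2 / n%:R.
      by rewrite sumr_const card_ord -(mulr_natr (S w ^+ 2 / n%:R)) divfK// pnatr_eq0 -lt0n.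
    apply: ltr_sum => [|j _]; last by rewrite ltNge; apply/negP; exact: H.
    by apply/hasP; exists (Ordinal n0).
  rewrite (bigD1 j)//= -[leLHS]addr0 lerD ?sumr_ge0//.
    rewrite ler_expR invfM -mulrA mulrC [n%:R^-1 * _]mulrC.
    by rewrite ler_pM2r// invr_gt0.
rewrite ge0_integral_sum//.
by apply: lte_sum_pinfty => j _; exact: chi2_exp_moment.
Qed.

Section bound.
Variables (J : pred nat) (kappa C D : nat -> R).
Hypotheses (kappa0 : forall n, 0 <= kappa n) (C0 : forall n, 0 <= C n).
Hypotheses (kappa1 : kappa 1 = 1) (D0 : forall n, (2 <= n)%N -> 0 <= D n).
Hypothesis CD : forall n, (2 <= n)%N -> C n * kappa n.-1 = D n * kappa n.
Hypothesis H0 : forall M n, (2 <= n)%N ->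
  \sum_(1 <= k < M.+1 | ~~ J k) (n%:R^-1) ^+ k <= kappa n / n%:R ^+ 2.
Hypothesis Hs : forall M n s, (2 <= n)%N -> (1 <= s)%N ->
  \sum_(1 <= k < M.+1 | ~~ J k)
    k%:R ^+ 2 / (k + s)%:R ^+ 2 * 'C(k + s, k)%:R * (n%:R^-1) ^+ k *
      (1 - n%:R^-1) ^+ s <= C n / n%:R ^+ 2.
Hypothesis JX : forall j k, J k -> poly_mean _ _ _ P (X j) (hermite R 1 k) = 0.

Lemma chi2_normalized_sum_le (delta : R) :
  ((n%:R^-1)%:E * \sum_(j < n) chi2 P (X j))%E = delta%:E ->
  (chi2 P S <= (kappa n * delta * nested_sum R D n delta)%:E)%E.
Proof.
move=> Ddelta.
have deltaE : n%:R^-1 * \sum_(i in [set: 'I_n]%SET) fine (chi2 P (X i)) = delta.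
  apply: EFin_inj; rewrite -Ddelta EFinM; congr (_ * _)%E.
  rewrite -sumEFin; apply: eq_big => [i|i _]; first by rewrite inE.
  by rewrite fineK// ge0_fin_numE ?chi2_ge0.
pose Sm : {RV P >-> R} := mfun_Sub (mem_set measurable_normalized_sum).
apply: (@chi2_le_hermite R d T P Sm _ (8%:R * n%:R)^-1).
- exact: normalized_sum_moments.
- by rewrite invr_gt0 mulr_gt0 ?ltr0n.
- exact: normalized_sum_exp_moment.
move=> M; rewrite normalized_sum_energy.
have := hermite_energy_bound R kappa C D kappa0 C0 kappa1 D0 CD _ (hpoly M) J M
  (fun j => fine (chi2 P (X j))) [set: 'I_n]%SET.
rewrite cardsT card_ord deltaE.
rewrite (eq_bigl xpredT); last by move=> i; rewrite inE.
apply => //.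
- by move=> j; rewrite coef_poly/= poly_mean1.
- by move=> j k Jk; rewrite coef_poly; case: ifP => // _; exact: JX.
- move=> j; rewrite -lee_fin fineK; last by rewrite ge0_fin_numE ?chi2_ge0.
  apply: le_trans (chi2_bessel _ _ _ _ (X j) M); rewrite lee_fin le_eqVlt; apply/orP; left.
  apply/eqP; apply: eq_big_nat => k /andP[_ kM].
  by rewrite expr1n divr1 coef_poly kM.
- by move=> k; exact: H0.
- by move=> k s; exact: Hs.
Qed.
End bound.

End normalized_sum.

(** * Vanishing Hermite coefficients *)

Section coefficients.
Context (R : realType) (d : measure_display) (T : measurableType d) (P : probability T R).
Context (Y : {RV P >-> R}).
Hypothesis mY : all_moments _ _ _ P Y.

Lemma poly_mean_hermite1 : expectation P Y = 0%E -> poly_mean _ _ _ P Y (hermite R 1 1) = 0.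
Proof.
rewrite unlock => EY; rewrite /poly_mean hermite1 /Rintegral.
by under eq_integral do rewrite hornerX; rewrite EY.
Qed.

Lemma poly_mean_hermite2 : expectation P (fun w => Y w ^+ 2) = 1%E ->
  poly_mean _ _ _ P Y (hermite R 1 2) = 0.
Proof.
rewrite unlock => EY.
have -> : poly_mean _ _ _ P Y (hermite R 1 2) =
    poly_mean _ _ _ P Y (2^-1 *: 'X^2 + ((- 2^-1) *: 1 + 0)).
  by apply: eq_Rintegral => w _; rewrite horner_hermite2 !(hornerD, hornerZ, hornerXn, hornerC) ; field.
rewrite !poly_mean_lin// poly_mean1 poly_mean0//.
rewrite [poly_mean _ _ _ _ _ 'X^2](_ : _ = 1); first by ring.
rewrite /poly_mean /Rintegral; under eq_integral do rewrite hornerXn.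
by rewrite EY.
Qed.

(** Y and -Y have the same law, while a Hermite polynomial of odd degree is odd, so its mean equals
    its own negative. *)
Lemma poly_mean_hermite_odd k : symmetric_rv P Y -> odd k ->
  poly_mean _ _ _ P Y (hermite R 1 k) = 0.
Proof.
move=> symY k1.
have mN : measurable_fun [set: T] (fun w => - Y w) by apply: measurableT_comp.
pose Z : {RV P >-> R} := mfun_Sub (mem_set mN).
have ZE : (Z : T -> R) = fun w => - Y w by [].
have mZ : all_moments _ _ _ P Z.
  move=> q; have := mY (q \Po (- 'X)); congr (_.-integrable _ _); apply/funext => w.
  by rewrite horner_comp hornerN hornerX.
have mq : measurable_fun [set: R] (EFin \o horner (hermite R 1 k)).
  by apply/measurable_EFinP; exact: measurable_poly.
have E : poly_mean _ _ _ P Y (hermite R 1 k) = poly_mean _ _ _ P Z (hermite R 1 k).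
  rewrite -(law_poly_mean _ _ _ _ _ mY) -(law_poly_mean _ _ _ _ _ mZ); congr fine.
  by apply: eq_measure_integral => A mA _; exact: symY.
have : poly_mean _ _ _ P Z (hermite R 1 k) = - poly_mean _ _ _ P Y (hermite R 1 k).
  rewrite -mulN1r -RintegralZl//; last exact: mY.
  apply: eq_Rintegral => w _; rewrite ZE hermite_opp.
  by rewrite -signr_odd k1 expr1.
by rewrite -E; lra.
Qed.
End coefficients.

(** * The prefactors and the constants D_n and L_n *)

(** The row s = 0 of the energy step. At p = 1/n the right side is n^-2/(n - 1), the source of the
    prefactor 1/(n - 1). *)
Lemma geometric_sum12 (R : realFieldType) (p : R) M : 0 < p < 1 ->
  \sum_(1 <= k < M.+1 | ~~ J12 k) p ^+ k <= p ^+ 3 / (1 - p).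
Proof.
move=> /andP[p0 p1]; have q0 : 0 < 1 - p by rewrite subr_gt0.
have H m : \sum_(1 <= k < m.+3 | ~~ J12 k) p ^+ k = p ^+ 3 / (1 - p) - p ^+ m.+3 / (1 - p).
  elim: m => [|m IH].
    by rewrite big_ltn_cond//= big_ltn_cond//= big_geq// subrr.
  rewrite big_mkcond big_nat_recr//= -big_mkcond IH [p ^+ m.+4]exprS.
    by field; rewrite gt_eqF.
case: M => [|[|m]].
- by rewrite big_geq// divr_ge0 ?exprn_ge0// ltW.
- by rewrite big_ltn_cond//= big_geq// divr_ge0 ?exprn_ge0// ltW.
by rewrite H gerBl divr_ge0 ?exprn_ge0// ltW.
Qed.

(** Only even k >= 4 remain; at p = 1/n the right side is n^-2/(n^2 - 1). *)
Lemma geometric_sum_sym (R : realFieldType) (p : R) M : 0 < p < 1 ->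
  \sum_(1 <= k < M.+1 | ~~ Jsym k) p ^+ k <= p ^+ 4 / (1 - p ^+ 2).
Proof.
move=> /andP[p0 p1]; have q0 : 0 < 1 - p ^+ 2 by rewrite subr_gt0 expr_lt1// ltW.
have H m : \sum_(1 <= k < m.*2.+4 | ~~ Jsym k) p ^+ k =
    p ^+ 4 / (1 - p ^+ 2) - p ^+ m.*2.+4 / (1 - p ^+ 2).
  elim: m => [|m IH].
    by rewrite big_ltn_cond//= big_ltn_cond//= big_ltn_cond//= big_geq// subrr.
  rewrite doubleS big_mkcond big_nat_recr//= big_nat_recr//= -big_mkcond IH.
  rewrite /Jsym/= !negbK odd_double/= addr0 [p ^+ m.*2.+2.+4]exprS [p ^+ m.*2.+2.+3]exprS.
    by field; rewrite gt_eqF.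
apply: (@le_trans _ _ (\sum_(1 <= k < M.*2.+4 | ~~ Jsym k) p ^+ k)).
  rewrite [leRHS](big_cat_nat (n := M.+1))//=; last by rewrite -addnn; lia.
  by rewrite lerDl sumr_ge0// => k _; rewrite exprn_ge0// ltW.
by rewrite H gerBl divr_ge0 ?exprn_ge0// ltW.
Qed.

Lemma nested_sumE (R : realFieldType) (D : nat -> R) n x : (0 < n)%N ->
  nested_sum R D n x = 1 + \sum_(2 <= k < n.+1)
    (\prod_((n.+2 - k)%N <= i < n.+1) D i) * x ^+ (k - 1).
Proof.
move=> n0; rewrite /nested_sum big_ltn// subn0 big_geq// expr0 mulr1 [in RHS]big_add1.
by congr (_ + _); apply: eq_bigr => k _; rewrite subSS subn1.
Qed.

Section growth.
Context (R : realType) (G : R).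
Hypothesis G0 : 0 < G.

(** The bound G + 3 p/(1 - p) at p = 1/n, which stands in for C_J(1/n). *)
Definition growth (n : nat) : R := G + 3%:R * (n%:R^-1 / (1 - n%:R^-1)).

Lemma growth_gt0 n : 0 < growth n.
Proof.
rewrite ltr_wpDr// mulr_ge0// divr_ge0 ?invr_ge0// subr_ge0.
by case: n => [|n]; [rewrite invr0|rewrite invf_le1 ?ler1n ?ltr0n].
Qed.

Lemma growthE n : growth n.+2 = G + 3%:R * harmonic n.
Proof.
rewrite /growth /harmonic/=; congr (_ + _ * _).
have n0 : 0 < n.+1%:R :> R by rewrite ltr0n.
rewrite -[n.+2%:R]natr1; move: (n.+1%:R : R) n0 => x x0.
by field; rewrite !gt_eqF//; lra.
Qed.

Lemma cvg_growth3 : growth n.+3 @[n --> \oo] --> G.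
Proof.
have h : (harmonic n.+1 : R) @[n --> \oo] --> (0 : R).
  by rewrite (cvg_shiftS (fun n => harmonic n : R)); exact: cvg_harmonic.
have c : (G + 3%:R * harmonic n.+1) @[n --> \oo] --> G + 3%:R * 0.
  by apply: cvgD; [exact: cvg_cst|exact: cvgMr].
by rewrite mulr0 addr0 in c; under eq_fun do rewrite growthE.
Qed.

(** The value 1 at n = 1 starts the recursion, a single factor being bounded by its own energy. *)
Definition weight12 (n : nat) : R := if (n < 2)%N then 1 else (n%:R - 1)^-1.
Definition weight_sym (n : nat) : R := if (n < 2)%N then 1 else (n%:R ^+ 2 - 1)^-1.

Lemma weight12_gt0 n : 0 < weight12 n.
Proof.
rewrite /weight12; case: ltnP => // n2.
by rewrite invr_gt0 subr_gt0 ltr1n.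
Qed.

Lemma weight_sym_gt0 n : 0 < weight_sym n.
Proof.
rewrite /weight_sym; case: ltnP => // n2.
by rewrite invr_gt0 subr_gt0 expr_gt1 ?ltr1n.
Qed.

Definition recursion_coef (w : nat -> R) (n : nat) : R := growth n * w n.-1 / w n.

Lemma recursion_coef_gt0 w n : (forall n, 0 < w n) -> 0 < recursion_coef w n.
Proof. by move=> w0; rewrite divr_gt0// mulr_gt0// growth_gt0. Qed.

(** The shift by 3 keeps both indices n - 1 and n of the weight at least 2, away from the
    exceptional values. *)
Lemma cvg_recursion_coef w (r : nat -> R) : (forall n, w n.+2 / w n.+3 = r n) ->
  r n @[n --> \oo] --> (1 : R) -> recursion_coef w n @[n --> \oo] --> G.
Proof.
move=> wr r1; rewrite -(cvg_shiftn 3).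
have c : (growth n.+3 * r n) @[n --> \oo] --> G * 1 by apply: cvgM => //; exact: cvg_growth3.
by rewrite mulr1 in c; under eq_fun do rewrite addn3 /recursion_coef /= -mulrA wr.
Qed.

Lemma cvg_recursion_coef12 : recursion_coef weight12 n @[n --> \oo] --> G.
Proof.
apply: (cvg_recursion_coef _ (fun n => 1 + harmonic n)) => [n|].
  rewrite /weight12 /harmonic/= invrK -[n.+3%:R]natr1 -[n.+2%:R]natr1 !addrK.
  by rewrite -natr1; field; rewrite natr1 pnatr_eq0.
have c : (1 + harmonic n : R) @[n --> \oo] --> 1 + (0 : R).
  by apply: cvgD; [exact: cvg_cst|exact: cvg_harmonic].
by rewrite addr0 in c.
Qed.

Lemma cvg_recursion_coef_sym : recursion_coef weight_sym n @[n --> \oo] --> G.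
Proof.
have h : (harmonic n : R) @[n --> \oo] --> (0 : R) by exact: cvg_harmonic.
have h2 : (harmonic n.+2 : R) @[n --> \oo] --> (0 : R).
  by rewrite (cvg_shiftS (fun n => harmonic n.+1 : R)) (cvg_shiftS (fun n => harmonic n : R)).
apply: (cvg_recursion_coef _ (fun n => (1 + harmonic n) * (1 + harmonic n.+2))) => [n|].
  rewrite /weight_sym /harmonic/= invrK.
  have -> : n.+2%:R = n.+1%:R + 1 :> R by rewrite natr1.
  have -> : n.+3%:R = n.+1%:R + 2 :> R by rewrite -natrD addn2.
  have n0 : 0 < n.+1%:R :> R by rewrite ltr0n.
  move: (n.+1%:R) n0 => x x0.
  by field; rewrite !gt_eqF//; nra.
have c : ((1 + harmonic n) * (1 + harmonic n.+2) : R) @[n --> \oo] --> (1 + 0) * (1 + 0 : R).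
  by apply: cvgM; apply: cvgD => //; exact: cvg_cst.
by rewrite addr0 mulr1 in c.
Qed.
End growth.

Section chi2_bound_of_weights.
Context (R : realType) (J : pred nat) (G : R) (w : nat -> R).
Hypotheses (G0 : 0 < G) (w0 : forall n, 0 < w n) (w1 : w 1 = 1).
Hypothesis sum_w : forall M n, (2 <= n)%N ->
  \sum_(1 <= k < M.+1 | ~~ J k) (n%:R^-1) ^+ k <= w n / n%:R ^+ 2.
Hypothesis sum_h : forall s p M, (1 <= s)%N -> 0 < p < 1 ->
  \sum_(1 <= k < M.+1 | ~~ J k) hterm R s p k * (1 - p) ^+ s <=
  (G + 3%:R * (p / (1 - p))) * p ^+ 2.

Lemma chi2_le_of_weights (d : measure_display) (T : measurableType d) (P : probability T R)
    (n : nat) (X : 'I_n -> {RV P >-> R}) (delta : R) : (2 <= n)%N ->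
  mutually_independent P (fun j => (X j : T -> R)) ->
  ((n%:R^-1)%:E * \sum_(j < n) chi2 P (X j))%E = delta%:E ->
  ((forall j, chi2 P (X j) < +oo)%E -> forall j k, J k ->
    poly_mean _ _ _ P (X j) (hermite R 1 k) = 0) ->
  (chi2 P (fun v => (\sum_(j < n) X j v) / Num.sqrt n%:R)%R <= (w n * delta *
     (1 + \sum_(2 <= k < n.+1)
       (\prod_((n.+2 - k)%N <= i < n.+1) recursion_coef R G w i) * delta ^+ (k - 1)))%:E)%E.
Proof.
move=> n2 indX Ddelta JX; have n0 : (0 < n)%N by apply: ltnW.
(* A finite Delta is a positive multiple of a sum of nonnegative terms, so each term is finite. *)
have finX j : (chi2 P (X j) < +oo)%E.
  rewrite ltey; apply/eqP => Xy; move: Ddelta; rewrite (bigD1 j)//= Xy addye; last first.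
    by rewrite gt_eqF// (lt_le_trans (ltNyr 0))// sume_ge0// => i _; exact: chi2_ge0.
  by rewrite gt0_muley// lte_fin invr_gt0 ltr0n.
rewrite -nested_sumE//.
apply: (chi2_normalized_sum_le _ _ _ _ _ _ n0 indX finX J w (growth R G) (recursion_coef R G w)) => //.
- by move=> i; exact: ltW.
- by move=> i; apply: ltW; exact: growth_gt0.
- by move=> i _; apply: ltW; exact: recursion_coef_gt0.
- by move=> i _; rewrite /recursion_coef divfK// gt_eqF.
- move=> M m s m2 s1; have m0 : 0 < m%:R :> R by rewrite ltr0n ltnW.
  have m01 : 0 < (m%:R^-1 : R) < 1 by rewrite invr_gt0 m0 invf_lt1// ltr1n.
  by have := sum_h s _ M s1 m01; rewrite [X in _ * X]exprVn.
- exact: JX.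
Qed.
End chi2_bound_of_weights.

Lemma expRN1_le (R : realType) : expR (- 1) <= 37%:R / 100%:R :> R.
Proof. by apply: (expRN_nat_le R 1); lra. Qed.

Definition profile_sup (R : realType) (g : R -> R) := sup [set g x | x in [set x : R | 0 < x]].

Theorem theorem8 (R : realType) :
  exists D L : nat -> R,
    (forall n, (2 <= n)%N -> 0 < D n /\ 0 < L n) /\
    (exists lD : R, D n @[n --> \oo] --> lD /\
       CJ J12 p @[p --> 0^'+] --> lD%:E /\ lD < 12183%:R / 10000%:R) /\
    (exists lL : R, L n @[n --> \oo] --> lL /\
       CJ Jsym p @[p --> 0^'+] --> lL%:E /\ lL < 5893%:R / 10000%:R) /\
    forall (d : measure_display) (T : measurableType d) (P : probability T R)
      (n : nat) (X : 'I_n -> {RV P >-> R}),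
      (2 <= n)%N ->
      mutually_independent P (fun j => (X j : T -> R)) ->
      (forall j, expectation P (X j) = 0%E) ->
      (forall j, expectation P (fun w => X j w ^+ 2) = 1%E) ->
      let S := fun w => (\sum_(j < n) X j w) / Num.sqrt n%:R in
      let Delta := ((n%:R^-1)%:E * \sum_(j < n) chi2 P (X j))%E in
      (forall delta : R, Delta = delta%:E ->
         (chi2 P S <= (delta / (n%:R - 1) *
            (1 + \sum_(2 <= k < n.+1)
                   (\prod_((n.+2 - k)%N <= i < n.+1) D i) * delta ^+ (k - 1)))%:E)%E)
      /\
      ((forall j, symmetric_rv P (X j)) ->
       forall delta : R, Delta = delta%:E ->
         (chi2 P S <= (delta / (n%:R ^+ 2 - 1) *
            (1 + \sum_(2 <= k < n.+1)
                   (\prod_((n.+2 - k)%N <= i < n.+1) L i) * delta ^+ (k - 1)))%:E)%E).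
Proof.
have J12E i : ~~ J12 i.+2 = (0 < i)%N by case: i.
have JsymE i : ~~ Jsym i.+2 = ((0 < i)%N && ~~ odd i) by case: i => [|i] //=; rewrite /Jsym /= !negbK.
have J12_1 : J12 1 by [].
have Jsym_1 : Jsym 1 by [].
pose G := profile_sup R (limit_profile12 R).
pose K := profile_sup R (limit_profile_sym R).
have e1 := expRN1_le R.
have G_le : G <= 121829%:R / 100000%:R := profile_sup_le _ _ _ (limit_profile12_le R).
have K_le : K <= 58929%:R / 100000%:R := profile_sup_le _ _ _ (limit_profile_sym_le R).
(* Positivity of G and K is read off at x = 1, where the profiles equal 2 - 3/e and 1 - 2/e. *)
have G0 : 0 < G.
  apply: lt_le_trans (profile_le_sup _ _ _ (limit_profile12_le R) 1 ltr01).
  by rewrite /limit_profile12 divr1; lra.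
have K0 : 0 < K.
  apply: lt_le_trans (profile_le_sup _ _ _ (limit_profile_sym_le R) 1 ltr01).
  by rewrite /limit_profile_sym mulr1; lra.
have cG := cvg_CJ R J12 _ _ _ _ J12_1 J12E (cvg_hmajorant12 R) (hbound12_le R)
  (limit_profile12_le R) (cvg_hbound12 R).
have cK := cvg_CJ R Jsym _ _ _ _ Jsym_1 JsymE (cvg_hmajorant_sym R) (hbound_sym_le R)
  (limit_profile_sym_le R) (cvg_hbound_sym R).
have sG := sum_hterm_bound R J12 _ _ _ _ J12_1 J12E (cvg_hmajorant12 R) (hbound12_le R)
  (limit_profile12_le R).
have sK := sum_hterm_bound R Jsym _ _ _ _ Jsym_1 JsymE (cvg_hmajorant_sym R) (hbound_sym_le R)
  (limit_profile_sym_le R).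
exists (recursion_coef R G (weight12 R)), (recursion_coef R K (weight_sym R)).
split; first by move=> n _; split; apply: recursion_coef_gt0 => //; [exact: weight12_gt0|exact: weight_sym_gt0].
split; first by exists G; split; [exact: cvg_recursion_coef12|split; [exact: cG|lra]].
split; first by exists K; split; [exact: cvg_recursion_coef_sym|split; [exact: cK|lra]].
have inv01 (n : nat) : (2 <= n)%N -> 0 < (n%:R^-1 : R) < 1.
  by move=> n2; rewrite invr_gt0 ltr0n ltnW//= invf_lt1 ?ltr1n ?ltr0n// ltnW.
move=> d T P n X n2 indX EX EX2 S Delta.
split=> [|symX] delta Ddelta.
- have -> : delta / (n%:R - 1) = weight12 R n * delta.
    by rewrite /weight12 ltnNge n2 mulrC.
  apply: (chi2_le_of_weights R J12 G (weight12 R) G0 (weight12_gt0 R) _ _ sG) => //.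
  + move=> M m m2; apply: le_trans (geometric_sum12 R _ M (inv01 m m2)) _.
    rewrite /weight12 ltnNge m2/= le_eqVlt; apply/orP; left; apply/eqP.
    have m1 : 1 < m%:R :> R by rewrite ltr1n.
    move: (m%:R : R) m1 => x x1; field; rewrite !gt_eqF//; lra.
  + move=> finX j k /orP[] /eqP ->; last exact: poly_mean_hermite2 (chi2_all_moments _ _ _ _ _ (finX j)) (EX2 j).
    exact: poly_mean_hermite1.
- have -> : delta / (n%:R ^+ 2 - 1) = weight_sym R n * delta.
    by rewrite /weight_sym ltnNge n2 mulrC.
  apply: (chi2_le_of_weights R Jsym K (weight_sym R) K0 (weight_sym_gt0 R) _ _ sK) => //.
  + move=> M m m2; apply: le_trans (geometric_sum_sym R _ M (inv01 m m2)) _.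
    rewrite /weight_sym ltnNge m2/= le_eqVlt; apply/orP; left; apply/eqP.
    have m1 : 1 < m%:R :> R by rewrite ltr1n.
    move: (m%:R : R) m1 => x x1; field; rewrite !gt_eqF//; nra.
  + move=> finX j k /orP[/eqP ->|k1].
      exact: poly_mean_hermite2 (chi2_all_moments _ _ _ _ _ (finX j)) (EX2 j).
    exact: poly_mean_hermite_odd (chi2_all_moments _ _ _ _ _ (finX j)) k (symX j) k1.
Qed.
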